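(* Let $0<q<1$, let $\mathcal{U}=\mathcal{U}_q(su_2)$, $\mathcal{A}=\mathcal{O}(SU_q(2))$, and let $\mathcal{U}\ltimes\mathcal{A}$ be their right cross product $*$-algebra. Let $\pi_h$ be the Heisenberg representation of $\mathcal{U}\ltimes\mathcal{A}$. (i) Let $\pi$ be a closed $*$-representation of $\mathcal{U}\ltimes\mathcal{A}$ such that the restriction of $\pi$ to $\mathcal{U}$ is integrable. Then $\pi$ is unitarily equivalent to a direct sum of copies of the Heisenberg representation $\pi_h$. (ii) The Heisenberg representation $\pi_h$ of $\mathcal{U}\ltimes\mathcal{A}$ is irreducible and its restriction to $\mathcal{U}$ is an integrable representation.
   Context: Fix $0<q<1$, $\lambda=q-q^{-1}$, $[k]_q=\lambda^{-1}(q^k-q^{-k})$. **Algebras.** $\mathcal{U}_q(su_2)$ is the Hopf $*$-algebra with generators $E,F,K,K^{-1}$ and relations $KK^{-1}=K^{-1}K=1$, $KEK^{-1}=qE$, $KFK^{-1}=q^{-1}F$, $EF-FE=\lambda^{-1}(K^2-K^{-2})$; $\Delta(E)=E\otimes K+K^{-1}\otimes E$, $\Delta(F)=F\otimes K+K^{-1}\otimes F$, $\Delta(K)=K\otimes K$; $\varepsilon(E)=\varepsilon(F)=0$, $\varepsilon(K)=1$; $S(E)=-qE$, $S(F)=-q^{-1}F$, $S(K)=K^{-1}$; $E^*=F$, $K^*=K$. $\mathcal{O}(SU_q(2))$ is the unital $*$-algebra with generators $a,b,c,d$, relations $ab=qba$, $ac=qca$, $bd=qdb$, $cd=qdc$,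 $bc=cb$, $ad-da=\lambda bc$, $ad-qbc=1$, and involution $a^*=d$, $b^*=-qc$. $\mathcal{A}=\mathcal{O}(SU_q(2))$ is a right $\mathcal{U}$-module $*$-algebra: the right action $\triangleleft$ satisfies $(xy)\triangleleft f=(x\triangleleft f_{(1)})(y\triangleleft f_{(2)})$ and $1\triangleleft f=\varepsilon(f)1$, and is determined by $a\triangleleft E=b\triangleleft E=0$, $c\triangleleft E=a$, $d\triangleleft E=b$; $a\triangleleft F=c$, $b\triangleleft F=d$, $c\triangleleft F=d\triangleleft F=0$; $a\triangleleft K=q^{-1/2}a$, $b\triangleleft K=q^{-1/2}b$, $c\triangleleft K=q^{1/2}c$, $d\triangleleft K=q^{1/2}d$. The right cross product $*$-algebra $\mathcal{U}\ltimes\mathcal{A}$ is the vector space $\mathcal{U}\otimes\mathcal{A}$ with product $(g\otimes x)(f\otimes y)=gf_{(1)}\otimes(x\triangleleft f_{(2)})y$ and involution $(f\otimes x)^*=f^*_{(1)}\otimes(x^*\triangleleft f^*_{(2)})$. Equivalently, it is generated by its $*$-subalgebras $\mathcal{U}$, $\mathcal{A}$ with cross relations $xf=f_{(1)}(x\triangleleft f_{(2)})$. **Representations.** A $*$-representation of a $*$-algebra $\mathcal{X}$ on a dense linear subspace $\mathcal{D}$ of a Hilbert space is a homomorphism $\pi$ of $\mathcal{X}$ into the algebra of linear operators mapping $\mathcal{D}$ into itself with $\langle\pi(x)\eta,\xi\rangle=\langle\eta,\pi(x^* )\xi\rangle$ for $x\in\mathcal{X}$, $\eta,\xi\in\mathcal{D}$.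 It is closed if $\mathcal{D}=\bigcap_{x}\mathcal{D}(\overline{\pi(x)})$; its closure is the $*$-representation $x\mapsto\overline{\pi(x)}$ restricted to $\bigcap_x\mathcal{D}(\overline{\pi(x)})$. The direct sum of $*$-representations $\pi_i$ on $\mathcal{D}_i\subseteq\mathcal{H}_i$ acts componentwise on the domain of all $(\eta_i)\in\bigoplus_i\mathcal{H}_i$ with $\eta_i\in\mathcal{D}_i$ and $\sum_i\|\pi_i(x)\eta_i\|^2<\infty$ for all $x\in\mathcal{X}$. A closed $*$-representation is irreducible if it is not a direct sum of two $*$-representations on non-zero Hilbert spaces. **Integrability.** For $l\in\frac12\mathbb{N}_0$, $T_l$ is the $*$-representation of $\mathcal{U}_q(su_2)$ on the $(2l+1)$-dimensional Hilbert space with orthonormal basis $e_{-l},e_{-l+1},\dots,e_l$ given by $T_l(K)e_j=q^je_j$, $T_l(E)e_j=\alpha_{j+1,l}e_{j+1}$, $T_l(F)e_j=\alpha_{j,l}e_{j-1}$, where $\alpha_{j,l}=([l+j]_q[l-j+1]_q)^{1/2}$ and $e_{l+1}=e_{-l-1}=0$. A closed $*$-representation of $\mathcal{U}_q(su_2)$ is integrable if it is (unitarily equivalent to) a direct sum of representations $T_l$, $l\in\frac12\mathbb{N}_0$, with arbitrary multiplicities. **Heisenberg representation.** There is a unique linear functional $h$ on $\mathcal{A}$ with $h(1)=1$ and $h(x\triangleleft f)=\varepsilon(f)h(x)$ for all $x\in\mathcal{A}$, $f\in\mathcal{U}$; it is a state (the Haar state). Let $\pi_h$ be its GNS representation on $\mathcal{D}_h=\pi_h(\mathcal{A})v_h$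 with cyclic vector $v_h$, $h(x)=\langle\pi_h(x)v_h,v_h\rangle$. There is a well-defined $*$-representation $\tilde\pi_h$ of $\mathcal{U}\ltimes\mathcal{A}$ on $\mathcal{D}_h$ with $\tilde\pi_h(x)=\pi_h(x)$ for $x\in\mathcal{A}$ and $\tilde\pi_h(f)\pi_h(x)v_h=\pi_h(x\triangleleft S^{-1}(f))v_h$ for $f\in\mathcal{U}$, $x\in\mathcal{A}$. Its closure, again denoted $\pi_h$, is the Heisenberg representation. *)

(* Defs.v *)
From HB Require Import structures.
From mathcomp Require Import all_boot all_order all_algebra.
From mathcomp Require Import sesquilinear complex ring.
From mathcomp Require Import all_classical all_reals all_analysis.

Set Implicit Arguments.
Unset Strict Implicit.
Unset Printing Implicit Defensive.

Import Order.TTheory GRing.Theory Num.Theory.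
Import numFieldNormedType.Exports.

Local Open Scope classical_set_scope.
Local Open Scope ring_scope.
Local Open Scope complex_scope.
Local Open Scope quotient_scope.


(* Complex Hilbert spaces. Sesquilinear forms of the library are linear in
   their first argument, as in h(x) = <pi_h(x) v_h, v_h>. *)
HB.mixin Record CompleteNormedModule_isHilbert (R : realType) H
    & CompleteNormedModule R[i] H := {
  hdot : {dot H for (@Num.conj R[i])};
  hdot_norm : forall u : H, hdot u u = `|u| ^+ 2
}.

#[short(type="hilbertType")]
HB.structure Definition Hilbert (R : realType) :=
  {H of CompleteNormedModule R[i] H & CompleteNormedModule_isHilbert R H}.

HB.mixin Record isStarAlgebra (R : realType) A & GRing.Algebra R[i] A := {
  star : A -> A;
  starD : {morph star : x y / x + y};
  starZ : forall (c : R[i]) (x : A), star (c *: x) = c^*%R *: star x;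
  starM : forall x y : A, star (x * y) = star y * star x;
  starK : involutive star
}.

#[short(type="starAlgType")]
HB.structure Definition StarAlgebra (R : realType) :=
  {A of GRing.Algebra R[i] A & isStarAlgebra R A}.

(* Expressions in generators G with coefficients in C; they represent the
   elements of the free unital C-algebra on G. *)
Inductive ncpoly (C G : Type) : Type :=
| NCgen of G
| NCconst of C
| NCadd of ncpoly C G & ncpoly C G
| NCmul of ncpoly C G & ncpoly C G.
Arguments NCgen {C G}.
Arguments NCconst {C G}.

Declare Scope nc_scope.
Delimit Scope nc_scope with nc.
Bind Scope nc_scope with ncpoly.
Notation "x + y" := (NCadd x y) : nc_scope.
Notation "x * y" := (NCmul x y) : nc_scope.
Notation "c *: x" := (NCmul (NCconst c%R) x) : nc_scope.
Notation "x - y" := (NCadd x (NCmul (NCconst (-1)%R) y)) : nc_scope.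
Notation "0" := (NCconst 0%R) : nc_scope.
Notation "1" := (NCconst 1%R) : nc_scope.

HB.instance Definition _ C G := gen_eqMixin (ncpoly C G).
HB.instance Definition _ C G := gen_choiceMixin (ncpoly C G).

Section Presentation.
Variable R : realType.
Local Notation C := R[i].

Fixpoint nc_map (G1 G2 : Type) (f : G1 -> G2) (t : ncpoly C G1) :
    ncpoly C G2 :=
  match t with
  | NCgen g => NCgen (f g)
  | NCconst c => NCconst c
  | NCadd t u => (nc_map f t + nc_map f u)%nc
  | NCmul t u => (nc_map f t * nc_map f u)%nc
  end.

Fixpoint nc_star (G : Type) (s : G -> ncpoly C G) (t : ncpoly C G) :
    ncpoly C G :=
  match t with
  | NCgen g => s g
  | NCconst c => NCconst c^*%R
  | NCadd t u => (nc_star s t + nc_star s u)%nc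
  | NCmul t u => (nc_star s u * nc_star s t)%nc
  end.

(* The character of the free algebra with values f on the generators. *)
Fixpoint nc_char (G : Type) (f : G -> C) (t : ncpoly C G) : C :=
  match t with
  | NCgen g => f g
  | NCconst c => c
  | NCadd t u => nc_char f t + nc_char f u
  | NCmul t u => nc_char f t * nc_char f u
  end.

Definition nc_sum (G : Type) (s : seq (ncpoly C G)) : ncpoly C G :=
  foldr (@NCadd C G) (NCconst 0) s.

(* The congruence generated by the algebra axioms, the relations rel and the
   images of rel under the involution determined by s. The quotient is the
   universal unital *-algebra with these generators and relations; for the
   algebras below the relations imply their own images, so nc_relstar does not
   change the ideal. *)
Inductive nc_cong (G : Type) (s : G -> ncpoly C G)
    (rel : ncpoly C G -> ncpoly C G -> Prop) :
    ncpoly C G -> ncpoly C G -> Prop :=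
| nc_rel t u : rel t u -> nc_cong s rel t u
| nc_relstar t u : rel t u -> nc_cong s rel (nc_star s t) (nc_star s u)
| nc_refl t : nc_cong s rel t t
| nc_sym t u : nc_cong s rel t u -> nc_cong s rel u t
| nc_trans t u v : nc_cong s rel t u -> nc_cong s rel u v -> nc_cong s rel t v
| nc_add t t' u u' : nc_cong s rel t t' -> nc_cong s rel u u' ->
    nc_cong s rel (t + u)%nc (t' + u')%nc
| nc_mul t t' u u' : nc_cong s rel t t' -> nc_cong s rel u u' ->
    nc_cong s rel (t * u)%nc (t' * u')%nc
| nc_addC t u : nc_cong s rel (t + u)%nc (u + t)%nc
| nc_addA t u v : nc_cong s rel (t + (u + v))%nc ((t + u) + v)%nc
| nc_add0 t : nc_cong s rel (0 + t)%nc t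
| nc_addN t : nc_cong s rel (-1 *: t + t)%nc 0%nc
| nc_mulA t u v : nc_cong s rel (t * (u * v))%nc ((t * u) * v)%nc
| nc_mul1l t : nc_cong s rel (1 * t)%nc t
| nc_mul1r t : nc_cong s rel (t * 1)%nc t
| nc_mulDl t u v : nc_cong s rel ((t + u) * v)%nc (t * v + u * v)%nc
| nc_mulDr t u v : nc_cong s rel (t * (u + v))%nc (t * u + t * v)%nc
| nc_constD c d : nc_cong s rel (NCconst (c + d)) (NCconst c + NCconst d)%nc
| nc_constM c d : nc_cong s rel (NCconst (c * d)) (NCconst c * NCconst d)%nc
| nc_constC c t : nc_cong s rel (NCconst c * t)%nc (t * NCconst c)%nc.

Lemma nc_char_star (G : Type) (s : G -> ncpoly C G) (f : G -> C) :
  (forall g, nc_char f (s g) = (f g)^*%R) ->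
  forall t, nc_char f (nc_star s t) = (nc_char f t)^*%R.
Proof.
move=> fs; elim=> [g|c|t IHt u IHu|t IHt u IHu] //=.
- by rewrite IHt IHu rmorphD.
- by rewrite IHt IHu rmorphM mulrC.
Qed.

Lemma nc_char_cong (G : Type) (s : G -> ncpoly C G) rel (f : G -> C) :
  (forall g, nc_char f (s g) = (f g)^*%R) ->
  (forall t u, rel t u -> nc_char f t = nc_char f u) ->
  forall t u, nc_cong s rel t u -> nc_char f t = nc_char f u.
Proof.
move=> fs frel t u; elim=> {t u} //=.
- by move=> t u tu; rewrite !(nc_char_star fs) (frel _ _ tu).
- by move=> t u v _ -> _ ->.
- by move=> t t' u u' _ -> _ ->.
- by move=> t t' u u' _ -> _ ->.
- by move=> t u; rewrite addrC.
- by move=> t u v; rewrite addrA.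
- by move=> t; rewrite add0r.
- by move=> t; rewrite mulN1r addNr.
- by move=> t u v; rewrite mulrA.
- by move=> t; rewrite mul1r.
- by move=> t; rewrite mulr1.
- by move=> t u v; rewrite mulrDl.
- by move=> t u v; rewrite mulrDr.
- by move=> c t; rewrite mulrC.
Qed.

(* pnontrivial is there because algType only covers rings with 1 != 0. *)
Record presentation := Presentation {
  pgen : Type;
  pstar : pgen -> ncpoly C pgen;
  prel : ncpoly C pgen -> ncpoly C pgen -> Prop;
  pstarK : forall g,
    nc_cong pstar prel (nc_star pstar (pstar g)) (NCgen g);
  pnontrivial : ~ nc_cong pstar prel 1%nc 0%nc
}.

Variable P : presentation.
Local Notation term := (ncpoly C (pgen P)).
Local Notation "t ~~ u" := (nc_cong (@pstar P) (@prel P) t u) (at level 70).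

Definition pcongb (t u : term) : bool := `[< t ~~ u >].

Lemma pcongb_equiv : equiv_class_of pcongb.
Proof.
split=> [t|t u|u t v].
- exact/asboolP/nc_refl.
- by apply/asboolP/asboolP; exact: nc_sym.
- by move=> /asboolP tu /asboolP uv; apply/asboolP; exact: nc_trans uv.
Qed.

Canonical pcongb_equivRel := EquivRelPack pcongb_equiv.

Definition presented : Type := {eq_quot pcongb_equivRel}.
HB.instance Definition _ := EqQuotient.on presented.
HB.instance Definition _ := Choice.on presented.

Definition pclass (t : term) : presented := \pi_presented t.

Lemma pclassP t u : pclass t = pclass u <-> t ~~ u.
Proof.
split=> [/eqmodP/asboolP //|tu].
by apply/eqmodP/asboolP.
Qed.

Lemma pclassK (x : presented) : pclass (repr x) = x.
Proof. exact: reprK. Qed.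

Lemma pclass_repr t : repr (pclass t) ~~ t.
Proof. by apply/pclassP; rewrite pclassK. Qed.

Lemma pclass_ind (Q : presented -> Prop) :
  (forall t, Q (pclass t)) -> forall x, Q x.
Proof. by move=> H x; rewrite -(pclassK x). Qed.

Definition padd (x y : presented) := pclass (repr x + repr y)%nc.
Definition popp (x : presented) := pclass (NCconst (-1) * repr x)%nc.
Definition pmul (x y : presented) := pclass (repr x * repr y)%nc.
Definition pscale (c : C) (x : presented) := pclass (NCconst c * repr x)%nc.
Definition pstarq (x : presented) := pclass (nc_star (@pstar P) (repr x)).

Lemma paddE t u : padd (pclass t) (pclass u) = pclass (t + u)%nc.
Proof. by apply/pclassP; apply: nc_add; exact: pclass_repr. Qed.
Lemma pmulE t u : pmul (pclass t) (pclass u) = pclass (t * u)%nc.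
Proof. by apply/pclassP; apply: nc_mul; exact: pclass_repr. Qed.
Lemma poppE t : popp (pclass t) = pclass (NCconst (-1) * t)%nc.
Proof. by apply/pclassP; apply: nc_mul; [exact: nc_refl|exact: pclass_repr]. Qed.
Lemma pscaleE c t : pscale c (pclass t) = pclass (NCconst c * t)%nc.
Proof. by apply/pclassP; apply: nc_mul; [exact: nc_refl|exact: pclass_repr]. Qed.

Lemma paddA : associative padd.
Proof.
elim/pclass_ind=> t; elim/pclass_ind=> u; elim/pclass_ind=> v.
by rewrite !paddE; apply/pclassP/nc_addA.
Qed.
Lemma paddC : commutative padd.
Proof.
elim/pclass_ind=> t; elim/pclass_ind=> u.
by rewrite !paddE; apply/pclassP/nc_addC.
Qed.
Lemma padd0 : left_id (pclass 0%nc) padd.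
Proof. by elim/pclass_ind=> t; rewrite paddE; apply/pclassP/nc_add0. Qed.
Lemma pmulA : associative pmul.
Proof.
elim/pclass_ind=> t; elim/pclass_ind=> u; elim/pclass_ind=> v.
by rewrite !pmulE; apply/pclassP/nc_mulA.
Qed.
Lemma pmul1r : left_id (pclass 1%nc) pmul.
Proof. by elim/pclass_ind=> t; rewrite pmulE; apply/pclassP/nc_mul1l. Qed.
Lemma pmulr1 : right_id (pclass 1%nc) pmul.
Proof. by elim/pclass_ind=> t; rewrite pmulE; apply/pclassP/nc_mul1r. Qed.
Lemma pmulDl : left_distributive pmul padd.
Proof.
elim/pclass_ind=> t; elim/pclass_ind=> u; elim/pclass_ind=> v.
by rewrite !(pmulE, paddE); apply/pclassP/nc_mulDl.
Qed.
Lemma pmulDr : right_distributive pmul padd.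
Proof.
elim/pclass_ind=> t; elim/pclass_ind=> u; elim/pclass_ind=> v.
by rewrite !(pmulE, paddE); apply/pclassP/nc_mulDr.
Qed.

Lemma paddN : left_inverse (pclass 0%nc) popp padd.
Proof. by elim/pclass_ind=> t; rewrite poppE paddE; apply/pclassP/nc_addN. Qed.

Lemma p1neq0 : pclass 1%nc != pclass 0%nc.
Proof. by apply/eqP => /pclassP; exact: pnontrivial. Qed.

HB.instance Definition _ :=
  GRing.isZmodule.Build presented paddA paddC padd0 paddN.
HB.instance Definition _ := GRing.Zmodule_isNzRing.Build presented
  pmulA pmul1r pmulr1 pmulDl pmulDr p1neq0.

Lemma pclassD t u : pclass (t + u)%nc = pclass t + pclass u.
Proof. exact/esym/paddE. Qed.
Lemma pclassM t u : pclass (t * u)%nc = pclass t * pclass u.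
Proof. exact/esym/pmulE. Qed.

Lemma pscaleM (c : C) x : pscale c x = (pclass (NCconst c) : presented) * x.
Proof. by elim/pclass_ind: x => t; rewrite pscaleE pclassM. Qed.
Lemma pconstD c d :
  pclass (NCconst (c + d)) = (pclass (NCconst c) + pclass (NCconst d) : presented).
Proof. by rewrite -pclassD; apply/pclassP; exact: nc_constD. Qed.
Lemma pconstM c d :
  pclass (NCconst (c * d)) = (pclass (NCconst c) * pclass (NCconst d) : presented).
Proof. by rewrite -pclassM; apply/pclassP; exact: nc_constM. Qed.
Lemma pconstC c (x : presented) : pclass (NCconst c) * x = x * pclass (NCconst c).
Proof.
by elim/pclass_ind: x => t; rewrite -!pclassM; apply/pclassP; exact: nc_constC.
Qed.

Lemma pscaleA a b x : pscale a (pscale b x) = pscale (a * b) x.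
Proof. by rewrite !pscaleM mulrA pconstM. Qed.
Lemma pscale1 : left_id 1 pscale.
Proof. by move=> x; rewrite pscaleM mul1r. Qed.
Lemma pscaleDr : right_distributive pscale +%R.
Proof. by move=> a x y; rewrite !pscaleM mulrDr. Qed.
Lemma pscaleDl x : {morph pscale^~ x : a b / a + b}.
Proof. by move=> a b; rewrite !pscaleM pconstD mulrDl. Qed.

HB.instance Definition _ := GRing.Zmodule_isLmodule.Build C presented
  pscaleA pscale1 pscaleDr pscaleDl.

Lemma pscaleAl (a : C) (x y : presented) : a *: (x * y) = (a *: x) * y.
Proof. by rewrite /GRing.scale/= !pscaleM mulrA. Qed.
HB.instance Definition _ := GRing.Lmodule_isLalgebra.Build C presented pscaleAl.
Lemma pscaleAr (a : C) (x y : presented) : a *: (x * y) = x * (a *: y).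
Proof. by rewrite /GRing.scale/= !pscaleM !mulrA pconstC. Qed.
HB.instance Definition _ := GRing.Lalgebra_isAlgebra.Build C presented pscaleAr.

Lemma pclassZ c t : pclass (NCconst c * t)%nc = c *: pclass t.
Proof. by rewrite -pscaleE. Qed.
Lemma pclass_const c : pclass (NCconst c) = c%:A.
Proof. by rewrite -pclassZ; apply/esym/pclassP/nc_mul1r. Qed.
Lemma pclass_sum s : pclass (nc_sum s) = \sum_(t <- s) pclass t.
Proof.
elim: s => [|t s IHs]; first by rewrite big_nil.
by rewrite big_cons -IHs -pclassD.
Qed.

Lemma nc_star_invol t : nc_star (@pstar P) (nc_star (@pstar P) t) ~~ t.
Proof.
elim: t => [g|c|t IHt u IHu|t IHt u IHu] /=.
- exact: pstarK.
- by rewrite conjCK; exact: nc_refl.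
- exact: nc_add.
- exact: nc_mul.
Qed.

Lemma nc_star_cong t u : t ~~ u -> nc_star (@pstar P) t ~~ nc_star (@pstar P) u.
Proof.
elim=> {t u} //=.
- by move=> t u tu; exact: nc_relstar.
- move=> t u tu; apply: nc_trans (nc_star_invol t) _.
  by apply: nc_trans (nc_sym (nc_star_invol u)); exact: nc_rel.
- by move=> *; exact: nc_refl.
- by move=> *; exact: nc_sym.
- by move=> t u v _ tu _; exact: nc_trans tu.
- by move=> *; exact: nc_add.
- by move=> *; exact: nc_mul.
- by move=> *; exact: nc_addC.
- by move=> *; exact: nc_addA.
- by move=> *; rewrite rmorph0; exact: nc_add0.
- move=> t; rewrite rmorphN1 rmorph0.
  apply: nc_trans (nc_addN _ _ (nc_star (@pstar P) t)).
  by apply: nc_add (nc_refl _ _ _); apply: nc_sym; exact: nc_constC.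
- by move=> *; apply: nc_sym; exact: nc_mulA.
- by move=> *; rewrite rmorph1; exact: nc_mul1r.
- by move=> *; rewrite rmorph1; exact: nc_mul1l.
- by move=> *; exact: nc_mulDr.
- by move=> *; exact: nc_mulDl.
- by move=> *; rewrite rmorphD; exact: nc_constD.
- by move=> *; rewrite rmorphM mulrC; exact: nc_constM.
- by move=> *; apply: nc_sym; exact: nc_constC.
Qed.

Lemma pstarE t : pstarq (pclass t) = pclass (nc_star (@pstar P) t).
Proof. by apply/pclassP/nc_star_cong/pclass_repr. Qed.

Lemma pstarD : {morph pstarq : x y / x + y}.
Proof.
elim/pclass_ind=> t; elim/pclass_ind=> u.
by rewrite -pclassD !pstarE -pclassD.
Qed.
Lemma pstarM x y : pstarq (x * y) = pstarq y * pstarq x.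
Proof.
elim/pclass_ind: x => t; elim/pclass_ind: y => u.
by rewrite -pclassM !pstarE -pclassM.
Qed.
Lemma pstarZ c x : pstarq (c *: x) = c^*%R *: pstarq x.
Proof.
elim/pclass_ind: x => t.
rewrite -pclassZ !pstarE -pclassZ /=; apply/pclassP/nc_sym/nc_constC.
Qed.
Lemma pstar_invol : involutive pstarq.
Proof. by elim/pclass_ind=> t; rewrite !pstarE; apply/pclassP/nc_star_invol. Qed.

HB.instance Definition _ := isStarAlgebra.Build R presented
  pstarD pstarZ pstarM pstar_invol.

Lemma starE t : star (pclass t) = pclass (nc_star (@pstar P) t).
Proof. exact: pstarE. Qed.

End Presentation.

(* genKi is K^-1. *)
Inductive uqgen := genE | genF | genK | genKi.
Inductive oqgen := gena | genb | genc | gend.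

Section QuantumSU2.
Variables (R : realType) (q : R).
Local Notation C := R[i].
Local Notation "'E" := (@NCgen C _ genE) : nc_scope.
Local Notation "'F" := (@NCgen C _ genF) : nc_scope.
Local Notation "'K" := (@NCgen C _ genK) : nc_scope.
Local Notation "'Ki" := (@NCgen C _ genKi) : nc_scope.
Local Notation "'a" := (@NCgen C _ gena) : nc_scope.
Local Notation "'b" := (@NCgen C _ genb) : nc_scope.
Local Notation "'c" := (@NCgen C _ genc) : nc_scope.
Local Notation "'d" := (@NCgen C _ gend) : nc_scope.

Definition qlam : R := q - q^-1.

Inductive uq_rel : ncpoly C uqgen -> ncpoly C uqgen -> Prop :=
| uq_KKi : uq_rel ('K * 'Ki) 1
| uq_KiK : uq_rel ('Ki * 'K) 1
| uq_KEKi : uq_rel ('K * 'E * 'Ki) (q%:C *: 'E)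
| uq_KFKi : uq_rel ('K * 'F * 'Ki) (q^-1%:C *: 'F)
| uq_EF : uq_rel ('E * 'F - 'F * 'E)
                 (qlam^-1%:C *: ('K * 'K - 'Ki * 'Ki)).

Definition uq_star (g : uqgen) : ncpoly C uqgen :=
  match g with
  | genE => 'F
  | genF => 'E
  | genK => 'K
  | genKi => 'Ki
  end%nc.

Definition uq_coprod_gen (g : uqgen) : seq (uqgen * uqgen) :=
  match g with
  | genE => [:: (genE, genK); (genKi, genE)]
  | genF => [:: (genF, genK); (genKi, genF)]
  | genK => [:: (genK, genK)]
  | genKi => [:: (genKi, genKi)]
  end.

Definition uq_counit_gen (g : uqgen) : C :=
  match g with genE | genF => 0 | genK | genKi => 1 end.

Definition uq_antip_gen (g : uqgen) : ncpoly C uqgen :=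
  match g with
  | genE => - q%:C *: 'E
  | genF => - q^-1%:C *: 'F
  | genK => 'Ki
  | genKi => 'K
  end%nc.

Definition uq_antipV_gen (g : uqgen) : ncpoly C uqgen :=
  match g with
  | genE => - q^-1%:C *: 'E
  | genF => - q%:C *: 'F
  | genK => 'Ki
  | genKi => 'K
  end%nc.

(* The list of the pairs (f_(1), f_(2)) in a representation of Delta(f) as a
   sum of elementary tensors. *)
Fixpoint uq_coprod_nc (f : ncpoly C uqgen) :
    seq (ncpoly C uqgen * ncpoly C uqgen) :=
  match f with
  | NCgen g => [seq (NCgen p.1, NCgen p.2) | p <- uq_coprod_gen g]
  | NCconst c => [:: (NCconst c, 1%nc)]
  | NCadd f g => uq_coprod_nc f ++ uq_coprod_nc g
  | NCmul f g => [seq (p.1 * r.1, p.2 * r.2)%nc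
                   | p <- uq_coprod_nc f, r <- uq_coprod_nc g]
  end.

(* The linear antimultiplicative extension of s. *)
Fixpoint nc_anti (G : Type) (s : G -> ncpoly C G) (t : ncpoly C G) :
    ncpoly C G :=
  match t with
  | NCgen g => s g
  | NCconst c => NCconst c
  | NCadd t u => (nc_anti s t + nc_anti s u)%nc
  | NCmul t u => (nc_anti s u * nc_anti s t)%nc
  end.

Inductive oq_rel : ncpoly C oqgen -> ncpoly C oqgen -> Prop :=
| oq_ab : oq_rel ('a * 'b) (q%:C *: ('b * 'a))
| oq_ac : oq_rel ('a * 'c) (q%:C *: ('c * 'a))
| oq_bd : oq_rel ('b * 'd) (q%:C *: ('d * 'b))
| oq_cd : oq_rel ('c * 'd) (q%:C *: ('d * 'c))
| oq_bc : oq_rel ('b * 'c) ('c * 'b)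
| oq_ad_da : oq_rel ('a * 'd - 'd * 'a) (qlam%:C *: ('b * 'c))
| oq_det : oq_rel ('a * 'd - q%:C *: ('b * 'c)) 1.

Definition oq_star (g : oqgen) : ncpoly C oqgen :=
  match g with
  | gena => 'd
  | genb => - q%:C *: 'c
  | genc => - q^-1%:C *: 'b
  | gend => 'a
  end%nc.

(* oq_act_gen, oq_act1 and oq_act_nc give the right action x <| f for
   successively more general x and f. *)
Definition oq_act_gen (x : oqgen) (g : uqgen) : ncpoly C oqgen :=
  match g, x with
  | genE, gena => 0 | genE, genb => 0 | genE, genc => 'a | genE, gend => 'b
  | genF, gena => 'c | genF, genb => 'd | genF, genc => 0 | genF, gend => 0
  | genK, (gena | genb) => (Num.sqrt q)^-1%:C *: NCgen x
  | genK, (genc | gend) => (Num.sqrt q)%:C *: NCgen x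
  | genKi, (gena | genb) => (Num.sqrt q)%:C *: NCgen x
  | genKi, (genc | gend) => (Num.sqrt q)^-1%:C *: NCgen x
  end%nc.

Fixpoint oq_act1 (t : ncpoly C oqgen) (g : uqgen) : ncpoly C oqgen :=
  match t with
  | NCgen x => oq_act_gen x g
  | NCconst c => uq_counit_gen g *: NCconst c
  | NCadd t u => oq_act1 t g + oq_act1 u g
  | NCmul t u =>
      nc_sum [seq oq_act1 t p.1 * oq_act1 u p.2 | p <- uq_coprod_gen g]
  end%nc.

Fixpoint oq_act_nc (t : ncpoly C oqgen) (f : ncpoly C uqgen) :
    ncpoly C oqgen :=
  match f with
  | NCgen g => oq_act1 t g
  | NCconst c => c *: t
  | NCadd f g => oq_act_nc t f + oq_act_nc t g
  | NCmul f g => oq_act_nc (oq_act_nc t f) g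
  end%nc.

Local Notation embU := (nc_map (@inl uqgen oqgen)).
Local Notation embO := (nc_map (@inr uqgen oqgen)).

(* uo_cross is the cross relation x f = f_(1) (x <| f_(2)), for all x and f. *)
Inductive uo_rel : ncpoly C (uqgen + oqgen) -> ncpoly C (uqgen + oqgen) ->
    Prop :=
| uo_uq f g : uq_rel f g -> uo_rel (embU f) (embU g)
| uo_oq x y : oq_rel x y -> uo_rel (embO x) (embO y)
| uo_cross x f : uo_rel (embO x * embU f)
    (nc_sum [seq (embU p.1 * embO (oq_act_nc x p.2))%nc
              | p <- uq_coprod_nc f]).

Definition uo_star (g : uqgen + oqgen) : ncpoly C (uqgen + oqgen) :=
  match g with
  | inl g => embU (uq_star g)
  | inr x => embO (oq_star x)
  end.

Hypothesis hq : 0 < q < 1.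

Lemma q_gt0 : 0 < q. Proof. by case/andP: hq. Qed.
Let q0 : q != 0. Proof. by rewrite gt_eqF ?q_gt0. Qed.

Lemma conj_rc (x : R) : (x%:C)^*%R = x%:C :> C.
Proof. exact: conjc_real. Qed.

Lemma uq_starK g : nc_star uq_star (uq_star g) = NCgen g.
Proof. by case: g. Qed.

Lemma conj_Nrc (x : R) : (- x%:C)^*%R = - x%:C :> C.
Proof. by rewrite rmorphN /= conj_rc. Qed.

Lemma rcM (x y : R) : (x * y)%:C = x%:C * y%:C :> C.
Proof. by rewrite rmorphM. Qed.

Lemma nc_swap_scale (G : Type) s rel (c d : C) (g : G) : c * d = 1 ->
  nc_cong s rel (c *: NCgen g * NCconst d)%nc (NCgen g).
Proof.
move=> cd; apply: nc_trans (nc_sym (nc_constC _ _ _ _)) _.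
apply: nc_trans (nc_mulA _ _ _ _ _) _.
apply: nc_trans (nc_mul (nc_sym (nc_constM _ _ _ _)) (nc_refl _ _ _)) _.
by rewrite mulrC cd; exact: nc_mul1l.
Qed.

Lemma oq_starK rel g : nc_cong oq_star rel (nc_star oq_star (oq_star g)) (NCgen g).
Proof.
case: g => /=; try exact: nc_refl; rewrite conj_Nrc; apply: nc_swap_scale;
  by rewrite mulrNN -rcM ?mulVf ?mulfV.
Qed.

Lemma uq_counit_rel f g : uq_rel f g ->
  nc_char uq_counit_gen f = nc_char uq_counit_gen g.
Proof. by case=> /=; rewrite ?(mulr1, mulr0, subrr, addr0, mulN1r, mul0r, oppr0). Qed.
Lemma uq_counit_star g : nc_char uq_counit_gen (uq_star g) = (uq_counit_gen g)^*%R.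
Proof. by case: g => /=; rewrite ?rmorph0 ?rmorph1. Qed.
Definition uq_counit_cong := nc_char_cong uq_counit_star uq_counit_rel.

Lemma uq_nontrivial : ~ nc_cong uq_star uq_rel 1%nc 0%nc.
Proof. by move=> /uq_counit_cong/eqP; rewrite /= oner_eq0. Qed.

Definition oq_counit_gen (x : oqgen) : C :=
  match x with gena | gend => 1 | genb | genc => 0 end.
Lemma oq_nontrivial : ~ nc_cong oq_star oq_rel 1%nc 0%nc.
Proof.
move=> H.
have : nc_char oq_counit_gen 1%nc = nc_char oq_counit_gen 0%nc.
  apply: nc_char_cong H => [[]|t u []] /=;
  by rewrite ?(rmorph0, rmorph1, mulr1, mulr0, subrr, addr0, mulN1r, mul0r, oppr0).
by move/eqP; rewrite /= oner_eq0.
Qed.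

Definition uq_pres := Presentation
  (fun g => eq_rect_r (nc_cong uq_star uq_rel ^~ (NCgen g))
     (nc_refl _ _ _) (uq_starK g)) uq_nontrivial.
Definition oq_pres := Presentation (@oq_starK oq_rel) oq_nontrivial.

Section OqAction.
Local Notation pcl := (@pclass R oq_pres).
Local Notation A := (presented oq_pres).
Let a : A := pcl 'a%nc.
Let b : A := pcl 'b%nc.
Let c : A := pcl 'c%nc.
Let d : A := pcl 'd%nc.
Let p : C := (Num.sqrt q)%:C.

Lemma sqrtq_neq0 : Num.sqrt q != 0.
Proof. by rewrite gt_eqF// sqrtr_gt0 q_gt0. Qed.
Let p0 : p != 0. Proof. by rewrite -(rmorph0 (real_complex R)) (inj_eq (@complexI R)) sqrtq_neq0. Qed.
Let qE : q%:C = p * p. Proof. by rewrite -rcM -expr2 sqr_sqrtr// ltW ?q_gt0. Qed.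
Let pV : (Num.sqrt q)^-1%:C = p^-1.
Proof. by rewrite rmorphV ?unitfE ?sqrtq_neq0. Qed.
Let qV : q^-1%:C = p^-1 * p^-1.
Proof. by rewrite rmorphV ?unitfE//= qE invfM. Qed.
Let lamE : qlam%:C = p * p - p^-1 * p^-1.
Proof. by rewrite rmorphB/= qE qV. Qed.

Definition oq_cE := (@pclassZ R oq_pres, @pclassD R oq_pres, @pclassM R oq_pres,
   @pclass_const R oq_pres).


Let relE t u : oq_rel t u -> pcl t = pcl u.
Proof. by move=> tu; apply/pclassP; exact: nc_rel. Qed.

Let ba : b * a = (p^-1 * p^-1) *: (a * b).
Proof.
have := relE oq_ab; rewrite !oq_cE -/a -/b qE => ->.
by rewrite scalerA mulrACA !mulVf // mulr1 scale1r.
Qed.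
Let ca : c * a = (p^-1 * p^-1) *: (a * c).
Proof.
have := relE oq_ac; rewrite !oq_cE -/a -/c qE => ->.
by rewrite scalerA mulrACA !mulVf // mulr1 scale1r.
Qed.
Let db : d * b = (p^-1 * p^-1) *: (b * d).
Proof.
have := relE oq_bd; rewrite !oq_cE -/d -/b qE => ->.
by rewrite scalerA mulrACA !mulVf // mulr1 scale1r.
Qed.
Let dc : d * c = (p^-1 * p^-1) *: (c * d).
Proof.
have := relE oq_cd; rewrite !oq_cE -/c -/d qE => ->.
by rewrite scalerA mulrACA !mulVf // mulr1 scale1r.
Qed.
Let cb : c * b = b * c.
Proof. by have := relE oq_bc; rewrite !oq_cE -/b -/c => ->. Qed.
Let ad : a * d = 1 + (p * p) *: (b * c).
Proof.
have := relE oq_det; rewrite !oq_cE -/a -/b -/c -/d qE scale1r => <-.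
by rewrite scaleN1r subrK.
Qed.
Let da : d * a = 1 + (p^-1 * p^-1) *: (b * c).
Proof.
have := relE oq_ad_da; rewrite !oq_cE -/a -/b -/c -/d lamE scaleN1r => lE.
have -> : d * a = a * d - (a * d - d * a) by rewrite opprB addrC subrK.
by rewrite lE ad scalerBl opprB -addrA; congr (_ + _); rewrite addrC subrK.
Qed.

Local Notation act1 t g := (pcl (oq_act1 t g)).

Ltac nrm := rewrite ?(scale0r, scaler0, mul0r, mulr0, addr0, add0r, oppr0,
   mulr1, mul1r, scale1r, scaleN1r, scalerDr, scalerN, scalerA, mulrDl, mulrDr,
   =^~ scalerAl, =^~ scalerAr).

Let scale_eq0 (k : C) (x : A) : k = 0 -> k *: x = 0.
Proof. by move=> ->; rewrite scale0r. Qed.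
Let scale_eq1 (k l : C) (x : A) : k = 1 /\ l = 0 -> k%:A + l *: x = 1.
Proof. by case=> -> ->; rewrite scale0r addr0 scale1r. Qed.
Ltac fld := solve [ by [] | by field; rewrite ?p0 | split; by field; rewrite ?p0].

Lemma oq_act1_rel t u g : oq_rel t u -> act1 t g = act1 u g.
Proof.
case; case: g => /=; rewrite !(pV, qE, qV, lamE); rewrite !oq_cE -/a -/b -/c -/d; nrm.
all: rewrite ?(ba, ca, db, dc, cb, ad, da); nrm.
all: try by [].
all: rewrite -/p.
all: first
  [ congr (_ *: _); fld
  | rewrite -!scalerBl; congr (_ *: _); fld
  | rewrite -!scalerBl -(scale0r (0 : A)) scaler0; apply: scale_eq0; fld
  | rewrite addrCA -scalerDl -addrA -scalerDl; congr (_ *: _ + _ *: _); fld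
  | rewrite -addrA -scalerDl [RHS]addrCA -scalerDl; congr (_ *: _ + _ *: _); fld
  | rewrite opprD addrACA -!scalerBl mulrC subrr scale0r add0r;
    congr (_ *: _); fld
  | rewrite -addrA -scalerBl; apply: scale_eq1; fld
  ].
Qed.

End OqAction.
End QuantumSU2.

Notation Uqsu2 q := (presented (uq_pres q)).
Notation OSUq2 hq := (presented (oq_pres hq)).

Lemma star1 (R : realType) (A : starAlgType R) : star (1 : A) = 1.
Proof. by rewrite -[LHS]mulr1 -{2}(starK (1 : A)) -starM mulr1 starK. Qed.

Section OqAction.
Variables (R : realType) (q : R) (hq : 0 < q < 1).
Local Notation C := R[i].
Local Notation A := (OSUq2 hq).
Local Notation "[ t ]" := (@pclass R (oq_pres hq) t).

(* If oq_dual g = (c, g') then x^* <| g = c (x <| g')^*, which is the rule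
   (x <| f)^* = x^* <| S(f)^* on generators. *)
Definition oq_dual (g : uqgen) : C * uqgen :=
  match g with
  | genE => (- q%:C, genF)
  | genF => (- q^-1%:C, genE)
  | genK => (1, genKi)
  | genKi => (1, genK)
  end.

Let q0 : q%:C != 0 :> C.
Proof. by rewrite -(rmorph0 (real_complex R)) (inj_eq (@complexI R)) gt_eqF ?(q_gt0 hq). Qed.
Let qV : q^-1%:C = q%:C^-1 :> C.
Proof. by rewrite rmorphV// unitfE gt_eqF ?(q_gt0 hq). Qed.

Lemma oq_act1_star t g :
  [oq_act1 q (nc_star (oq_star q) t) g] =
  (oq_dual g).1 *: star [oq_act1 q t (oq_dual g).2].
Proof.
elim: t g => [x|c|t IHt u IHu|t IHt u IHu] g /=.
- rewrite starE; case: x; case: g => /=;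
  rewrite ?(oq_cE, conj_rc, conj_Nrc, rmorphN, rmorph0, rmorph1, scale0r, mul0r,
    scaler0, addr0, add0r, mulr0, mulr1, mul1r, scale1r,
    =^~ scalerAl, =^~ scalerAr, scalerA, oppr0) //.
- by rewrite mulrNN qV mulfV// scale1r.
- by rewrite mulrNN qV mulVf// scale1r.
- rewrite !(oq_cE hq) starZ starZ star1.
  by case: g; rewrite /= ?rmorph0 ?rmorph1 ?scale0r ?scaler0 ?scale1r.
- by rewrite !(oq_cE hq) IHt IHu starD scalerDr.
- by case: g; rewrite /= !(oq_cE hq) !scale0r ?addr0 ?IHt ?IHu ?starD ?starM /=
    ?scale1r // -?scalerAl -?scalerAr ?scale1r scalerDr addrC.
Qed.

Lemma oq_act1_cong t u g : nc_cong (oq_star q) (oq_rel q) t u ->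
  [oq_act1 q t g] = [oq_act1 q u g].
Proof.
move=> tu; elim: tu g => {t u} /=.
- by move=> t u tu g; exact: oq_act1_rel.
- by move=> t u tu g; rewrite !oq_act1_star (oq_act1_rel hq _ tu).
- by [].
- by move=> t u _ IH g; rewrite IH.
- by move=> t u v _ IH _ IH' g; rewrite IH IH'.
- by move=> t t' u u' _ IH _ IH' g; rewrite !(oq_cE hq) IH IH'.
- move=> t t' u u' _ IH _ IH' g.
  by case: g; rewrite /= !(oq_cE hq) ?IH ?IH'.
- by move=> t u g; rewrite !(oq_cE hq) addrC.
- by move=> t u v g; rewrite !(oq_cE hq) addrA.
- by move=> t g; rewrite !(oq_cE hq) scale0r scaler0 add0r.
- move=> t; case; rewrite /= !(oq_cE hq) ?scale0r ?mul0r ?addr0 ?add0r ?scale1r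
    ?scaleN1r ?mulN1r ?addNr ?scaler0 //.
- by move=> t u v; case; rewrite /= !(oq_cE hq) !scale0r !addr0 ?mulrDl ?mulrDr
    ?mulrA ?addrA.
- by move=> t; case; rewrite /= !(oq_cE hq) !scale0r ?addr0 ?scale1r ?mul1r
    ?mul0r ?addr0 ?add0r.
- by move=> t; case; rewrite /= !(oq_cE hq) !scale0r ?addr0 ?scale1r ?mulr1
    ?mulr0 ?addr0 ?add0r.
- by move=> t u v; case; rewrite /= !(oq_cE hq) !scale0r !addr0 ?mulrDl //
    addrACA.
- by move=> t u v; case; rewrite /= !(oq_cE hq) !scale0r !addr0 ?mulrDr //
    addrACA.
- by move=> c d g; rewrite !(oq_cE hq) scalerDl scalerDr.
- by move=> c d; case; rewrite /= !(oq_cE hq) !scale0r ?mul0r ?mulr0 ?addr0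
    ?scale1r -?scalerAl ?mul1r ?scalerA ?mul0r.
- by move=> c t; case; rewrite /= !(oq_cE hq) !scale0r ?mul0r ?mulr0 ?addr0
    ?add0r ?scale1r -?scalerAl -?scalerAr ?mul1r ?mulr1.
Qed.

(* x <| g for a generator g; oq_op f below is x |-> x <| f. *)
Definition oq_del (g : uqgen) (x : A) : A := [oq_act1 q (repr x) g].

Lemma oq_delE g t : oq_del g [t] = [oq_act1 q t g].
Proof. by apply: oq_act1_cong; exact: (@pclass_repr R (oq_pres hq) t). Qed.

Lemma oq_delD g x y : oq_del g (x + y) = oq_del g x + oq_del g y.
Proof.
elim/pclass_ind: x => t; elim/pclass_ind: y => u.
by rewrite -pclassD !oq_delE /= pclassD.
Qed.

Lemma oq_delM g x y : oq_del g (x * y) =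
  \sum_(p <- uq_coprod_gen g) oq_del p.1 x * oq_del p.2 y.
Proof.
elim/pclass_ind: x => t; elim/pclass_ind: y => u.
rewrite -pclassM !oq_delE /= pclass_sum big_map.
by apply: eq_bigr => p _; rewrite !oq_delE pclassM.
Qed.

Lemma oq_del1 g : oq_del g 1 = uq_counit_gen R g *: (1 : A).
Proof.
rewrite -[1 in LHS](scale1r (1 : A)) -pclass_const oq_delE /=.
by rewrite pclassZ pclass_const scale1r.
Qed.

Lemma oq_delEM x y : oq_del genE (x * y) =
  oq_del genE x * oq_del genK y + oq_del genKi x * oq_del genE y.
Proof. by rewrite oq_delM !big_cons big_nil addr0. Qed.
Lemma oq_delFM x y : oq_del genF (x * y) =
  oq_del genF x * oq_del genK y + oq_del genKi x * oq_del genF y.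
Proof. by rewrite oq_delM !big_cons big_nil addr0. Qed.
Lemma oq_delKM x y : oq_del genK (x * y) = oq_del genK x * oq_del genK y.
Proof. by rewrite oq_delM !big_cons big_nil addr0. Qed.
Lemma oq_delKiM x y : oq_del genKi (x * y) = oq_del genKi x * oq_del genKi y.
Proof. by rewrite oq_delM !big_cons big_nil addr0. Qed.

Lemma oq_delZ g c x : oq_del g (c *: x) = c *: oq_del g x.
Proof.
rewrite -[x in LHS]mul1r scalerAl -pclass_const.
have dc h : oq_del h [NCconst c] = (uq_counit_gen R h * c) *: (1 : A).
  by rewrite oq_delE /= pclassZ pclass_const scalerA.
case: g; rewrite ?(oq_delEM, oq_delFM, oq_delKM, oq_delKiM) !dc /=;
by rewrite ?mul0r ?mul1r ?scale0r ?mul0r ?add0r -?scalerAl ?mul1r.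
Qed.

Fixpoint oq_op (f : ncpoly C uqgen) (x : A) : A :=
  match f with
  | NCgen g => oq_del g x
  | NCconst c => c *: x
  | NCadd f g => oq_op f x + oq_op g x
  | NCmul f g => oq_op g (oq_op f x)
  end.

Lemma oq_opE f t : [oq_act_nc q t f] = oq_op f [t].
Proof.
elim: f t => [g|c|f IHf g IHg|f IHf g IHg] t /=.
- by rewrite oq_delE.
- by rewrite pclassZ.
- by rewrite pclassD IHf IHg.
- by rewrite IHg IHf.
Qed.

Lemma oq_opD f x y : oq_op f (x + y) = oq_op f x + oq_op f y.
Proof.
elim: f x y => [g|c|f IHf g IHg|f IHf g IHg] x y /=.
- exact: oq_delD.
- exact: scalerDr.
- by rewrite IHf IHg addrACA.
- by rewrite IHf IHg.
Qed.

Lemma oq_opZ f c x : oq_op f (c *: x) = c *: oq_op f x.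
Proof.
elim: f x => [g|e|f IHf g IHg|f IHf g IHg] x /=.
- exact: oq_delZ.
- by rewrite !scalerA mulrC.
- by rewrite IHf IHg scalerDr.
- by rewrite IHf IHg.
Qed.

Lemma oq_ind (Q : A -> Prop) :
  (forall x, Q [NCgen x]) -> (forall c, Q (c *: (1 : A))) ->
  (forall x y, Q x -> Q y -> Q (x + y)) ->
  (forall x y, Q x -> Q y -> Q (x * y)) -> forall x, Q x.
Proof.
move=> Qg Qc QD QM; elim/pclass_ind; elim=> [x|c|t IHt u IHu|t IHt u IHu].
- exact: Qg.
- by rewrite pclass_const.
- by rewrite pclassD; exact: QD.
- by rewrite pclassM; exact: QM.
Qed.


Lemma oq_del0 g : oq_del g 0 = 0.
Proof. by have := oq_delZ g 0 0; rewrite !scale0r. Qed.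

Let p : C := (Num.sqrt q)%:C.
Let p0 : p != 0.
Proof.
by rewrite -(rmorph0 (real_complex R)) (inj_eq (@complexI R)) (sqrtq_neq0 hq).
Qed.
Let pV : (Num.sqrt q)^-1%:C = p^-1.
Proof. by rewrite rmorphV ?unitfE ?(sqrtq_neq0 hq). Qed.
Let qE : q%:C = p * p.
Proof. by rewrite -rcM -expr2 sqr_sqrtr// ltW ?(q_gt0 hq). Qed.
Let lamE : (qlam q)^-1%:C = (p * p - p^-1 * p^-1)^-1.
Proof.
have l0 : qlam q != 0.
  case/andP: hq => h0 h1.
  by rewrite /qlam subr_eq0 lt_eqF// (lt_trans h1)// invf_gt1.
by rewrite rmorphV ?unitfE// rmorphB/= qV qE invfM.
Qed.

Let oq_delgen g x : oq_del g [NCgen x] = [oq_act_gen q x g].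
Proof. exact: oq_delE. Qed.

Ltac cmp := do 4 (rewrite ?(oq_cE hq, oq_del0, oq_delZ, oq_delgen, scale0r,
  scaler0, pV, qV, qE, oppr0, subrr) -?/p /=); rewrite ?scalerA.

Lemma oq_delK_Ki x : oq_del genKi (oq_del genK x) = x.
Proof.
elim/oq_ind: x => [x|c|x y IHx IHy|x y IHx IHy].
- by case: x; cmp; rewrite ?mulVf ?mulfV// scale1r.
- by rewrite !oq_delZ !oq_del1 !oq_delZ oq_del1 !scale1r.
- by rewrite !oq_delD IHx IHy.
- by rewrite !(oq_delKM, oq_delKiM) IHx IHy.
Qed.

Lemma oq_delKi_K x : oq_del genK (oq_del genKi x) = x.
Proof.
elim/oq_ind: x => [x|c|x y IHx IHy|x y IHx IHy].
- by case: x; cmp; rewrite ?mulVf ?mulfV// scale1r.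
- by rewrite !oq_delZ !oq_del1 !oq_delZ oq_del1 !scale1r.
- by rewrite !oq_delD IHx IHy.
- by rewrite !(oq_delKM, oq_delKiM) IHx IHy.
Qed.

Lemma oq_delKE x :
  oq_del genE (oq_del genK x) = q%:C *: oq_del genK (oq_del genE x).
Proof.
elim/oq_ind: x => [x|c|x y IHx IHy|x y IHx IHy].
- by case: x; cmp => //; congr (_ *: _); field; rewrite p0.
- by rewrite !oq_delZ !oq_del1 !oq_delZ !oq_del1 /= !(scale0r, scaler0).
- by rewrite !oq_delD IHx IHy scalerDr.
- rewrite !(oq_delKM, oq_delEM, oq_delD) IHx IHy oq_delK_Ki oq_delKi_K.
  by rewrite scalerDr -!scalerAl -!scalerAr.
Qed.

Lemma oq_delKF x :
  oq_del genF (oq_del genK x) = q^-1%:C *: oq_del genK (oq_del genF x).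
Proof.
elim/oq_ind: x => [x|c|x y IHx IHy|x y IHx IHy].
- by case: x; cmp => //; congr (_ *: _); field; rewrite p0.
- by rewrite !oq_delZ !oq_del1 !oq_delZ !oq_del1 /= !(scale0r, scaler0).
- by rewrite !oq_delD IHx IHy scalerDr.
- rewrite !(oq_delKM, oq_delFM, oq_delD) IHx IHy oq_delK_Ki oq_delKi_K.
  by rewrite scalerDr -!scalerAl -!scalerAr.
Qed.

Lemma oq_delKiE x :
  oq_del genKi (oq_del genE x) = q%:C *: oq_del genE (oq_del genKi x).
Proof.
by rewrite -{1}[x]oq_delKi_K oq_delKE oq_delZ oq_delK_Ki.
Qed.

Lemma oq_delKiF x :
  oq_del genKi (oq_del genF x) = q^-1%:C *: oq_del genF (oq_del genKi x).
Proof.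
by rewrite -{1}[x]oq_delKi_K oq_delKF oq_delZ oq_delK_Ki.
Qed.

Lemma oq_delEF x :
  oq_del genF (oq_del genE x) - oq_del genE (oq_del genF x) =
  (qlam q)^-1%:C *: (oq_del genK (oq_del genK x) - oq_del genKi (oq_del genKi x)).
Proof.
elim/oq_ind: x => [x|c|x y IHx IHy|x y IHx IHy].
- have pp : p * p - p^-1 * p^-1 != 0.
    have l0 : (qlam q)^-1%:C != 0 :> C.
      rewrite -(rmorph0 (real_complex R)) (inj_eq (@complexI R)) invr_eq0.
      case/andP: hq => h0 h1.
      by rewrite /qlam subr_eq0 lt_eqF// (lt_trans h1)// invf_gt1.
    by rewrite -invr_eq0 -lamE.
  case: x; cmp; rewrite ?lamE ?(sub0r, subr0) -?scalerBl scalerA.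
  + by rewrite -[p^-1 * p^-1 - p * p]opprB mulrN mulVf// scaleN1r.
  + by rewrite -[p^-1 * p^-1 - p * p]opprB mulrN mulVf// scaleN1r.
  + by rewrite mulVf// scale1r addr0.
  + by rewrite mulVf// scale1r addr0.
- by rewrite !oq_delZ !oq_del1 !oq_delZ !oq_del1 /= !(scale0r, scaler0, scale1r, subrr, oq_del1).
- rewrite !oq_delD opprD addrACA IHx IHy -scalerDr; congr (_ *: _).
  by rewrite opprD addrACA.
- rewrite !(oq_delKM, oq_delFM, oq_delEM, oq_delKiM, oq_delD).
  rewrite oq_delKE oq_delKF oq_delKiE oq_delKiF.
  rewrite -!scalerAl -!scalerAr !scalerA qV mulfV// mulVf// !scale1r.
  have ac (V : zmodType) (a1 a2 b c d1 d2 : V) :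
      (a1 + b + (c + d1)) - (a2 + c + (b + d2)) = (a1 - a2) + (d1 - d2).
    rewrite (addrACA a2) opprD addrACA; congr (_ + _).
      by rewrite opprD addrACA subrr addr0.
    by rewrite opprD addrACA subrr add0r.
  rewrite ac -mulrBl -mulrBr IHx IHy -scalerAl -scalerAr -scalerDr.
  congr (_ *: _).
  by rewrite mulrBl mulrBr addrA subrK.
Qed.

Lemma oq_op_rel f g : uq_rel q f g -> oq_op f =1 oq_op g.
Proof.
case=> x /=.
- by rewrite oq_delK_Ki scale1r.
- by rewrite oq_delKi_K scale1r.
- by rewrite oq_delKE oq_delZ oq_delK_Ki oq_delZ.
- by rewrite oq_delKF oq_delZ oq_delK_Ki oq_delZ.
- by rewrite !oq_delZ !scaleN1r oq_delEF scalerBr.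
Qed.

Lemma oq_op_relstar f g : uq_rel q f g ->
  oq_op (nc_star (@uq_star R) f) =1 oq_op (nc_star (@uq_star R) g).
Proof.
case=> x /=; rewrite ?(rmorph1, rmorphN1, conj_rc, scale1r).
- exact: oq_delKi_K.
- exact: oq_delK_Ki.
- have := oq_delKF (oq_del genKi x); rewrite oq_delKi_K => ->.
  by rewrite scalerA qV mulfV// scale1r.
- have := oq_delKE (oq_del genKi x); rewrite oq_delKi_K => ->.
  by rewrite scalerA qV mulVf// scale1r.
- by rewrite !scaleN1r oq_delEF.
Qed.

Lemma oq_op_cong f g : nc_cong (@uq_star R) (uq_rel q) f g ->
  oq_op f =1 oq_op g.
Proof.
elim=> {f g} /=.
- exact: oq_op_rel.
- exact: oq_op_relstar.
- by [].
- by move=> f g _ IH x; rewrite IH.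
- by move=> f g h _ IH _ IH' x; rewrite IH IH'.
- by move=> f f' g g' _ IH _ IH' x; rewrite IH IH'.
- by move=> f f' g g' _ IH _ IH' x; rewrite IH IH'.
- by move=> f g x; rewrite addrC.
- by move=> f g h x; rewrite addrA.
- by move=> f x; rewrite scale0r add0r.
- by move=> f x; rewrite oq_opZ scaleN1r addNr scale0r.
- by [].
- by move=> f x; rewrite scale1r.
- by move=> f x; rewrite scale1r.
- by move=> f g h x; rewrite oq_opD.
- by [].
- by move=> c d x; rewrite scalerDl.
- by move=> c d x; rewrite scalerA mulrC.
- by move=> c f x; rewrite oq_opZ.
Qed.

Local Notation U := (Uqsu2 q).
Local Notation "[ t ]U" := (@pclass R (uq_pres q) t).

Definition oq_act (x : A) (f : U) : A := [oq_act_nc q (repr x) (repr f)].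

Lemma oq_act_op x f : oq_act x [f]U = oq_op f x.
Proof.
rewrite /oq_act oq_opE (pclassK x); apply: oq_op_cong.
exact: (@pclass_repr R (uq_pres q) f).
Qed.

Lemma oq_actE t f : oq_act [t] [f]U = [oq_act_nc q t f].
Proof. by rewrite oq_act_op oq_opE. Qed.

Lemma oq_op1 f : oq_op f 1 = nc_char (uq_counit_gen R) f *: (1 : A).
Proof.
elim: f => [g|c|f IHf g IHg|f IHf g IHg] //=.
- exact: oq_del1.
- by rewrite IHf IHg scalerDl.
- by rewrite IHf oq_opZ IHg scalerA.
Qed.

Lemma oq_opM f x y : oq_op f (x * y) =
  \sum_(p <- uq_coprod_nc f) oq_op p.1 x * oq_op p.2 y.
Proof.
elim: f x y => [g|c|f IHf g IHg|f IHf g IHg] x y /=.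
- by rewrite oq_delM big_map.
- by rewrite big_seq1 /= scale1r scalerAl.
- by rewrite IHf IHg big_cat.
- rewrite IHf big_allpairs_dep /=.
  rewrite (big_morph (oq_op g) (oq_opD g) (_ : oq_op g 0 = 0)); last first.
    by have := oq_opZ g 0 0; rewrite !scale0r.
  by apply: eq_bigr => p' _; rewrite IHg.
Qed.

End OqAction.

Record starHom (R : realType) (X Y : starAlgType R) := StarHom {
  shom :> X -> Y;
  shomD : forall x y, shom (x + y) = shom x + shom y;
  shomZ : forall (c : R[i]) x, shom (c *: x) = c *: shom x;
  shomM : forall x y, shom (x * y) = shom x * shom y;
  shom1 : shom 1 = 1;
  shom_star : forall x, shom (star x) = star (shom x)
}.

Section PresentationMap.
Variables (R : realType) (P Q : presentation R) (f : pgen P -> pgen Q).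
Hypothesis f_star : forall g, nc_map f (pstar g) = @pstar R Q (f g).
Hypothesis f_rel : forall t u, @prel R P t u ->
  @prel R Q (nc_map f t) (nc_map f u).

Lemma nc_map_star t :
  nc_map f (nc_star (@pstar R P) t) = nc_star (@pstar R Q) (nc_map f t).
Proof. by elim: t => [g|c|t IHt u IHu|t IHt u IHu] //=; rewrite ?f_star ?IHt ?IHu. Qed.

Lemma nc_map_cong t u : nc_cong (@pstar R P) (@prel R P) t u ->
  nc_cong (@pstar R Q) (@prel R Q) (nc_map f t) (nc_map f u).
Proof.
elim=> {t u} /=.
- by move=> t u tu; apply: nc_rel; exact: f_rel.
- by move=> t u tu; rewrite !nc_map_star; apply: nc_relstar; exact: f_rel.
- by move=> *; exact: nc_refl.
- by move=> *; exact: nc_sym.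
- by move=> t u v _ tu _; exact: nc_trans tu.
- by move=> *; exact: nc_add.
- by move=> *; exact: nc_mul.
- by move=> *; exact: nc_addC.
- by move=> *; exact: nc_addA.
- by move=> *; exact: nc_add0.
- by move=> *; exact: nc_addN.
- by move=> *; exact: nc_mulA.
- by move=> *; exact: nc_mul1l.
- by move=> *; exact: nc_mul1r.
- by move=> *; exact: nc_mulDl.
- by move=> *; exact: nc_mulDr.
- by move=> *; exact: nc_constD.
- by move=> *; exact: nc_constM.
- by move=> *; exact: nc_constC.
Qed.

Definition pmap_fun (x : presented P) : presented Q :=
  pclass (nc_map f (repr x)).

Lemma pmapE t : pmap_fun (pclass t) = pclass (nc_map f t).
Proof. by apply/pclassP/nc_map_cong; exact: pclass_repr. Qed.

Lemma pmapD x y : pmap_fun (x + y) = pmap_fun x + pmap_fun y.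
Proof.
elim/pclass_ind: x => t; elim/pclass_ind: y => u.
by rewrite -pclassD !pmapE -pclassD.
Qed.
Lemma pmapM x y : pmap_fun (x * y) = pmap_fun x * pmap_fun y.
Proof.
elim/pclass_ind: x => t; elim/pclass_ind: y => u.
by rewrite -pclassM !pmapE -pclassM.
Qed.
Lemma pmapZ c x : pmap_fun (c *: x) = c *: pmap_fun x.
Proof. by elim/pclass_ind: x => t; rewrite -pclassZ !pmapE -pclassZ. Qed.
Lemma pmap1 : pmap_fun 1 = 1.
Proof. exact: pmapE. Qed.
Lemma pmap_star x : pmap_fun (star x) = star (pmap_fun x).
Proof.
by elim/pclass_ind: x => t; rewrite starE !pmapE starE nc_map_star.
Qed.

Definition pmap_hom : starHom (presented P) (presented Q) :=
  StarHom pmapD pmapZ pmapM pmap1 pmap_star.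

End PresentationMap.

Section Antipode.
Variables (R : realType) (q : R) (hq : 0 < q < 1).
Local Notation C := R[i].
Local Notation U := (Uqsu2 q).
Local Notation "[ t ]" := (@pclass R (uq_pres q) t).

Let q0 : q%:C != 0 :> C.
Proof. by rewrite -(rmorph0 (real_complex R)) (inj_eq (@complexI R)) gt_eqF ?(q_gt0 hq). Qed.
Let qV : q^-1%:C = q%:C^-1 :> C.
Proof. by rewrite rmorphV// unitfE gt_eqF ?(q_gt0 hq). Qed.

Definition uq_counit (f : U) : C := nc_char (uq_counit_gen R) (repr f).

Lemma uq_counitE f : uq_counit [f] = nc_char (uq_counit_gen R) f.
Proof.
by apply: (uq_counit_cong (q := q)); exact: (@pclass_repr R (uq_pres q) f).
Qed.

Definition uq_cE := (@pclassZ R (uq_pres q), @pclassD R (uq_pres q),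
  @pclassM R (uq_pres q), @pclass_const R (uq_pres q)).

Let relE f g : uq_rel q f g -> [f] = [g].
Proof. by move=> fg; apply/pclassP; exact: nc_rel. Qed.

Let E : U := [NCgen genE].
Let F : U := [NCgen genF].
Let K : U := [NCgen genK].
Let Ki : U := [NCgen genKi].

Let KKi : K * Ki = 1. Proof. by rewrite /K /Ki -pclassM (relE (uq_KKi q)). Qed.
Let KiK : Ki * K = 1. Proof. by rewrite /K /Ki -pclassM (relE (uq_KiK q)). Qed.
Let KEKi : K * E * Ki = q%:C *: E.
Proof. by rewrite -pclassZ -(relE (uq_KEKi q)) !pclassM. Qed.
Let KFKi : K * F * Ki = q^-1%:C *: F.
Proof. by rewrite -pclassZ -(relE (uq_KFKi q)) !pclassM. Qed.
Let EF : E * F - F * E = (qlam q)^-1%:C *: (K * K - Ki * Ki).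
Proof.
have := relE (uq_EF q); rewrite !uq_cE -/E -/F -/K -/Ki !scaleN1r => ->.
by [].
Qed.

Lemma uq_anti_rel (e : C) (s : uqgen -> ncpoly C uqgen) f g : e != 0 ->
  s genE = (- e *: NCgen genE)%nc -> s genF = (- e^-1 *: NCgen genF)%nc ->
  s genK = NCgen genKi -> s genKi = NCgen genK ->
  uq_rel q f g -> [nc_anti s f] = [nc_anti s g].
Proof.
move=> e0 sE sF sK sKi.
case=> /=; rewrite ?(sE, sF, sK, sKi) !uq_cE -/E -/F -/K -/Ki
  ?scale1r -?scalerAl -?scalerAr ?mulr1.
- by rewrite KKi.
- by rewrite KiK.
- by rewrite mulrA KEKi.
- by rewrite mulrA KFKi.
- rewrite !scalerA !(mulrN, mulNr, opprK, mul1r, mulr1) ?mulVf// ?mulfV// !scaleNr !scale1r.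
  by rewrite -opprB EF -scalerN opprB.
Qed.

Lemma uq_antip_rel f g : uq_rel q f g ->
  [nc_anti (uq_antip_gen q) f] = [nc_anti (uq_antip_gen q) g].
Proof. by apply: (uq_anti_rel q0) => //=; rewrite qV. Qed.

Lemma uq_antipV_rel f g : uq_rel q f g ->
  [nc_anti (uq_antipV_gen q) f] = [nc_anti (uq_antipV_gen q) g].
Proof.
apply: (uq_anti_rel (e := q^-1%:C)) => //=; first by rewrite qV invr_neq0.
by rewrite qV invrK.
Qed.

Lemma nc_anti_star f :
  ([nc_anti (uq_antip_gen q) (nc_star (@uq_star R) f)] =
   star [nc_anti (uq_antipV_gen q) f]) *
  ([nc_anti (uq_antipV_gen q) (nc_star (@uq_star R) f)] =
   star [nc_anti (uq_antip_gen q) f]).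
Proof.
elim: f => [g|c|f IHf g IHg|f IHf g IHg] /=.
- by split; rewrite starE; case: g => //=;
    rewrite conj_Nrc; apply/pclassP/nc_constC.
- by split; rewrite starE.
- by split; rewrite !uq_cE starD !(IHf, IHg).
- by split; rewrite !uq_cE starM !(IHf, IHg).
Qed.

Lemma nc_anti_cong f g : nc_cong (@uq_star R) (uq_rel q) f g ->
  ([nc_anti (uq_antip_gen q) f] = [nc_anti (uq_antip_gen q) g]) *
  ([nc_anti (uq_antipV_gen q) f] = [nc_anti (uq_antipV_gen q) g]).
Proof.
elim=> {f g} /=.
- by move=> f g fg; split; [exact: uq_antip_rel|exact: uq_antipV_rel].
- by move=> f g fg; rewrite !nc_anti_star (uq_antip_rel fg) (uq_antipV_rel fg).
- by [].
- by move=> f g _ [-> ->].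
- by move=> f g h _ [-> ->] _ [-> ->].
- by move=> f f' g g' _ [e1 e2] _ [e3 e4]; rewrite !uq_cE e1 e2 e3 e4.
- by move=> f f' g g' _ [e1 e2] _ [e3 e4]; rewrite !pclassM e1 e2 e3 e4.
- by move=> f g; split; rewrite !uq_cE addrC.
- by move=> f g h; rewrite !uq_cE !addrA.
- by move=> f; rewrite !uq_cE !scale0r !add0r.
- by move=> f; rewrite !pclassD !pclassM !pclass_const -!scalerAr !mulr1
    !scaleN1r !addNr scale0r.
- by move=> f g h; rewrite !pclassM !mulrA.
- by move=> f; rewrite !pclassM !pclass_const !scale1r !mulr1.
- by move=> f; rewrite !pclassM !pclass_const !scale1r !mul1r.
- by move=> f g h; rewrite !(pclassM, pclassD) !mulrDr.
- by move=> f g h; rewrite !(pclassM, pclassD) !mulrDl.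
- by move=> c d; rewrite !(pclassD, pclass_const) scalerDl.
- by move=> c d; rewrite !(pclassM, pclass_const) -scalerAl mul1r scalerA mulrC.
- by move=> c f; rewrite !(pclassM, pclass_const) -!scalerAl -!scalerAr
    !mul1r !mulr1.
Qed.

Definition uq_antip (f : U) : U := [nc_anti (uq_antip_gen q) (repr f)].
Definition uq_antipV (f : U) : U := [nc_anti (uq_antipV_gen q) (repr f)].

Lemma uq_antipE f : uq_antip [f] = [nc_anti (uq_antip_gen q) f].
Proof. exact: (nc_anti_cong (@pclass_repr R (uq_pres q) f)).1. Qed.
Lemma uq_antipVE f : uq_antipV [f] = [nc_anti (uq_antipV_gen q) f].
Proof. exact: (nc_anti_cong (@pclass_repr R (uq_pres q) f)).2. Qed.

Lemma uq_antipK : cancel uq_antip uq_antipV.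
Proof.
elim/pclass_ind=> f; rewrite uq_antipE uq_antipVE.
elim: f => [g|c|f IHf g IHg|f IHf g IHg] //=.
- case: g => //=; rewrite !uq_cE -scalerAr mulr1 scalerA mulrNN qV ?mulVf ?mulfV//;
  by rewrite scale1r.
- by rewrite !pclassD IHf IHg.
- by rewrite !pclassM IHf IHg.
Qed.

Lemma uq_antipVK : cancel uq_antipV uq_antip.
Proof.
elim/pclass_ind=> f; rewrite uq_antipVE uq_antipE.
elim: f => [g|c|f IHf g IHg|f IHf g IHg] //=.
- case: g => //=; rewrite !uq_cE -scalerAr mulr1 scalerA mulrNN qV ?mulVf ?mulfV//;
  by rewrite scale1r.
- by rewrite !pclassD IHf IHg.
- by rewrite !pclassM IHf IHg.
Qed.

End Antipode.

Section CrossProduct.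
Variables (R : realType) (q : R) (hq : 0 < q < 1).
Local Notation C := R[i].
Local Notation A := (OSUq2 hq).
Local Notation "[ t ]" := (@pclass R (oq_pres hq) t).
Local Notation embU := (nc_map (@inl uqgen oqgen)).
Local Notation embO := (nc_map (@inr uqgen oqgen)).
Local Notation anti := (nc_anti (uq_antipV_gen q)).
Local Notation stU := (nc_star (@uq_star R)).
Local Notation op := (@oq_op R q hq).

Let q0 : q%:C != 0 :> C.
Proof. by rewrite -(rmorph0 (real_complex R)) (inj_eq (@complexI R)) gt_eqF ?(q_gt0 hq). Qed.
Let qV : q^-1%:C = q%:C^-1 :> C.
Proof. by rewrite rmorphV// unitfE gt_eqF ?(q_gt0 hq). Qed.

Lemma oq_del_star g x :
  oq_del g (star x) = (oq_dual q g).1 *: star (oq_del (oq_dual q g).2 x) :> A.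
Proof.
by elim/pclass_ind: x => t; rewrite starE !oq_delE oq_act1_star.
Qed.

Lemma oq_op0 f : op f 0 = 0.
Proof. by have := oq_opZ f 0 (0 : A); rewrite !scale0r. Qed.

Lemma oq_op_cross f (x y : A) :
  x * op (anti f) y =
  \sum_(p <- uq_coprod_nc f) op (anti p.1) (op p.2 x * y).
Proof.
elim: f x y => [g|c|f IHf g IHg|f IHf g IHg] x y /=.
- rewrite big_map; case: g; rewrite /= !big_cons big_nil addr0 /=.
  + rewrite !oq_delZ oq_delEM oq_delKM oq_delKE !oq_delK_Ki -scalerAl -scalerAr.
    by rewrite scalerDr scalerA mulNr qV mulVf// scaleN1r addrAC addNr add0r.
  + rewrite !oq_delZ oq_delFM oq_delKM oq_delKF !oq_delK_Ki -scalerAl -scalerAr.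
    by rewrite scalerDr scalerA mulNr qV mulfV// scaleN1r addrAC addNr add0r.
  + by rewrite oq_delKiM oq_delK_Ki.
  + by rewrite oq_delKM oq_delKi_K.
- by rewrite big_seq1 /= scale1r scalerAr.
- by rewrite mulrDr IHf IHg big_cat.
- rewrite IHf big_allpairs_dep /=; apply: eq_bigr => p _.
  by rewrite IHg (big_morph _ (oq_opD _) (oq_op0 _)).
Qed.

Lemma oq_op_cross_star f (z y : A) :
  op (anti (stU f)) (star z * y) =
  \sum_(p <- uq_coprod_nc f) star (op p.2 z) * op (anti (stU p.1)) y.
Proof.
elim: f z y => [g|c|f IHf g IHg|f IHf g IHg] z y /=.
- rewrite big_map; case: g; rewrite /= !big_cons big_nil addr0 /=.
  + rewrite !oq_delZ oq_delFM !oq_del_star /= scale1r -!scalerAl scalerDr.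
    by rewrite scalerA qV mulrNN mulfV// scale1r addrC scalerAr.
  + rewrite !oq_delZ oq_delEM !oq_del_star /= scale1r -!scalerAl scalerDr.
    by rewrite scalerA qV mulrNN mulVf// scale1r addrC scalerAr.
  + by rewrite oq_delKiM oq_del_star /= scale1r.
  + by rewrite oq_delKM oq_del_star /= scale1r.
- by rewrite big_seq1 /= scale1r scalerAr.
- by rewrite IHf IHg big_cat.
- rewrite IHf big_allpairs_dep /= (big_morph _ (oq_opD _) (oq_op0 _)).
  by apply: eq_bigr => p _; rewrite IHg.
Qed.

(* The action of the cross product algebra on A in which A acts by left
   multiplication and f in U acts by y |-> y <| S^-1(f). It shows that the
   cross product algebra is not trivial. *)
Fixpoint uo_op (t : ncpoly C (uqgen + oqgen)) (y : A) : A :=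
  match t with
  | NCgen (inl g) => op (uq_antipV_gen q g) y
  | NCgen (inr x) => [NCgen x] * y
  | NCconst c => c *: y
  | NCadd t u => uo_op t y + uo_op u y
  | NCmul t u => uo_op t (uo_op u y)
  end.

Lemma uo_opD t x y : uo_op t (x + y) = uo_op t x + uo_op t y.
Proof.
elim: t x y => [[g|g]|c|t IHt u IHu|t IHt u IHu] x y /=.
- exact: oq_opD.
- exact: mulrDr.
- exact: scalerDr.
- by rewrite IHt IHu addrACA.
- by rewrite IHu IHt.
Qed.

Lemma uo_opZ t c y : uo_op t (c *: y) = c *: uo_op t y.
Proof.
elim: t y => [[g|g]|e|t IHt u IHu|t IHt u IHu] y /=.
- exact: oq_opZ.
- by rewrite scalerAr.
- by rewrite !scalerA mulrC.
- by rewrite IHt IHu scalerDr.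
- by rewrite IHu IHt.
Qed.

Lemma uo_op_U f y : uo_op (embU f) y = op (anti f) y.
Proof. by elim: f y => [g|c|f IHf g IHg|f IHf g IHg] y //=; rewrite IHf IHg. Qed.

Lemma uo_op_O t y : uo_op (embO t) y = [t] * y.
Proof.
elim: t y => [g|c|f IHf g IHg|f IHf g IHg] y //=.
- by rewrite pclass_const -scalerAl mul1r.
- by rewrite IHf IHg pclassD mulrDl.
- by rewrite IHg IHf pclassM mulrA.
Qed.

Lemma uo_op_sum s y : uo_op (nc_sum s) y = \sum_(t <- s) uo_op t y.
Proof.
by elim: s => [|t s IHs] /=; rewrite ?big_nil ?big_cons ?scale0r ?IHs.
Qed.

Lemma uo_star_U f : nc_star (uo_star q) (embU f) = embU (stU f).
Proof. by elim: f => [g|c|f IHf g IHg|f IHf g IHg] //=; rewrite IHf IHg. Qed.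
Lemma uo_star_O f :
  nc_star (uo_star q) (embO f) = embO (nc_star (oq_star q) f).
Proof. by elim: f => [g|c|f IHf g IHg|f IHf g IHg] //=; rewrite IHf IHg. Qed.
Lemma nc_star_sum (G : Type) (s : G -> ncpoly C G) ts :
  nc_star s (nc_sum ts) = nc_sum [seq nc_star s t | t <- ts].
Proof. by elim: ts => [|t ts IH] /=; rewrite ?rmorph0 ?IH. Qed.

Lemma uo_op_cong t u :
  nc_cong (uo_star q) (uo_rel q) t u -> uo_op t =1 uo_op u.
Proof.
have antiU f g : nc_cong (@uq_star R) (uq_rel q) f g ->
    op (anti f) =1 op (anti g).
  move=> /(nc_anti_cong hq)[_ fg] y.
  by apply: oq_op_cong; apply/(pclassP (P := uq_pres q)).
elim=> {t u} /=.
- move=> _ _ [f g fg|t u tu|x f] y.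
  + by rewrite !uo_op_U; apply: antiU; exact: nc_rel.
  + by rewrite !uo_op_O; congr (_ * _); apply/pclassP; exact: nc_rel.
  + rewrite /= uo_op_U uo_op_O uo_op_sum big_map oq_op_cross.
    by apply: eq_bigr => p _ /=; rewrite uo_op_U uo_op_O oq_opE.
- move=> _ _ [f g fg|t u tu|x f] y.
  + by rewrite !uo_star_U !uo_op_U; apply: antiU; exact: nc_relstar.
  + rewrite !uo_star_O !uo_op_O; congr (_ * _); apply/pclassP.
    exact: (@nc_relstar _ _ (@pstar R (oq_pres hq))).
  + rewrite nc_star_sum uo_op_sum -map_comp big_map /= uo_star_U uo_star_O.
    rewrite uo_op_U uo_op_O -starE oq_op_cross_star.
    apply: eq_bigr => p _ /=; rewrite uo_star_U uo_star_O uo_op_O uo_op_U.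
    by rewrite -oq_opE starE.
- by [].
- by move=> t u _ IH y; rewrite IH.
- by move=> t u v _ IH _ IH' y; rewrite IH IH'.
- by move=> t t' u u' _ IH _ IH' y; rewrite IH IH'.
- by move=> t t' u u' _ IH _ IH' y; rewrite IH' IH.
- by move=> t u y; rewrite addrC.
- by move=> t u v y; rewrite addrA.
- by move=> t y; rewrite scale0r add0r.
- by move=> t y; rewrite scaleN1r addNr scale0r.
- by [].
- by move=> t y; rewrite scale1r.
- by move=> t y; rewrite scale1r.
- by [].
- by move=> t u v y; rewrite uo_opD.
- by move=> c d y; rewrite scalerDl.
- by move=> c d y; rewrite scalerA.
- by move=> c t y; rewrite uo_opZ.
Qed.

Lemma uo_nontrivial : ~ nc_cong (uo_star q) (uo_rel q) 1%nc 0%nc.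
Proof.
move=> /uo_op_cong /(_ 1) /eqP.
by rewrite /= scale1r scale0r oner_eq0.
Qed.

Lemma uo_starK rel g :
  nc_cong (uo_star q) rel (nc_star (uo_star q) (uo_star q g)) (NCgen g).
Proof.
case: g => [[]|[]] /=; try exact: nc_refl; rewrite conj_Nrc;
  by apply: nc_swap_scale; rewrite mulrNN qV ?mulVf ?mulfV.
Qed.

Definition uo_pres := Presentation (@uo_starK (uo_rel q)) uo_nontrivial.

Definition inU : starHom (Uqsu2 q) (presented uo_pres) :=
  @pmap_hom R (uq_pres q) uo_pres (@inl uqgen oqgen)
    (fun=> erefl) (@uo_uq R q).
Definition inO : starHom (OSUq2 hq) (presented uo_pres) :=
  @pmap_hom R (oq_pres hq) uo_pres (@inr uqgen oqgen)
    (fun=> erefl) (@uo_oq R q).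

End CrossProduct.

Notation UOSUq2 hq := (presented (uo_pres hq)).

(* The value of rop x outside rdom is irrelevant. *)
Record starRep (R : realType) (X : starAlgType R) (H : hilbertType R) :=
  StarRep {
  rdom : set H;
  rop : X -> H -> H;
  rdom0 : rdom 0;
  rdomP : forall (c : R[i]) u v, rdom u -> rdom v -> rdom (c *: u + v);
  rdom_dense : dense rdom;
  rop_dom : forall x u, rdom u -> rdom (rop x u);
  rop_linear : forall x (c : R[i]) u v, rdom u -> rdom v ->
    rop x (c *: u + v) = c *: rop x u + rop x v;
  ropD : forall x y u, rdom u -> rop (x + y) u = rop x u + rop y u;
  ropZ : forall (c : R[i]) x u, rdom u -> rop (c *: x) u = c *: rop x u;
  ropM : forall x y u, rdom u -> rop (x * y) u = rop x (rop y u);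
  rop1 : forall u, rdom u -> rop 1 u = u;
  rop_star : forall x u v, rdom u -> rdom v ->
    hdot (rop x u) v = hdot u (rop (star x) v)
}.

Section StarRep.
Variables (R : realType) (X : starAlgType R).

Definition graph_closure (H : hilbertType R) (pi : starRep X H) (x : X) :
    set (H * H) :=
  closure [set p | rdom pi p.1 /\ p.2 = rop pi x p.1].

Definition closure_dom (H : hilbertType R) (pi : starRep X H) : set H :=
  [set u | forall x, exists v, graph_closure pi x (u, v)].

Definition rep_closed (H : hilbertType R) (pi : starRep X H) : Prop :=
  rdom pi = closure_dom pi.

Definition is_rep_closure (H : hilbertType R) (pi pi' : starRep X H) : Prop :=
  rdom pi' = closure_dom pi /\
  forall x u, rdom pi' u -> graph_closure pi x (u, rop pi' x u).

Definition sqnorm (H : hilbertType R) (u : H) : R := complex.Re (`|u| ^+ 2).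

(* The Hilbert space direct sum of the K i consists of the families f with
   hsum_sqnorm f < +oo, and hsum_sqnorm f is the square of the norm of f. *)
Definition hsum_sqnorm (I : choiceType) (K : I -> hilbertType R)
    (f : forall i, K i) : \bar R :=
  (\esum_(i in [set: I]) (sqnorm (f i))%:E)%E.

(* W is a unitary operator (a surjective linear isometry) of H onto the Hilbert
   space direct sum of the K i. *)
Definition hsum_unitary (H : hilbertType R) (I : choiceType)
    (K : I -> hilbertType R) (W : H -> forall i, K i) : Prop :=
  [/\ forall (c : R[i]) u v i, W (c *: u + v) i = c *: W u i + W v i,
      forall u, hsum_sqnorm (W u) = (sqnorm u)%:E &
      forall f : forall i, K i, (hsum_sqnorm f < +oo)%E ->
        exists u, forall i, W u i = f i].

(* The domain of the direct sum of the representations rho i. The condition for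
   x = 1 says that f belongs to the Hilbert space direct sum. *)
Definition hsum_rdom (I : choiceType) (K : I -> hilbertType R)
    (rho : forall i, starRep X (K i)) : set (forall i, K i) :=
  [set f | (forall i, rdom (rho i) (f i)) /\
           forall x, (hsum_sqnorm (fun i => rop (rho i) x (f i)) < +oo)%E].

(* pi is unitarily equivalent to the direct sum of the rho i. *)
Definition equiv_direct_sum (H : hilbertType R) (pi : starRep X H)
    (I : choiceType) (K : I -> hilbertType R)
    (rho : forall i, starRep X (K i)) : Prop :=
  exists W : H -> forall i, K i,
    [/\ hsum_unitary W,
        forall u, rdom pi u <-> hsum_rdom rho (W u) &
        forall x u i, rdom pi u -> W (rop pi x u) i = rop (rho i) x (W u i)].

Definition irreducible_rep (H : hilbertType R) (pi : starRep X H) : Prop :=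
  rep_closed pi /\
  ~ exists (K : bool -> hilbertType R) (rho : forall b, starRep X (K b)),
      (forall b, exists u : K b, u != 0) /\ equiv_direct_sum pi rho.

End StarRep.

Section Restriction.
Variables (R : realType) (X Y : starAlgType R) (phi : starHom X Y).
Variables (H : hilbertType R) (pi : starRep Y H).

Definition rep_res : starRep X H.
Proof.
refine (@StarRep R X H (rdom pi) (fun x => rop pi (phi x)) (rdom0 pi)
  (@rdomP _ _ _ pi) (@rdom_dense _ _ _ pi) _ _ _ _ _ _ _).
- by move=> x u; exact: rop_dom.
- by move=> x c u v; exact: rop_linear.
- by move=> x y u Du; rewrite shomD ropD.
- by move=> c x u Du; rewrite shomZ ropZ.
- by move=> x y u Du; rewrite shomM ropM.
- by move=> u Du; rewrite shom1 rop1.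
- by move=> x u v Du Dv; rewrite shom_star rop_star.
Defined.

End Restriction.

Section Heisenberg.
Variables (R : realType) (q : R).
Local Notation C := R[i].

Definition uq_elt (g : uqgen) : Uqsu2 q := @pclass R (uq_pres q) (NCgen g).

Definition qnum (x : R) : R := (qlam q)^-1 * (q `^ x - q `^ (- x)).

Definition qalpha (j l : R) : R :=
  Num.sqrt (qnum (l + j) * qnum (l - j + 1)).

(* The family e extended by 0. *)
Definition ext_basis (V : nmodType) (n : nat) (e : 'I_n -> V) (k : int) : V :=
  if k is Posz m then (if insub m is Some i then e i else 0) else 0.

(* tau is T_l for l = n / 2; the basis vector written e_j, where
   j = -l, -l + 1, ..., l, is e k with k = j + l. *)
Definition is_spin_rep (n : nat) (V : hilbertType R)
    (tau : starRep (Uqsu2 q) V) : Prop :=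
  let l : R := n%:R / 2 in
  exists e : 'I_n.+1 -> V,
    [/\ forall i k, hdot (e i) (e k) = (i == k)%:R,
        forall v, v = \sum_i hdot v (e i) *: e i,
        rdom tau = [set: V] &
        forall k : 'I_n.+1, let j : R := k%:R - l in
          [/\ rop tau (uq_elt genK) (e k) = (q `^ j)%:C *: e k,
              rop tau (uq_elt genE) (e k) =
                (qalpha (j + 1) l)%:C *: ext_basis e (k%:Z + 1) &
              rop tau (uq_elt genF) (e k) =
                (qalpha j l)%:C *: ext_basis e (k%:Z - 1)]].

Definition integrable_rep (H : hilbertType R)
    (tau : starRep (Uqsu2 q) H) : Prop :=
  rep_closed tau /\
  exists (I : choiceType) (n : I -> nat) (K : I -> hilbertType R)
         (T : forall i, starRep (Uqsu2 q) (K i)),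
    (forall i, is_spin_rep (n i) (T i)) /\ equiv_direct_sum tau T.

Variable hq : 0 < q < 1.

Definition is_haar (h : OSUq2 hq -> C) : Prop :=
  [/\ forall (c : C) x y, h (c *: x + y) = c * h x + h y,
      h 1 = 1 &
      forall x (f : Uqsu2 q), h (oq_act x f) = uq_counit f * h x].

Definition is_GNS (h : OSUq2 hq -> C) (H : hilbertType R)
    (pi : starRep (OSUq2 hq) H) (v : H) : Prop :=
  [/\ rdom pi v,
      rdom pi = [set rop pi x v | x in [set: OSUq2 hq]] &
      forall x, h x = hdot (rop pi x v) v].

Definition is_heisenberg (H : hilbertType R) (pih : starRep (UOSUq2 hq) H) :
    Prop :=
  exists (h : OSUq2 hq -> C) (pi0 : starRep (OSUq2 hq) H) (vh : H)
         (pit : starRep (UOSUq2 hq) H),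
  [/\ is_haar h,
      is_GNS h pi0 vh,
      [/\ rdom pit = rdom pi0,
          forall x u, rdom pi0 u -> rop pit (inO hq x) u = rop pi0 x u &
          forall f x, rop pit (inU hq f) (rop pi0 x vh) =
                      rop pi0 (oq_act x (uq_antipV f)) vh] &
      is_rep_closure pit pih].

End Heisenberg.

(* Main.v *)
Require Import Defs.
From HB Require Import structures.
From mathcomp Require Import all_boot all_order all_algebra.
From mathcomp Require Import sesquilinear complex finmap zify ring lra.
From mathcomp Require Import all_classical all_reals all_analysis.

Set Implicit Arguments.
Unset Strict Implicit.
Unset Printing Implicit Defensive.

Import Order.TTheory GRing.Theory Num.Theory.
Import numFieldNormedType.Exports.

Local Open Scope classical_set_scope.
Local Open Scope ring_scope.
Local Open Scope complex_scope.

(* If xi, xi' are U-invariant vectors of a *-representation pi of the cross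
   product, then x |-> <pi(x) xi, xi'> is an invariant functional on A, hence
   equals <xi, xi'> h by uniqueness of h. So an orthonormal family of invariant
   vectors generates pairwise orthogonal copies of the Heisenberg
   representation. They fill the Hilbert space when pi restricted to U is
   integrable: a highest weight vector of spin l > 0 is a combination, with
   coefficients a and b, of two highest weight vectors of spin l - 1/2, so by
   induction every highest weight vector lies in the closed span of pi(A) times
   the invariant vectors. Domains match because A acts by bounded operators and
   the cross product is spanned by A U: the graph topology of a closed
   representation is the one of its restriction to U, which is read off the
   coefficients in an orthonormal basis adapted to U. *)

(** * Hilbert spaces and orthonormal families *)

(** Uniqueness of the invariant functional rests on a weak form of the Peter-Weyl decomposition: the
    monomials a^i b^j generate A under the right action of U, and K acts on them by p^-(i+j) with p
    = q^(1/2), so an invariant functional vanishes on all of them except 1. Applied to the Haar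
    vector, the same monomials are highest weight vectors; the F-orbits of the normalized monomials
    form an orthonormal basis of the Heisenberg space in which U acts by finite blocks. The elements
    of U act by unbounded operators, so domains cannot be compared by continuity. Instead, a closed
    domain is shown to be as large as possible: u lies in it once, for every f in U, the numbers <u,
    f e_m> are the coefficients of some vector in the adapted basis e_m. A unitary that matches two
    adapted bases preserves this condition. Irreducibility holds because the invariant vectors of
    the Heisenberg representation form a line, while the component of the Haar vector along any
    direct summand is again invariant. *)

Section HilbertBasics.
Variables (R : realType) (H : hilbertType R).
Implicit Types (u v w : H) (c z : R[i]).

Lemma hdotDl u v w : hdot (u + v) w = hdot u w + hdot v w.
Proof. exact: linearDl. Qed.
Lemma hdotDr u v w : hdot u (v + w) = hdot u v + hdot u w.
Proof. exact: linearDr. Qed.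
Lemma hdotZl c u v : hdot (c *: u) v = c * hdot u v.
Proof. exact: linearZl_LR. Qed.
Lemma hdotZr c u v : hdot u (c *: v) = c^*%R * hdot u v.
Proof. exact: linearZr_LR. Qed.
Lemma hdot0l v : hdot 0 v = 0 :> R[i].
Proof. by rewrite -(scale0r (0 : H)) hdotZl mul0r. Qed.
Lemma hdot0r v : hdot v 0 = 0 :> R[i].
Proof. by rewrite -(scale0r (0 : H)) hdotZr rmorph0 mul0r. Qed.
Lemma hdotNl u v : hdot (- u) v = - hdot u v.
Proof. by rewrite -scaleN1r hdotZl mulN1r. Qed.
Lemma hdotNr u v : hdot u (- v) = - hdot u v.
Proof. by rewrite -scaleN1r hdotZr rmorphN rmorph1 mulN1r. Qed.
Lemma hdotBl u v w : hdot (u - v) w = hdot u w - hdot v w.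
Proof. by rewrite hdotDl hdotNl. Qed.
Lemma hdotBr u v w : hdot w (u - v) = hdot w u - hdot w v.
Proof. by rewrite hdotDr hdotNr. Qed.
Lemma hdotC u v : hdot u v = (hdot v u)^*%R :> R[i].
Proof. by rewrite hermC /= expr0 mul1r. Qed.
Lemma hdot_suml (I : Type) (r : seq I) (P : pred I) (F : I -> H) v :
  hdot (\sum_(i <- r | P i) F i) v = \sum_(i <- r | P i) hdot (F i) v.
Proof. by apply: (big_morph (fun u => hdot u v)) => [x y|]; rewrite ?hdotDl ?hdot0l. Qed.
Lemma hdot_sumr (I : Type) (r : seq I) (P : pred I) (F : I -> H) v :
  hdot v (\sum_(i <- r | P i) F i) = \sum_(i <- r | P i) hdot v (F i).
Proof. by apply: (big_morph (fun u => hdot v u)) => [x y|]; rewrite ?hdotDr ?hdot0r. Qed.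

Definition sqmod z : R := complex.Re z ^+ 2 + complex.Im z ^+ 2.

Lemma sqmodE z : (sqmod z)%:C = z * z^*%R.
Proof. by rewrite /sqmod add_Re2_Im2 normCK. Qed.
Lemma sqmod_ge0 z : 0 <= sqmod z.
Proof. by rewrite addr_ge0 ?sqr_ge0. Qed.
Lemma sqmod0 : sqmod 0 = 0.
Proof. by rewrite /sqmod /= expr0n addr0. Qed.
Lemma sqmod_eq0 z : sqmod z = 0 -> z = 0.
Proof.
move=> z0; apply/eqP; rewrite -normr_eq0 -sqrf_eq0 normCK -sqmodE z0.
by rewrite rmorph0.
Qed.
Lemma sqnorm_norm u : (sqnorm u)%:C = `|u| ^+ 2.
Proof. by rewrite /sqnorm RRe_real// ger0_real// exprn_ge0. Qed.
Lemma hdot_sqnorm u : hdot u u = (sqnorm u)%:C.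
Proof. by rewrite sqnorm_norm hdot_norm. Qed.
Lemma sqnorm_ge0 u : 0 <= sqnorm u.
Proof. by rewrite -lecR sqnorm_norm exprn_ge0. Qed.
Lemma sqnorm0 : sqnorm (0 : H) = 0.
Proof. by apply: (@complexI R); rewrite -hdot_sqnorm hdot0l. Qed.
Lemma sqnorm_eq0 u : sqnorm u = 0 -> u = 0.
Proof.
move=> u0; apply/eqP; rewrite -normr_eq0 -sqrf_eq0 -sqnorm_norm u0.
by rewrite rmorph0.
Qed.
Lemma hdot_eq0 u : hdot u u = 0 -> u = 0.
Proof. by move=> u0; apply: sqnorm_eq0; apply: (@complexI R); rewrite -hdot_sqnorm. Qed.
Lemma sqnormZ c u : sqnorm (c *: u) = sqmod c * sqnorm u.
Proof.
by apply: (@complexI R); rewrite rmorphM /= sqmodE -!hdot_sqnorm hdotZl hdotZr mulrA.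
Qed.
Lemma sqnormN u : sqnorm (- u) = sqnorm u.
Proof. by apply: (@complexI R); rewrite -!hdot_sqnorm hdotNl hdotNr opprK. Qed.
Lemma sqnormBC u v : sqnorm (u - v) = sqnorm (v - u).
Proof. by rewrite -sqnormN opprB. Qed.
Lemma sqnormD_orth u v : hdot u v = 0 -> sqnorm (u + v) = sqnorm u + sqnorm v.
Proof.
move=> uv; apply: (@complexI R); rewrite rmorphD /= -!hdot_sqnorm.
by rewrite !(hdotDl, hdotDr) (hdotC v u) uv rmorph0 addr0 add0r.
Qed.
(** From the parallelogram law. It replaces the triangle inequality, so that all estimates compare
    squared norms, which are real numbers. *)
Lemma sqnorm_le2 u v : sqnorm (u + v) <= 2 * sqnorm u + 2 * sqnorm v.
Proof.
have -> : 2 * sqnorm u + 2 * sqnorm v = sqnorm (u + v) + sqnorm (u - v).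
  apply: (@complexI R); rewrite !rmorphD !rmorphM /= -!hdot_sqnorm rmorphMn rmorph1.
  rewrite !(hdotBl, hdotBr, hdotDl, hdotDr).
  by rewrite /=; ring.
by rewrite lerDl sqnorm_ge0.
Qed.
Lemma sqnorm_triangle u v w :
  sqnorm (u - w) <= 2 * sqnorm (u - v) + 2 * sqnorm (v - w).
Proof. by rewrite -[u - w](subrKA v) sqnorm_le2. Qed.

Lemma hdot_CS u v : sqmod (hdot u v) <= sqnorm u * sqnorm v.
Proof.
have [->|v0] := eqVneq v 0; first by rewrite hdot0r sqmod0 sqnorm0 mulr0.
have sv : 0 < sqnorm v.
  rewrite lt_neqAle sqnorm_ge0 andbT eq_sym; apply: contra_neq v0.
  exact: sqnorm_eq0.
set t := hdot u v.
have := sqnorm_ge0 ((sqnorm v)%:C *: u - t *: v).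
suff -> : sqnorm ((sqnorm v)%:C *: u - t *: v) =
    sqnorm v * (sqnorm u * sqnorm v - sqmod t) by rewrite pmulr_rge0// subr_ge0.
apply: (@complexI R); rewrite rmorphM rmorphB rmorphM /= sqmodE.
rewrite -!hdot_sqnorm !(hdotBl, hdotBr, hdotZl, hdotZr) (hdotC v u) -/t.
by rewrite (_ : ((hdot v v)^*)%R = hdot v v); [ring|rewrite -hdotC].
Qed.

Lemma norm_lt_sqnorm u (e : R) : 0 < e -> (`|u| < e%:C) = (sqnorm u < e ^+ 2).
Proof.
move=> e0; rewrite -ltcR sqnorm_norm rmorphXn /= ltr_pXn2r// nnegrE//.
by rewrite lecR ltW.
Qed.

Lemma posc (e : R[i]) : 0 < e -> exists2 r : R, 0 < r & e = r%:C.
Proof.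
case: e => x y; rewrite ltcE /= => /andP[/eqP -> x0].
by exists x.
Qed.

Lemma ball_sqnorm u v (e : R) : 0 < e -> ball u e%:C v <-> sqnorm (u - v) < e ^+ 2.
Proof. by move=> e0; rewrite -ball_normE /ball_ /= norm_lt_sqnorm. Qed.

Lemma sqnorm_small (e : R) : 0 < e -> exists2 r : R, 0 < r & r ^+ 2 <= e.
Proof.
move=> e0; exists (Num.sqrt e); first by rewrite sqrtr_gt0.
by rewrite sqr_sqrtr// ltW.
Qed.

Lemma dense_sqnorm (D : set H) : dense D -> forall u (e : R), 0 < e ->
  exists2 v, D v & sqnorm (u - v) < e.
Proof.
move=> Dd u e e0; have [r r0 re] := sqnorm_small e0.
have rC : 0 < r%:C :> R[i] by rewrite ltcR.
have nb : nbhs u (ball u r%:C)^° by apply: nbhs_interior; exact: nbhsx_ballx.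
have [|v [vo vD]] := Dd _ _ (open_interior (ball u r%:C)).
  by exists u; exact: nbhs_singleton.
exists v => //; have /ball_sqnorm := interior_subset vo.
by move=> /(_ r0)/lt_le_trans; exact.
Qed.

End HilbertBasics.

Section ProductClosure.
Variables (R : realType) (H K : hilbertType R).

Lemma closure_sqnorm (A : set (H * K)) u v :
  closure A (u, v) <-> forall e : R, 0 < e ->
    exists u' v', [/\ A (u', v'), sqnorm (u - u') < e & sqnorm (v - v') < e].
Proof.
split=> [Auv e e0|Auv B].
  have [r r0 re] := sqnorm_small e0.
  have rC : 0 < r%:C :> R[i] by rewrite ltcR.
  have [[u' v'] [Auv' [/= /ball_sqnorm h1 /ball_sqnorm h2]]] :=
    Auv (ball (u, v) r%:C) (nbhsx_ballx (u, v) _ rC).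
  by exists u', v'; split=> //; [apply: lt_le_trans re; exact: h1|
    apply: lt_le_trans re; exact: h2].
rewrite -nbhs_ballE => -[e /= /posc[r r0 ->] eB].
have [u' [v' [Auv' h1 h2]]] := Auv _ (exprn_gt0 2 r0).
exists (u', v'); split=> //; apply: eB.
by split; apply/ball_sqnorm.
Qed.

End ProductClosure.

Lemma hilbert_complete (R : realType) (H : hilbertType R) (f : nat -> H) :
  (forall e : R, 0 < e -> exists N, forall n m, (N <= n)%N -> (N <= m)%N ->
     sqnorm (f n - f m) < e) ->
  exists u, forall e : R, 0 < e -> exists N, forall n, (N <= n)%N ->
     sqnorm (u - f n) < e.
Proof.
move=> fC.
have : cvg (f @ \oo).
  apply: cauchy_cvg; apply: cauchy_exP => e /posc[r r0 ->].
  have [N hN] := fC _ (exprn_gt0 2 r0).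
  exists (f N); exists N => // n Nn.
  by apply/ball_sqnorm => //; exact: hN.
move=> /cvg_ex[u fu]; exists u => e e0.
have [r r0 re] := sqnorm_small e0.
have rC : 0 < r%:C :> R[i] by rewrite ltcR.
have [N _ hN] := cvg_ball fu rC.
exists N => n Nn; apply: lt_le_trans re.
by apply/(ball_sqnorm _ _ r0); exact: hN.
Qed.

Section EsumReal.
Variables (R : realType) (M : choiceType) (a : M -> R).
Hypothesis a0 : forall m, 0 <= a m.

Lemma fsets_sum (S : {fset M}) :
  ((\sum_(m <- S) a m)%:E <= \esum_(m in [set: M]) (a m)%:E)%E.
Proof.
rewrite -sumEFin -[S in leLHS]set_fsetK -fsbig_finite//=.
by apply: ereal_sup_ubound; exists [set` S]; rewrite //; split.
Qed.

Lemma esum_le_bound (b : R) : (forall S : {fset M}, \sum_(m <- S) a m <= b) ->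
  (\esum_(m in [set: M]) (a m)%:E <= b%:E)%E.
Proof.
move=> aS; apply: ub_ereal_sup => _ [A [fA _] <-].
by rewrite fsbig_finite//= sumEFin lee_fin.
Qed.

Lemma esum_lt_bound : (\esum_(m in [set: M]) (a m)%:E < +oo)%E ->
  exists b, forall S : {fset M}, \sum_(m <- S) a m <= b.
Proof.
move=> ltoo; exists (fine (\esum_(m in [set: M]) (a m)%:E)%E) => S.
rewrite -lee_fin fineK ?fsets_sum// ge0_fin_numE// esum_ge0// => m _.
by rewrite lee_fin.
Qed.

End EsumReal.

Lemma inv_nat_small (R : realType) (r : R) : 0 < r ->
  exists N, forall n, (N <= n)%N -> n.+1%:R^-1 < r.
Proof.
move=> r0; have [N hN] : exists N : nat, r^-1 < N%:R.
  by exists (Num.bound r^-1); apply: archi_boundP; rewrite invr_ge0 ltW.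
exists N => n Nn; rewrite -[r]invrK ltf_pV2 ?posrE ?invr_gt0//.
by apply: lt_le_trans hN _; rewrite ler_nat leqW.
Qed.

Section Orthonormal.
Local Open Scope fset_scope.
Variables (R : realType) (H : hilbertType R) (M : choiceType).
Implicit Types (e : M -> H) (c : M -> R[i]) (S : {fset M}) (u v : H).

Definition orthonormal_family e := forall m n, hdot (e m) (e n) = (m == n)%:R.
Definition total_family e := forall v, (forall m, hdot v (e m) = 0) -> v = 0.
Definition fcomb e c S : H := \sum_(m <- S) c m *: e m.

Lemma fset_filter_sub S S' : S `<=` S' -> [fset x in S' | x \in S] = S.
Proof.
move=> SS'; apply/fsetP => x; rewrite !inE /=.
by case: (boolP (x \in S)) => [/(fsubsetP SS') ->|_]; rewrite ?andbF.
Qed.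

Variable e : M -> H.
Hypothesis oe : orthonormal_family e.

Lemma hdot_fcomb c S m : hdot (fcomb e c S) (e m) = if m \in S then c m else 0.
Proof.
rewrite /fcomb hdot_suml; under eq_bigr do rewrite hdotZl oe.
case: ifPn => mS.
  rewrite (big_fsetD1 m)//= eqxx mulr1 big_seq big1 ?addr0// => n.
  by rewrite !inE => /andP[/negPf -> _]; rewrite mulr0.
rewrite big_seq big1 // => n nS; have [nm|_] := eqVneq n m; last by rewrite mulr0.
by rewrite -nm nS in mS.
Qed.

Lemma sqnorm_fcomb c S : sqnorm (fcomb e c S) = \sum_(m <- S) sqmod (c m).
Proof.
apply: (@complexI R); rewrite -hdot_sqnorm {2}/fcomb hdot_sumr rmorph_sum /=.
rewrite big_seq [RHS]big_seq; apply: eq_bigr => m mS.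
by rewrite hdotZr hdot_fcomb mS sqmodE mulrC.
Qed.

Lemma fcombD c S S' : S `<=` S' ->
  fcomb e c S' - fcomb e c S = fcomb e c (S' `\` S).
Proof.
move=> SS'; rewrite /fcomb (big_fsetID _ (mem S))/=.
rewrite fset_filter_sub// addrAC subrr add0r.
by congr (\sum_(m <- enum_fset _) _); apply/fsetP => x; rewrite !inE andbC.
Qed.

Lemma sum_sqmodD c S S' : S `<=` S' ->
  \sum_(m <- S' `\` S) sqmod (c m) = \sum_(m <- S') sqmod (c m) - \sum_(m <- S) sqmod (c m).
Proof.
move=> SS'; rewrite [X in X - _](big_fsetID _ (mem S))/=.
rewrite fset_filter_sub// addrAC subrr add0r.
by congr (\sum_(m <- enum_fset _) _); apply/fsetP => x; rewrite !inE andbC.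
Qed.

Lemma bessel_eq u S : sqnorm (u - fcomb e (fun m => hdot u (e m)) S) =
  sqnorm u - \sum_(m <- S) sqmod (hdot u (e m)).
Proof.
set s := fcomb _ _ _.
have us : hdot (u - s) s = 0.
  rewrite {2}/s hdot_sumr big_seq big1// => m mS.
  by rewrite hdotZr hdotBl hdot_fcomb mS subrr mulr0.
by rewrite -sqnorm_fcomb -/s -[in RHS](subrK s u) (sqnormD_orth us) addrK.
Qed.

Lemma bessel u S : \sum_(m <- S) sqmod (hdot u (e m)) <= sqnorm u.
Proof. by rewrite -subr_ge0 -bessel_eq sqnorm_ge0. Qed.

(** The index set is arbitrary, so a sequence of finite sets [F N] is chosen whose sums come within
    1/(N+1) of the supremum; enlarging [F N] then changes the combination by less than 1/(N+1) in
    squared norm. The last clause is convergence along the net of finite sets, which allows a common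
    finite set for several vectors. *)
Lemma riesz_fischer c (b : R) :
    (forall S, \sum_(m <- S) sqmod (c m) <= b) ->
  exists u, (forall m, hdot u (e m) = c m) /\
    forall eps : R, 0 < eps -> exists S, forall S', S `<=` S' ->
      sqnorm (u - fcomb e c S') < eps.
Proof.
move=> cb; pose sm S := \sum_(m <- S) sqmod (c m).
pose T : set R := [set sm S | S in [set: {fset M}]].
have hT : has_sup T.
  by split; [exists (sm fset0), fset0|exists b => _ [S _ <-]; exact: cb].
have /choice[F hF] (N : nat) : exists S, sup T - N.+1%:R^-1 < sm S.
  have [_ [S _ <-] hS] := sup_adherent (ltac:(by []) : 0 < N.+1%:R^-1 :> R) hT.
  by exists S.
have smT S : sm S <= sup T by apply: ub_le_sup; [case: hT|exists S].
have near N S : F N `<=` S ->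
    sqnorm (fcomb e c S - fcomb e c (F N)) < N.+1%:R^-1.
  move=> FS; rewrite fcombD// sqnorm_fcomb sum_sqmodD//.
  have := smT S; have := hF N; rewrite /sm; move: (N.+1%:R^-1) (sup T) => x y; lra.
have [|u hu] := hilbert_complete (f := fun N => fcomb e c (F N)).
  move=> r r0; have [N hN] := inv_nat_small (divr_gt0 r0 (ltac:(by []) : 0 < 4 :> R)).
  exists N => n m Nn Nm.
  apply: le_lt_trans (sqnorm_triangle _ (fcomb e c (F n `|` F m)) _) _.
  rewrite (sqnormBC (fcomb e c (F n))).
  have := near n _ (fsubsetUl (F n) (F m)).
  have := near m _ (fsubsetUr (F n) (F m)).
  have := hN _ Nn; have := hN _ Nm; move: (n.+1%:R^-1) (m.+1%:R^-1) => x y; lra.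
have appr (eps : R) : 0 < eps -> exists S, forall S', S `<=` S' ->
      sqnorm (u - fcomb e c S') < eps.
  move=> e0; have e4 := divr_gt0 e0 (ltac:(by []) : 0 < 4 :> R).
  have [N hN] := inv_nat_small e4; have [N' hN'] := hu _ e4.
  pose k := maxn N N'; exists (F k) => S' kS.
  apply: le_lt_trans (sqnorm_triangle _ (fcomb e c (F k)) _) _.
  rewrite (sqnormBC _ (fcomb e c S')).
  have := near _ _ kS; have := hN k (leq_maxl _ _); have := hN' k (leq_maxr _ _).
  move: (k.+1%:R^-1) => x; lra.
exists u; split=> // m; apply/eqP; rewrite -subr_eq0; apply/eqP/sqmod_eq0.
apply/eqP; rewrite eq_le sqmod_ge0 andbT; apply/ler_addgt0Pl => eps e0.
have [S hS] := appr _ e0; have := hS (m |` S) (fsubsetU1 _ _).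
have -> : hdot u (e m) - c m = hdot (u - fcomb e c (m |` S)) (e m).
  by rewrite hdotBl hdot_fcomb !inE eqxx.
move=> /ltW lt; rewrite addr0; apply: le_trans lt.
apply: le_trans (hdot_CS _ _) _.
suff -> : sqnorm (e m) = 1 by rewrite mulr1.
by apply: (@complexI R); rewrite -hdot_sqnorm oe eqxx.
Qed.

Hypothesis te : total_family e.

Lemma total_approx u (eps : R) : 0 < eps -> exists S, forall S', S `<=` S' ->
  sqnorm (u - fcomb e (fun m => hdot u (e m)) S') < eps.
Proof.
have [v [hv va]] := riesz_fischer (bessel u).
suff -> : u = v by move: va; under [fun m => hdot u _]eq_fun do rewrite -hv; exact.
apply/eqP; rewrite -subr_eq0; apply/eqP/te => m.
by rewrite hdotBl hv subrr.
Qed.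

Lemma parseval u :
  (\esum_(m in [set: M]) (sqmod (hdot u (e m)))%:E = (sqnorm u)%:E)%E.
Proof.
have c0 m : 0 <= sqmod (hdot u (e m)) by exact: sqmod_ge0.
apply/eqP; rewrite eq_le; apply/andP; split.
  by apply: esum_le_bound => // S; exact: bessel.
apply/lee_addgt0Pr => eps e0; have [S /(_ S)] := total_approx u e0.
rewrite bessel_eq => /(_ (fsubset_refl _)) h.
apply: (@le_trans _ _ ((\sum_(m <- S) sqmod (hdot u (e m)))%:E + eps%:E)%E).
  by rewrite -EFinD lee_fin; move: h; lra.
by rewrite leeD2r// fsets_sum.
Qed.

Lemma total_expand u (S : {fset M}) : (forall m, m \notin S -> hdot u (e m) = 0) ->
  u = fcomb e (fun m => hdot u (e m)) S.
Proof.
move=> uS; apply/eqP; rewrite -subr_eq0; apply/eqP/te => m.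
by rewrite hdotBl hdot_fcomb; case: ifPn => [_|/uS ->]; rewrite subrr.
Qed.

End Orthonormal.

Lemma esum_sigma (R : realType) (I : choiceType) (J : I -> choiceType)
    (a : {i & J i} -> \bar R) : (forall t, 0 <= a t)%E ->
  (\esum_(t in [set: {i & J i}]) a t =
   \esum_(i in [set: I]) \esum_(j in [set: J i]) a (existT _ i j))%E.
Proof.
move=> a0; pose F i : set {i & J i} := [set t | tag t = i].
transitivity (\esum_(i in [set: I]) \esum_(t in F i) a t)%E.
  rewrite (esum_esum (a := fun=> a))//; apply: esym.
  apply: (reindex_esum _ _ (fun t => (tag t, t)) (fun p => a p.2)); split.
  - by move=> t _; split.
  - by move=> t u _ _ [_ ->].
  - by move=> [i t] [_ /= ti]; exists t; rewrite // -ti.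
apply: eq_esum => i _; apply: reindex_esum; split.
- by move=> j _.
- by move=> j k _ _ /eqP; rewrite eq_Tagged /= => /eqP.
- by move=> [k j] ki; have {}ki : k = i := ki; subst k; exists j.
Qed.

Section DirectSumOfBases.
Variables (R : realType) (H : hilbertType R) (I : choiceType).
Variables (J : I -> choiceType) (K : I -> hilbertType R).
Variables (E : forall i, J i -> H) (f : forall i, J i -> K i).
Let E' (t : {i & J i}) := E (tagged t).
Hypotheses (oE : orthonormal_family E') (tE : total_family E').
Hypotheses (onf : forall i, orthonormal_family (@f i)).
Hypothesis tf : forall i, total_family (@f i).

Let oEi i : orthonormal_family (@E i).
Proof.
move=> j k; have := oE (existT _ i j) (existT _ i k).
by rewrite /E' /= eq_Tagged.
Qed.

(** [W u] is the family whose coefficients in the bases [f] are those of u in [E]. Parseval on both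
    sides gives the isometry, and Riesz-Fischer gives both the existence of [W u] and
    surjectivity. *)
Lemma hsum_unitary_bases : exists W : H -> forall i, K i,
  hsum_unitary W /\ forall u i j, hdot (W u i) (f j) = hdot u (E j).
Proof.
have /choice[W hW] (u : H) : exists w : forall i, K i,
    forall i j, hdot (w i) (f j) = hdot u (E j).
  have ex i : exists w : K i, forall j, hdot w (f j) = hdot u (E j).
    by have [w [hw _]] := riesz_fischer (onf (i := i)) (bessel (oEi (i := i)) u); exists w.
  by exists (fun i => projT1 (cid (ex i))) => i j; case: (cid (ex i)).
have eqK i (v w : K i) : (forall j, hdot v (f j) = hdot w (f j)) -> v = w.
  move=> vw; apply/eqP; rewrite -subr_eq0; apply/eqP/tf => j.
  by rewrite hdotBl vw subrr.
have hs (g : forall i, K i) : hsum_sqnorm g =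
    (\esum_(t in [set: {i & J i}]) (sqmod (hdot (g (tag t)) (f (tagged t))))%:E)%E.
  rewrite esum_sigma => [|t]; last by rewrite lee_fin sqmod_ge0.
  apply: eq_esum => i _.
  by rewrite -(parseval (onf (i := i)) (tf (i := i))).
exists W; split=> //; split.
- move=> c u v i; apply: eqK => j.
  by rewrite hdotDl hdotZl !hW hdotDl hdotZl.
- move=> u; rewrite hs -(parseval oE tE u).
  by apply: eq_esum => t _; rewrite hW.
- move=> g; rewrite hs => /esum_lt_bound[|b hb]; first by move=> t; exact: sqmod_ge0.
  have [u [hu _]] := riesz_fischer oE hb; exists u => i; apply: eqK => j.
  by rewrite hW -[RHS](hu (existT _ i j)).
Qed.

End DirectSumOfBases.

Section HilbertLimits.
Variables (R : realType) (H : hilbertType R).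

Lemma sqmod_arb (z : R[i]) (b : R) : (forall e : R, 0 < e -> sqmod z <= b * e) -> z = 0.
Proof.
move=> zb; apply: sqmod_eq0; apply/eqP; rewrite eq_le sqmod_ge0 andbT.
have [b0|b0] := leP b 0; first by apply: le_trans (zb 1 ltr01) _; rewrite mulr1.
apply/ler_addgt0Pl => e e0; rewrite addr0.
by have := zb _ (divr_gt0 e0 b0); rewrite mulrC divfK// gt_eqF.
Qed.

Lemma sqmodB_le2 (z c : R[i]) : sqmod (z - c) <= 2 * sqmod z + 2 * sqmod c.
Proof.
case: z c => x y [x' y']; rewrite /sqmod /=.
by have := sqr_ge0 (x + x'); have := sqr_ge0 (y + y'); nra.
Qed.

Lemma dense_orth (D : set H) z : dense D -> (forall w, D w -> hdot z w = 0) -> z = 0.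
Proof.
move=> Dd zD; apply: hdot_eq0; apply: (@sqmod_arb _ (sqnorm z)) => e e0.
have [w Dw zw] := dense_sqnorm Dd z e0.
rewrite -[X in hdot _ X](subrK w) hdotDr (zD w Dw) addr0.
by apply: le_trans (hdot_CS _ _) _; rewrite ler_wpM2l ?sqnorm_ge0 ?ltW.
Qed.

Definition cauchy_sequence (g : nat -> H) := forall e : R, 0 < e ->
  exists N, forall n m, (N <= n)%N -> (N <= m)%N -> sqnorm (g n - g m) < e.

Lemma cauchy_sequenceD g h : cauchy_sequence g -> cauchy_sequence h ->
  cauchy_sequence (fun n => g n + h n).
Proof.
move=> cg ch e e0; have e4 := divr_gt0 e0 (ltac:(by []) : 0 < 4 :> R).
have [N hN] := cg _ e4; have [N' hN'] := ch _ e4.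
exists (maxn N N') => n m; rewrite !geq_max => /andP[n1 n2] /andP[m1 m2].
rewrite opprD addrACA; apply: le_lt_trans (sqnorm_le2 _ _) _.
have := hN _ _ n1 m1; have := hN' _ _ n2 m2; lra.
Qed.

End HilbertLimits.

(** * Representations by unbounded operators *)

Section StarRepTheory.
Variables (R : realType) (X : starAlgType R) (H : hilbertType R).
Variable pi : starRep X H.
Local Notation D := (rdom pi).

Lemma rdomZ c u : D u -> D (c *: u).
Proof. by move=> Du; rewrite -[c *: u]addr0; apply: rdomP => //; exact: rdom0. Qed.
Lemma rdomD u v : D u -> D v -> D (u + v).
Proof. by move=> Du Dv; rewrite -[u]scale1r; exact: rdomP. Qed.
Lemma rdomB u v : D u -> D v -> D (u - v).
Proof. by move=> Du Dv; rewrite -scaleN1r; apply: rdomD => //; exact: rdomZ. Qed.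
Lemma rdom_fsum (I : eqType) (r : seq I) (F : I -> H) :
  (forall i, i \in r -> D (F i)) -> D (\sum_(i <- r) F i).
Proof.
move=> DF; rewrite big_seq; apply: (big_ind D) => //; first exact: rdom0.
exact: rdomD.
Qed.

Lemma ropDr x u v : D u -> D v -> rop pi x (u + v) = rop pi x u + rop pi x v.
Proof.
by move=> Du Dv; have := rop_linear x 1 Du Dv; rewrite !scale1r.
Qed.
Lemma rop0r x : rop pi x 0 = 0.
Proof.
have D0 := rdom0 pi; have := ropDr x D0 D0; rewrite addr0 => /eqP.
by rewrite -subr_eq0 opprD addNKr oppr_eq0 => /eqP.
Qed.
Lemma ropZr x c u : D u -> rop pi x (c *: u) = c *: rop pi x u.
Proof.
by move=> Du; have := rop_linear x c Du (rdom0 pi); rewrite rop0r !addr0.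
Qed.
Lemma ropBr x u v : D u -> D v -> rop pi x (u - v) = rop pi x u - rop pi x v.
Proof.
move=> Du Dv; have DNv := rdomZ (-1) Dv.
by rewrite -(scaleN1r v) ropDr// ropZr// scaleN1r.
Qed.
Lemma rop_sumr x (I : eqType) (r : seq I) (F : I -> H) :
  (forall i, i \in r -> D (F i)) ->
  rop pi x (\sum_(i <- r) F i) = \sum_(i <- r) rop pi x (F i).
Proof.
elim: r => [|i r IH] DF; first by rewrite !big_nil rop0r.
have Dr j : j \in r -> D (F j) by move=> jr; apply: DF; rewrite inE jr orbT.
rewrite !big_cons ropDr ?IH//; last exact: rdom_fsum.
by apply: DF; rewrite mem_head.
Qed.
Lemma rop0l u : D u -> rop pi 0 u = 0.
Proof. by move=> Du; rewrite -(scale0r (0 : X)) ropZ// scale0r. Qed.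
Lemma ropNl x u : D u -> rop pi (- x) u = - rop pi x u.
Proof. by move=> Du; rewrite -scaleN1r ropZ// scaleN1r. Qed.
Lemma ropBl x y u : D u -> rop pi (x - y) u = rop pi x u - rop pi y u.
Proof. by move=> Du; rewrite ropD// ropNl. Qed.
Lemma rop_suml (I : Type) (r : seq I) (F : I -> X) u : D u ->
  rop pi (\sum_(i <- r) F i) u = \sum_(i <- r) rop pi (F i) u.
Proof.
move=> Du; elim: r => [|i r IH]; first by rewrite !big_nil rop0l.
by rewrite !big_cons ropD// IH.
Qed.
Lemma rop_starl x u v : D u -> D v -> hdot (rop pi (star x) u) v = hdot u (rop pi x v).
Proof. by move=> Du Dv; rewrite rop_star// starK. Qed.

Lemma graph_closureP x u v : graph_closure pi x (u, v) <->
  forall e : R, 0 < e -> exists w,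
    [/\ D w, sqnorm (u - w) < e & sqnorm (v - rop pi x w) < e].
Proof.
split=> [/closure_sqnorm uv e e0|uv].
  by have [w [_ [[/= Dw ->] h1 h2]]] := uv e e0; exists w.
by apply/closure_sqnorm => e /uv[w [Dw h1 h2]]; exists w, (rop pi x w).
Qed.

(** The adjunction relation with a fixed w in the domain is continuous in (u, v), so it passes from
    the graph to its closure. *)
Lemma graph_closure_adj x u v w : graph_closure pi x (u, v) -> D w ->
  hdot v w = hdot u (rop pi (star x) w).
Proof.
move=> /graph_closureP uv Dw; apply/eqP; rewrite -subr_eq0; apply/eqP.
pose b := 2 * sqnorm w + 2 * sqnorm (rop pi (star x) w).
apply: (@sqmod_arb _ _ b) => e e0; have [z [Dz h1 h2]] := uv e e0.
have -> : hdot v w - hdot u (rop pi (star x) w) =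
    hdot (v - rop pi x z) w - hdot (u - z) (rop pi (star x) w).
  rewrite !hdotBl -(rop_star _ Dz Dw).
  by rewrite opprB addrA subrK.
apply: le_trans (sqmodB_le2 _ _) _; rewrite /b [leRHS]mulrDl -!mulrA.
apply: lerD; rewrite ler_pM2l//; apply: le_trans (hdot_CS _ _) _;
  by rewrite mulrC ler_wpM2l ?sqnorm_ge0// ltW.
Qed.

Lemma graph_closure_rop x u : D u -> graph_closure pi x (u, rop pi x u).
Proof. by move=> Du; apply: subset_closure. Qed.

Lemma rdom_separated v v' : (forall w, D w -> hdot v w = hdot v' w) -> v = v'.
Proof.
move=> vv'; apply/eqP; rewrite -subr_eq0; apply/eqP.
apply: (dense_orth (@rdom_dense _ _ _ pi)) => w Dw.
by rewrite hdotBl vv'// subrr.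
Qed.

Lemma graph_closure_closable x u v : D u -> graph_closure pi x (u, v) ->
  v = rop pi x u.
Proof.
move=> Du uv; apply: rdom_separated => w Dw.
by rewrite (graph_closure_adj uv Dw) rop_star.
Qed.

Lemma rdom_sub_closure u : D u -> closure_dom pi u.
Proof. by move=> Du x; exists (rop pi x u); exact: graph_closure_rop. Qed.

Lemma cauchy_sequence_rop x (b : R) (g : nat -> H) : (forall n, D (g n)) ->
  (forall u, D u -> sqnorm (rop pi x u) <= b * sqnorm u) ->
  cauchy_sequence g -> cauchy_sequence (fun n => rop pi x (g n)).
Proof.
(* The sign of [b] is unknown, hence the positive bound |b| + 1. *)
move=> Dg xb cg e e0; have b1 : 0 < `|b| + 1 by rewrite ltr_wpDl.
have [N hN] := cg _ (divr_gt0 e0 b1); exists N => n m Nn Nm.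
rewrite -ropBr//; apply: le_lt_trans (xb _ (rdomB (Dg _) (Dg _))) _.
have := hN _ _ Nn Nm; rewrite ltr_pdivlMr// mulrC; apply: le_lt_trans.
by rewrite ler_wpM2r ?sqnorm_ge0//; have := ler_norm b; lra.
Qed.

End StarRepTheory.

Section EquivalenceFromBases.
Variables (R : realType) (X : starAlgType R) (H : hilbertType R).
Variables (pi : starRep X H) (I : choiceType) (J : I -> choiceType).
Variables (K : I -> hilbertType R) (rho : forall i, starRep X (K i)).
Variables (E : forall i, J i -> H) (f : forall i, J i -> K i).
Let E' (t : {i & J i}) := E (tagged t).
Hypotheses (oE : orthonormal_family E') (tE : total_family E').
Hypothesis onf : forall i, orthonormal_family (@f i).
Hypothesis tf : forall i, total_family (@f i).
Hypothesis DE : forall i j, rdom pi (@E i j).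
Hypothesis Df : forall i j, rdom (rho i) (@f i j).
Hypothesis same_comb : forall x i j, exists S c,
  rop pi x (@E i j) = fcomb (@E i) c S /\
  rop (rho i) x (@f i j) = fcomb (@f i) c S.
Hypothesis domE : forall u, (forall x, exists v, forall i j,
  hdot v (@E i j) = hdot u (rop pi (star x) (@E i j))) -> rdom pi u.
Hypothesis domf : forall i u, (forall x, exists v, forall j,
  hdot v (@f i j) = hdot u (rop (rho i) (star x) (@f i j))) -> rdom (rho i) u.

(** By [same_comb] both representations have the same matrices in the two bases, so the unitary
    matching the bases intertwines them weakly. [domE] and [domf] say that a vector belongs to the
    domain as soon as every x acts on it weakly; this condition is carried over by the unitary, in
    both directions. *)
Lemma equiv_direct_sum_bases : equiv_direct_sum pi rho.
Proof.
have [W [uW hW]] := hsum_unitary_bases oE tE onf tf; exists W.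
have WE x u i j : hdot u (rop pi x (@E i j)) = hdot (W u i) (rop (rho i) x (f j)).
  have [S [c [-> ->]]] := same_comb x j.
  by rewrite /fcomb !hdot_sumr; apply: eq_bigr => k _; rewrite !hdotZr hW.
have Wdom u : rdom pi u -> forall i, rdom (rho i) (W u i).
  move=> Du i; apply: domf => x; exists (W (rop pi x u) i) => j.
  by rewrite hW -WE rop_star.
have Wrop x u i : rdom pi u -> W (rop pi x u) i = rop (rho i) x (W u i).
  move=> Du; apply/eqP; rewrite -subr_eq0; apply/eqP/tf => j.
  by rewrite hdotBl hW !rop_star ?WE ?subrr//; exact: Wdom.
split=> // u; split=> [Du|[Du fin]].
  split=> [|x]; first exact: Wdom.
  case: uW => _ /(_ (rop pi x u)) nW _.
  have -> : (fun i => rop (rho i) x (W u i)) = W (rop pi x u).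
    by apply: functional_extensionality_dep => i; rewrite Wrop.
  by rewrite nW ltry.
apply: domE => x; case: uW => _ _ /(_ _ (fin x))[v vE].
by exists v => i j; rewrite -hW vE rop_star// WE.
Qed.

End EquivalenceFromBases.

Section SimultaneousApproximation.
Local Open Scope fset_scope.
Variables (R : realType) (U A Y : starAlgType R).
Variables (phi : starHom U Y) (psi : starHom A Y).
Variables (H : hilbertType R) (pi : starRep Y H) (M : choiceType) (e : M -> H).
Hypotheses (oe : orthonormal_family e) (te : total_family e).
Hypothesis De : forall m, rdom pi (e m).
Hypothesis bounded : forall a, exists b : R, forall u, rdom pi u ->
  sqnorm (rop pi (psi a) u) <= b * sqnorm u.
Hypothesis factor : forall y, exists s : seq (A * U),
  y = \sum_(p <- s) psi p.1 * phi p.2.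

(** As the family is total, this means that the span of the [e m] with m in S is invariant under
    U. *)
Definition stable_fset (S : {fset M}) := forall f m n, m \in S -> n \notin S ->
  hdot (rop pi (phi f) (e m)) (e n) = 0.
Hypothesis local_fin : forall m, exists2 S, stable_fset S & m \in S.

Let stable_cover (s : seq M) : exists2 S, stable_fset S & {subset s <= S}.
Proof.
elim: s => [|m s [S sS hS]]; first by exists fset0 => // f m n; rewrite inE.
have [T sT mT] := local_fin m; exists (S `|` T) => [f k n|k].
  rewrite !inE negb_or => /orP[kS|kT] /andP[nS nT]; [exact: sS|exact: sT].
by rewrite !inE => /orP[/eqP->|/hS ->]; rewrite ?mT ?orbT.
Qed.

Variable u : H.
Variable v : U -> H.
Hypothesis uv : forall f m,
  hdot (v f) (e m) = hdot u (rop pi (phi (star f)) (e m)).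
Let uS w S := fcomb e (fun m => hdot w (e m)) S.

Let DuS w S : rdom pi (uS w S).
Proof. by apply: rdom_fsum => m _; exact: rdomZ. Qed.

(** Truncation to a stable set commutes with U. Outside S both coefficients vanish; for m in S the
    vector pi(star f) (e m) stays in the span of S, so the discarded part of u is orthogonal to
    it. *)
Let rop_uS f S : stable_fset S -> rop pi (phi f) (uS u S) = uS (v f) S.
Proof.
move=> sS; apply/eqP; rewrite -subr_eq0; apply/eqP/te => m.
rewrite hdotBl [X in _ - X]hdot_fcomb//; case: ifPn => mS; last first.
  rewrite rop_sumr ?hdot_suml => [|n _]; last exact: rdomZ.
  rewrite subr0 big_seq big1// => n nS.
  by rewrite ropZr// hdotZl sS// mulr0.
rewrite uv rop_star// -shom_star -hdotBl.
set w := rop _ _ _; have -> : w = uS w S.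
  apply: total_expand => // n nS; exact: sS.
rewrite hdot_sumr big_seq big1// => n nS.
by rewrite hdotZr hdotBl hdot_fcomb// nS subrr mulr0.
Qed.

Let approx (s : seq U) (eps : R) : 0 < eps -> exists w, [/\ rdom pi w,
  sqnorm (u - w) < eps &
  forall f, f \in s -> sqnorm (v f - rop pi (phi f) w) < eps].
Proof.
move=> e0.
have [S0 hS0] := total_approx oe te u e0.
have [T hT] : exists T : {fset M}, forall f, f \in s -> forall S, T `<=` S ->
    sqnorm (v f - uS (v f) S) < eps.
  elim: s => [|f s [T hT]]; first by exists fset0.
  have [T' hT'] := total_approx oe te (v f) e0.
  exists (T `|` T') => g; rewrite inE => /orP[/eqP-> S|gs S];
    rewrite fsubUset => /andP[h1 h2]; [exact: hT'|exact: hT].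
have [S sS hS] := stable_cover (S0 `|` T).
have S0S : S0 `<=` S by apply/fsubsetP => m mS; apply: hS; rewrite !inE mS.
have TS : T `<=` S by apply/fsubsetP => m mS; apply: hS; rewrite !inE mS orbT.
exists (uS u S); split=> //; first exact: hS0.
by move=> f fs; rewrite rop_uS//; exact: hT.
Qed.

(* The partial sums of u over stable finite sets commute with the action of U,
   so they approximate u simultaneously in all the graph norms of U; since A is
   bounded, they are Cauchy in the graph norm of any element of A U. *)
Lemma adjoint_in_closure_dom : closure_dom pi u.
Proof.
move=> y; have [s ->] := factor y.
have pos n : 0 < n.+1%:R^-1 :> R by rewrite invr_gt0.
have /choice[g hg] n := approx (unzip2 s) (pos n).
have Dg n : rdom pi (g n) by case: (hg n).
have cau : cauchy_sequence (fun n =>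
    rop pi (\sum_(p <- s) psi p.1 * phi p.2) (g n)).
  have : {subset s <= s} by [].
  (* The induction runs over lists contained in [s], while the vectors [g n] remain the
     approximations made for the whole of [s]. *)
  elim: {1 3}s => [_ r r0|[a f] t IH ts].
    by exists 0%N => n m _ _; rewrite big_nil !rop0l// subrr sqnorm0.
  under eq_fun do rewrite big_cons /= ropD// ropM//.
  apply: cauchy_sequenceD; last by apply: IH => p pt; apply: ts; rewrite inE pt orbT.
  have [b hb] := bounded a; apply: cauchy_sequence_rop hb _ => [n|r r0].
    exact: rop_dom.
  have r4 := divr_gt0 r0 (ltac:(by []) : 0 < 4 :> R).
  have [N hN] := inv_nat_small r4; exists N => n m Nn Nm.
  apply: le_lt_trans (sqnorm_triangle _ (v f) _) _.
  have fs : f \in unzip2 s by apply/mapP; exists (a, f) => //; apply: ts; rewrite mem_head.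
  have [_ _ /(_ f fs)] := hg n; have [_ _ /(_ f fs)] := hg m.
  rewrite [X in _ -> _ -> (2 * X + _ < _)%R]sqnormBC; have := hN _ Nn; have := hN _ Nm.
  move: (n.+1%:R^-1) (m.+1%:R^-1) => p q; lra.
have [w hw] := hilbert_complete cau; exists w.
apply/graph_closureP => r r0.
have [N hN] := inv_nat_small r0; have [N' hN'] := hw _ r0.
exists (g (maxn N N')); split=> //.
  have [_ + _] := hg (maxn N N') => /lt_trans; apply.
  by apply: hN; rewrite leq_maxl.
by apply: hN'; rewrite leq_maxr.
Qed.

End SimultaneousApproximation.

(** * The coordinate algebra *)

Section WeightOrbits.
Variables (R : realType) (A : algType R[i]) (p : R) (p0 : 0 < p).
Variables a b c d : A.
Local Notation "r %:S" := (r%:C : R[i]) (at level 2, format "r %:S").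
Hypothesis ba : b * a = (p ^- 2)%:S *: (a * b).
Hypothesis ca : c * a = (p ^- 2)%:S *: (a * c).
Hypothesis db : d * b = (p ^- 2)%:S *: (b * d).
Hypothesis cb : c * b = b * c.
Hypothesis ad : a * d = 1 + (p ^+ 2)%:S *: (b * c).
Variable del : uqgen -> A -> A.
Hypothesis delD : forall g x y, del g (x + y) = del g x + del g y.
Hypothesis delZ : forall g (k : R[i]) x, del g (k *: x) = k *: del g x.
Hypothesis delEM : forall x y,
  del genE (x * y) = del genE x * del genK y + del genKi x * del genE y.
Hypothesis delFM : forall x y,
  del genF (x * y) = del genF x * del genK y + del genKi x * del genF y.
Hypothesis delKM : forall x y, del genK (x * y) = del genK x * del genK y.
Hypothesis delKiM : forall x y, del genKi (x * y) = del genKi x * del genKi y.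
Hypotheses (delK1 : del genK 1 = 1) (delKi1 : del genKi 1 = 1) (delF1 : del genF 1 = 0)
  (delE1 : del genE 1 = 0).
Hypotheses (delKa : del genK a = (p^-1)%:S *: a) (delKb : del genK b = (p^-1)%:S *: b)
  (delKc : del genK c = p%:S *: c) (delKd : del genK d = p%:S *: d)
  (delKia : del genKi a = p%:S *: a) (delKib : del genKi b = p%:S *: b)
  (delKic : del genKi c = (p^-1)%:S *: c) (delKid : del genKi d = (p^-1)%:S *: d)
  (delFa : del genF a = c) (delFb : del genF b = d)
  (delFc : del genF c = 0) (delFd : del genF d = 0)
  (delEa : del genE a = 0) (delEb : del genE b = 0)
  (delEc : del genE c = a) (delEd : del genE d = b).

(** In closed form p^-n [n+1] with q = p^2: the coefficient of x^n y in x^(n+1) <| F when x <| F =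
    y, for x = a or x = b. Only its positivity matters. *)
Fixpoint orbit_coef (n : nat) : R :=
  if n is m.+1 then p ^- 3 * orbit_coef m + p ^+ n else 1.

Lemma orbit_coef_gt0 n : 0 < orbit_coef n.
Proof.
by elim: n => //= n IH; rewrite addr_gt0 ?mulr_gt0 ?invr_gt0 ?exprn_gt0.
Qed.

Let scaleC (x y : R) (u : A) : x%:S *: (y%:S *: u) = (x * y)%:S *: u.
Proof. by rewrite scalerA rmorphM. Qed.
Let scaleCD (x y : R) (u : A) : x%:S *: u + y%:S *: u = (x + y)%:S *: u.
Proof. by rewrite rmorphD scalerDl. Qed.
Let scaleC1 (u : A) : 1%:S *: u = u.
Proof. by rewrite scale1r. Qed.
Let pn0 : p != 0. Proof. by rewrite gt_eqF. Qed.

Let delKX x (k : R) n : del genK x = k%:S *: x -> del genK (x ^+ n) = (k ^+ n)%:S *: x ^+ n.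
Proof.
move=> Kx; elim: n => [|n IH]; first by rewrite !expr0 scale1r.
by rewrite !exprSr delKM IH Kx -scalerAl -scalerAr scaleC.
Qed.
Let delKiX x (k : R) n : del genKi x = k%:S *: x -> del genKi (x ^+ n) = (k ^+ n)%:S *: x ^+ n.
Proof.
move=> Kx; elim: n => [|n IH]; first by rewrite !expr0 scale1r.
by rewrite !exprSr delKiM IH Kx -scalerAl -scalerAr scaleC.
Qed.

Let delFX x y n : del genF x = y -> del genK x = (p^-1)%:S *: x ->
  del genKi x = p%:S *: x -> y * x = (p ^- 2)%:S *: (x * y) ->
  del genF (x ^+ n.+1) = (orbit_coef n)%:S *: (x ^+ n * y).
Proof.
move=> Fx Kx Kix yx; elim: n => [|n IH]; first by rewrite expr1 expr0 mul1r scaleC1.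
rewrite [x ^+ n.+2]exprSr delFM IH Fx Kx (delKiX _ Kix) -!scalerAl -scalerAr -!mulrA yx.
rewrite -scalerAr mulrA -exprSr !scaleC scaleCD; congr (_%:S *: _) => /=.
by field.
Qed.

Let abX j : a * b ^+ j = (p ^+ (2 * j))%:S *: (b ^+ j * a).
Proof.
have ab : a * b = (p ^+ 2)%:S *: (b * a).
  by rewrite ba scaleC mulfV ?scaleC1// expf_eq0.
elim: j => [|j IH]; first by rewrite muln0 !expr0 mul1r mulr1 scaleC1.
by rewrite exprSr mulrA IH -scalerAl -[b ^+ j * a * b]mulrA ab -scalerAr scaleC [b ^+ j * (b * a)]mulrA -exprD mulnS addnC.
Qed.

Let bXa j : b ^+ j * a = (p ^- (2 * j))%:S *: (a * b ^+ j).
Proof. by rewrite abX scaleC mulVf ?scaleC1// expf_eq0 (negPf pn0) andbF. Qed.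

Let cbX j : c * b ^+ j = b ^+ j * c.
Proof.
elim: j => [|j IH]; first by rewrite expr0 mul1r mulr1.
by rewrite exprS mulrA cb -mulrA IH mulrA.
Qed.

Lemma delK_mon i j : del genK (a ^+ i * b ^+ j) = (p^-1 ^+ (i + j))%:S *: (a ^+ i * b ^+ j).
Proof.
by rewrite delKM (delKX _ delKa) (delKX _ delKb) -scalerAl -scalerAr scaleC exprD.
Qed.

Lemma delE_mon i j : del genE (a ^+ i * b ^+ j) = 0.
Proof.
have delEX x n : del genE x = 0 -> del genE (x ^+ n) = 0.
  move=> Ex; elim: n => [|n IH]; first by rewrite expr0.
  by rewrite exprS delEM Ex IH mul0r mulr0 addr0.
by rewrite delEM !delEX// mul0r mulr0 addr0.
Qed.

(** The smallest subspace that contains all a^i b^j and is stable under the right action. Products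
    are deliberately not a constructor: that this subspace is all of A is the content of
    [weight_orbitT]. *)
Inductive weight_orbit : A -> Prop :=
| weight_orbit_mon i j : weight_orbit (a ^+ i * b ^+ j)
| weight_orbit_lin k x y : weight_orbit x -> weight_orbit y -> weight_orbit (k *: x + y)
| weight_orbit_del g x : weight_orbit x -> weight_orbit (del g x).

Local Notation Q := weight_orbit.

Let Q0 : Q 0.
Proof. by rewrite -(addNr (a ^+ 0 * b ^+ 0)) -scaleN1r; apply: weight_orbit_lin; exact: weight_orbit_mon. Qed.
Let QZ k x : Q x -> Q (k *: x).
Proof. by move=> Qx; rewrite -[k *: x]addr0; exact: weight_orbit_lin. Qed.
Let QD x y : Q x -> Q y -> Q (x + y).
Proof. by move=> Qx Qy; rewrite -[x]scale1r; exact: weight_orbit_lin. Qed.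
Let QB x y : Q x -> Q y -> Q (x - y).
Proof. by move=> Qx Qy; rewrite -scaleN1r; apply: QD => //; exact: QZ. Qed.
Let QZr (k : R) x : k != 0 -> Q (k%:S *: x) -> Q x.
Proof. by move=> k0 /(QZ (k^-1)%:S); rewrite scaleC mulVf// scaleC1. Qed.

Let ab_mon_d i j : a ^+ i.+1 * b ^+ j * d =
  (p ^+ (2 * j))%:S *: (a ^+ i * b ^+ j) + (p ^+ (2 * j.+1))%:S *: (a ^+ i * b ^+ j.+1 * c).
Proof.
have abd : a * b ^+ j * d =
    (p ^+ (2 * j))%:S *: b ^+ j + (p ^+ (2 * j.+1))%:S *: (b ^+ j.+1 * c).
  rewrite abX -scalerAl -[b ^+ j * a * d]mulrA ad mulrDr mulr1 -scalerAr scalerDr scaleC.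
  by rewrite -exprD mulnSr [b ^+ j.+1]exprSr -[b ^+ j * b * c]mulrA.
rewrite exprSr -[a ^+ i * a * _]mulrA -[_ * _ * d]mulrA abd mulrDr -!scalerAr.
by rewrite [a ^+ i * (_ * c)]mulrA.
Qed.

(* (a^(i+1) b^j) <| F is a positive multiple of a^i b^j c plus a multiple of
   a^i b^(j-1). *)
Let ab_mon_c i j : Q (a ^+ i * b ^+ j * c).
Proof.
have FaX n := delFX n delFa delKa delKia ca.
have FbX n := delFX n delFb delKb delKib db.
have := weight_orbit_del genF (weight_orbit_mon i.+1 j).
rewrite delFM (delKX _ delKb) FaX -scalerAl -scalerAr -!mulrA cbX.
case: j => [|j].
  rewrite expr0 delF1 mulr0 addr0 scaleC; apply: QZr.
  by rewrite mulf_neq0 ?expr0 ?oner_eq0 ?gt_eqF ?orbit_coef_gt0.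
rewrite FbX (delKiX _ delKia) -scalerAl -!scalerAr [a ^+ i.+1 * (_ * d)]mulrA ab_mon_d.
rewrite scalerDr scalerDr !scaleC addrCA [a ^+ i * (_ * c)]mulrA scaleCD; set u := (X in X + _) => h.
have Qu : Q u by apply: QZ; exact: weight_orbit_mon.
have := QB h Qu; rewrite addrAC subrr add0r => /QZr; apply.
have := orbit_coef_gt0 i; have := orbit_coef_gt0 j => s1 s2.
by rewrite gt_eqF// addr_gt0// !mulr_gt0 ?exprn_gt0 ?invr_gt0.
Qed.

Let ab_mon_gen i j (x : A) : x \in [:: a; b; c; d] -> Q (a ^+ i * b ^+ j * x).
Proof.
rewrite !inE => /or4P[] /eqP ->; last 1 first.
- case: i => [|i]; last by rewrite ab_mon_d; apply: QD; apply: QZ => //; exact: weight_orbit_mon.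
  have := weight_orbit_del genF (weight_orbit_mon 0 j.+1).
  rewrite expr0 !mul1r (delFX _ delFb delKb delKib db) => /QZr; apply.
  by rewrite gt_eqF ?orbit_coef_gt0.
- by rewrite -mulrA bXa -scalerAr mulrA -exprSr; apply: QZ; exact: weight_orbit_mon.
- by rewrite -mulrA -exprSr; exact: weight_orbit_mon.
- exact: ab_mon_c.
Qed.

Let gens := [:: a; b; c; d].
Let delKgen x : x \in gens -> exists2 k : R, k != 0 & del genK x = k%:S *: x.
Proof.
have pV : p^-1 != 0 by rewrite invr_eq0.
rewrite !inE => /or4P[] /eqP ->; [exists p^-1|exists p^-1|exists p|exists p] => //.
Qed.
Let delKigen x : x \in gens -> exists2 k : R, k != 0 & del genKi x = k%:S *: x.
Proof.
have pV : p^-1 != 0 by rewrite invr_eq0.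
rewrite !inE => /or4P[] /eqP ->; [exists p|exists p|exists p^-1|exists p^-1] => //.
Qed.

(** The product rule is solved for the wanted term: (x <| E)(y <| K) = (x y) <| E - (x <| K^-1)(y <|
    E), and likewise for F. Here y <| K is a nonzero multiple of y, and y <| E is 0 or another
    generator, so the last product is covered by [QKi]. This is why the induction keeps all
    generators y at once. *)
Let orbit_gen x : Q x -> forall y, y \in gens -> Q (x * y).
Proof.
elim=> {x} [i j y yg|k x x' _ IH _ IH' y yg|g x Qx IH y yg].
- exact: ab_mon_gen.
- by rewrite mulrDl -scalerAl; apply: weight_orbit_lin; [exact: IH|exact: IH'].
have [k k0 Ky] := delKgen yg; have [k' k'0 Kiy] := delKigen yg.
have QKi z : z \in gens -> Q (del genKi x * z).
  move=> zg; have [k1 k10 Kiz] := delKigen zg.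
  by apply: (QZr k10); rewrite scalerAr -Kiz -delKiM; apply/weight_orbit_del/IH.
case: g.
- apply: (QZr k0); rewrite scalerAr -Ky.
  have -> : del genE x * del genK y = del genE (x * y) - del genKi x * del genE y.
    by rewrite delEM addrK.
  apply: QB; first by apply/weight_orbit_del/IH.
  move: yg; rewrite !inE => /or4P[] /eqP ->; rewrite ?delEa ?delEb ?delEc ?delEd ?mulr0//;
    by apply: QKi; rewrite !inE eqxx ?orbT.
- apply: (QZr k0); rewrite scalerAr -Ky.
  have -> : del genF x * del genK y = del genF (x * y) - del genKi x * del genF y.
    by rewrite delFM addrK.
  apply: QB; first by apply/weight_orbit_del/IH.
  move: yg; rewrite !inE => /or4P[] /eqP ->; rewrite ?delFa ?delFb ?delFc ?delFd ?mulr0//;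
    by apply: QKi; rewrite !inE eqxx ?orbT.
- by apply: (QZr k0); rewrite scalerAr -Ky -delKM; apply/weight_orbit_del/IH.
- exact: QKi.
Qed.

Hypothesis ind : forall P : A -> Prop,
  (forall x, x \in [:: a; b; c; d] -> P x) -> (forall k, P (k *: (1 : A))) ->
  (forall x y, P x -> P y -> P (x + y)) ->
  (forall x y, P x -> P y -> P (x * y)) -> forall x, P x.

Lemma weight_orbitT x : weight_orbit x.
Proof.
have QM y : forall x, Q x -> Q (x * y).
  elim/ind: y => [y yg z Qz|k z Qz|y y' IH IH' z Qz|y y' IH IH' z Qz].
  - exact: orbit_gen.
  - by rewrite -scalerAr mulr1; exact: QZ.
  - by rewrite mulrDr; apply: QD; [exact: IH|exact: IH'].
  - by rewrite mulrA; apply: IH'; exact: IH.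
by have := QM x _ (weight_orbit_mon 0 0); rewrite !expr0 !mul1r.
Qed.

End WeightOrbits.

Section Coordinates.
Variables (R : realType) (q : R) (hq : 0 < q < 1).
Local Notation C := R[i].
Local Notation A := (OSUq2 hq).
Local Notation "[ t ]" := (@pclass R (oq_pres hq) t).
Local Notation del := (@oq_del R q hq).

Definition oq_elt (x : oqgen) : A := [NCgen x].
Definition qhalf : R := Num.sqrt q.
Local Notation p := qhalf.
Local Notation a := (oq_elt gena).
Local Notation b := (oq_elt genb).
Local Notation c := (oq_elt genc).
Local Notation d := (oq_elt gend).

Lemma qlam_neq0 : qlam q != 0.
Proof.
case/andP: hq => h0 h1.
by rewrite /qlam subr_eq0 lt_eqF// (lt_trans h1)// invf_gt1.
Qed.
Lemma qhalf_gt0 : 0 < p. Proof. by rewrite sqrtr_gt0 (q_gt0 hq). Qed.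
Lemma qhalf_neq0 : p != 0. Proof. by rewrite gt_eqF ?qhalf_gt0. Qed.
Lemma sqr_qhalf : p ^+ 2 = q. Proof. by rewrite sqr_sqrtr// ltW ?(q_gt0 hq). Qed.
Lemma qhalf_lt1 : p < 1.
Proof.
rewrite -(ltr_pXn2r (ltac:(by []) : (0 < 2)%N)) ?nnegrE ?(ltW qhalf_gt0)//.
by rewrite sqr_qhalf expr1n; case/andP: hq.
Qed.
Lemma qhalfX_neq1 n : p ^+ n.+1 != 1.
Proof. by rewrite lt_eqF// exprn_ilt1 ?(ltW qhalf_gt0) ?qhalf_lt1. Qed.

Let relE t u : oq_rel q t u -> [t] = [u].
Proof. by move=> tu; apply/pclassP; exact: nc_rel. Qed.
Let scaleC (x y : R) (u : A) : x%:C *: (y%:C *: u) = (x * y)%:C *: u.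
Proof. by rewrite scalerA rmorphM. Qed.
Let q0 : q != 0. Proof. by rewrite gt_eqF ?(q_gt0 hq). Qed.
Let pV : p ^- 2 = q^-1. Proof. by rewrite sqr_qhalf. Qed.
Let qK (u : A) : q^-1%:C *: (q%:C *: u) = u.
Proof. by rewrite scaleC mulVf// scale1r. Qed.

Lemma oq_ba : b * a = (p ^- 2)%:C *: (a * b).
Proof. by have := relE (oq_ab q); rewrite !(oq_cE hq) pV => ->; rewrite qK. Qed.
Lemma oq_ca : c * a = (p ^- 2)%:C *: (a * c).
Proof. by have := relE (oq_ac q); rewrite !(oq_cE hq) pV => ->; rewrite qK. Qed.
Lemma oq_db : d * b = (p ^- 2)%:C *: (b * d).
Proof. by have := relE (oq_bd q); rewrite !(oq_cE hq) pV => ->; rewrite qK. Qed.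
Lemma oq_cb : c * b = b * c.
Proof. by have := relE (oq_bc q); rewrite !(oq_cE hq) => ->. Qed.
Lemma oq_ad : a * d = 1 + (p ^+ 2)%:C *: (b * c).
Proof.
have := relE (oq_det q); rewrite !(oq_cE hq) scale1r sqr_qhalf => <-.
by rewrite scaleN1r subrK.
Qed.
Lemma oq_da : d * a = 1 + (p ^- 2)%:C *: (b * c).
Proof.
have := relE (oq_ad_da q); rewrite !(oq_cE hq) scaleN1r => lE.
have -> : d * a = a * d - (a * d - d * a) by rewrite opprB addrC subrK.
rewrite -/a -/b -/c -/d in lE *.
rewrite lE oq_ad -addrA -scalerBl -rmorphB; congr (_ + _%:C *: _).
by rewrite /qlam sqr_qhalf opprB addrC subrK.
Qed.

Lemma oq_del_elt g x : del g (oq_elt x) = [oq_act_gen q x g].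
Proof. exact: oq_delE. Qed.

Lemma oq_weight_orbit x : weight_orbit a b del x.
Proof.
have hE := (oq_del_elt, oq_cE hq).
apply: (@weight_orbitT R A p qhalf_gt0 a b c d oq_ba oq_ca oq_db oq_cb oq_ad);
  try by rewrite !hE ?scale0r.
- exact: oq_delEM.
- exact: oq_delFM.
- exact: oq_delKM.
- exact: oq_delKiM.
- by rewrite oq_del1 scale1r.
- by rewrite oq_del1 scale1r.
- by rewrite oq_del1 scale0r.
- move=> P Pg Pc PD PM {}x; elim/oq_ind: x => //.
  by case; apply: Pg; rewrite !inE eqxx ?orbT.
Qed.

Definition invariant_functional (phi : A -> C) :=
  (forall (k : C) x y, phi (k *: x + y) = k * phi x + phi y) /\
  (forall g x, phi (del g x) = uq_counit_gen R g * phi x).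

Lemma oq_delK_mon i j :
  del genK (a ^+ i * b ^+ j) = (p^-1 ^+ (i + j))%:C *: (a ^+ i * b ^+ j).
Proof.
by apply: delK_mon; rewrite ?oq_del_elt ?oq_del1 ?(oq_cE hq) ?scale1r//; exact: oq_delKM.
Qed.
Lemma oq_delE_mon i j : del genE (a ^+ i * b ^+ j) = 0.
Proof.
by apply: (@delE_mon _ _ _ _ _ (@oq_delEM R q hq));
  rewrite ?oq_del_elt ?oq_del1 ?(oq_cE hq) ?scale0r.
Qed.

(** Both sides are compared along the orbit of the monomials a^i b^j. For i + j > 0 such a monomial
    is an eigenvector of K with eigenvalue p^-(i+j) different from 1, so every invariant functional
    kills it; only the monomial 1 remains. *)
Lemma invariant_functional_unique phi h :
  invariant_functional phi -> invariant_functional h -> h 1 = 1 ->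
  forall x, phi x = phi 1 * h x.
Proof.
move=> [phiL phiI] [hL hI] h1 x.
elim: (oq_weight_orbit x) => {x} [i j|k x y _ IHx _ IHy|g x _ IH].
- move: (oq_delK_mon i j); case ij: (i + j)%N => [|n] Kij.
    case: i j ij {Kij} => [|i] [|j] // _.
    by rewrite !expr0 mul1r h1 mulr1.
  have z0 psi : invariant_functional psi -> psi (a ^+ i * b ^+ j) = 0.
    move=> [psiL psiI]; have := psiI genK (a ^+ i * b ^+ j); rewrite Kij mul1r.
    have psi0 : psi 0 = 0.
      by have := psiL (-1) 0 0; rewrite scaler0 addr0 mulN1r addNr.
    rewrite -[_ *: _]addr0 psiL psi0 addr0 => /eqP.
    rewrite -subr_eq0 -{2}[psi _]mul1r -mulrBl mulf_eq0 => /orP[|/eqP//].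
    rewrite -(rmorph1 (real_complex R)) -rmorphB.
    rewrite -(rmorph0 (real_complex R)) (inj_eq (@complexI R)) subr_eq0 exprVn invr_eq1.
    by rewrite (negPf (qhalfX_neq1 n)).
  by rewrite !z0// mulr0.
- by rewrite phiL hL IHx IHy mulrDr mulrCA.
- by rewrite phiI hI IH mulrCA.
Qed.

(* The automorphisms (a, b, c, d) -> (t a, t^-1 b, t c, t^-1 d) commute with the
   right action of U, hence preserve invariant functionals; this makes the
   monomials a^i b^j of the same degree orthogonal. *)
Definition torus_coef (t : R) (g : oqgen) : R :=
  match g with gena | genc => t | genb | gend => t^-1 end.

Fixpoint nc_torus (t : R) (u : ncpoly C oqgen) : ncpoly C oqgen :=
  match u with
  | NCgen g => ((torus_coef t g)%:C *: NCgen g)%nc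
  | NCconst k => NCconst k
  | NCadd u v => (nc_torus t u + nc_torus t v)%nc
  | NCmul u v => (nc_torus t u * nc_torus t v)%nc
  end.

(** The involution exchanges a with d and b with c up to scalars, and these have inverse torus
    weights; hence t becomes t^-1. *)
Lemma nc_torus_star t u :
  [nc_torus t (nc_star (oq_star q) u)] = star [nc_torus t^-1 u].
Proof.
elim: u => [g|k|u IHu v IHv|u IHu v IHv] /=.
- rewrite (oq_cE hq) starZ conj_rc starE.
  by case: g; rewrite /= !(oq_cE hq) ?invrK// !scalerA mulrC.
- by rewrite starE.
- by rewrite !(oq_cE hq) IHu IHv starD.
- by rewrite !(oq_cE hq) IHu IHv starM.
Qed.

Lemma nc_torus_rel t u v : t != 0 -> oq_rel q u v -> [nc_torus t u] = [nc_torus t v].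
Proof.
move=> t0 r; have := relE r; case: r => /=;
rewrite !(oq_cE hq) -?scalerAl -?scalerAr ?scaleC ?mulfV// ?mulVf// ?divfK// ?mulfVK//
  ?scale1r => h; try exact: h; rewrite h scaleC; congr (_%:C *: _); by field.
Qed.

Lemma nc_torus_cong t u v : t != 0 ->
  nc_cong (oq_star q) (oq_rel q) u v -> [nc_torus t u] = [nc_torus t v].
Proof.
move=> t0; elim=> {u v} /=.
- by move=> u v uv; exact: nc_torus_rel.
- move=> u v uv; rewrite !nc_torus_star (nc_torus_rel _ uv)//.
  by rewrite invr_eq0.
- by [].
- by move=> u v _ ->.
- by move=> u v w _ -> _ ->.
- by move=> u u' v v' _ IH _ IH'; rewrite !(oq_cE hq) IH IH'.
- by move=> u u' v v' _ IH _ IH'; rewrite !(oq_cE hq) IH IH'.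
- by move=> u v; rewrite !(oq_cE hq) addrC.
- by move=> u v w; rewrite !(oq_cE hq) addrA.
- by move=> u; rewrite !(oq_cE hq) scale0r add0r.
- by move=> u; rewrite !(oq_cE hq) scale0r scaleN1r addNr.
- by move=> u v w; rewrite !(oq_cE hq) mulrA.
- by move=> u; rewrite !(oq_cE hq) scale1r.
- by move=> u; rewrite !(oq_cE hq) scale1r mulr1.
- by move=> u v w; rewrite !(oq_cE hq) mulrDl.
- by move=> u v w; rewrite !(oq_cE hq) mulrDr.
- by move=> k l; rewrite !(oq_cE hq) scalerDl.
- by move=> k l; rewrite !(oq_cE hq) scalerA.
- by move=> k u; rewrite !(oq_cE hq) -scalerAr mulr1.
Qed.

Definition torus (t : R) (x : A) : A := [nc_torus t (repr x)].

Section Torus.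
Variables (t : R) (t0 : t != 0).

Lemma torusE u : torus t [u] = [nc_torus t u].
Proof. by apply: nc_torus_cong => //; exact: (@pclass_repr R (oq_pres hq) u). Qed.
Lemma torusD x y : torus t (x + y) = torus t x + torus t y.
Proof.
elim/pclass_ind: x => u; elim/pclass_ind: y => v.
by rewrite -pclassD !torusE /= pclassD.
Qed.
Lemma torusM x y : torus t (x * y) = torus t x * torus t y.
Proof.
elim/pclass_ind: x => u; elim/pclass_ind: y => v.
by rewrite -pclassM !torusE /= pclassM.
Qed.
Lemma torusZ (k : C) x : torus t (k *: x) = k *: torus t x.
Proof. by elim/pclass_ind: x => u; rewrite -pclassZ !torusE /= pclassZ. Qed.
Lemma torus1 : torus t 1 = 1.
Proof. exact: (torusE (NCconst 1)). Qed.
Lemma torus_elt g : torus t (oq_elt g) = (torus_coef t g)%:C *: oq_elt g.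
Proof. by rewrite torusE /= pclassZ. Qed.
Lemma torusX x n : torus t (x ^+ n) = torus t x ^+ n.
Proof.
by elim: n => [|n IH]; rewrite ?expr0 ?torus1// !exprS torusM IH.
Qed.

(** The right action mixes a only with c and b only with d, and the two generators of each pair have
    the same torus weight. *)
Lemma torus_del g x : torus t (del g x) = del g (torus t x).
Proof.
have t00 : torus t 0 = 0 by rewrite -(scale0r (0 : A)) torusZ !scale0r.
elim/oq_ind: x g => [x|k|x y IHx IHy|x y IHx IHy] g.
- rewrite torus_elt oq_delZ !oq_del_elt.
  case: x; case: g; rewrite /= ?(oq_cE hq) -?/(oq_elt _) ?scale0r ?torusZ ?torus1
    ?torus_elt ?scaler0 //= !scalerA; by rewrite mulrC.
- by rewrite torusZ torus1 oq_delZ oq_del1 !torusZ torus1.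
- by rewrite torusD !oq_delD torusD IHx IHy.
- by rewrite torusM !oq_delM (big_morph _ torusD t00); apply: eq_bigr => r _;
    rewrite torusM IHx IHy.
Qed.

End Torus.

Lemma star_elt_c : star c = (- q^-1)%:C *: b.
Proof. by rewrite starE /= (oq_cE hq) rmorphN. Qed.
Lemma star_elt_b : star b = (- q)%:C *: c.
Proof. by rewrite starE /= (oq_cE hq) rmorphN. Qed.
Lemma star_elt_a : star a = d.
Proof. by rewrite starE. Qed.
Lemma star_elt_d : star d = a.
Proof. by rewrite starE. Qed.

Lemma starX (x : A) n : star (x ^+ n) = star x ^+ n.
Proof. by elim: n => [|n IH]; rewrite ?expr0 ?star1// exprS starM IH exprSr. Qed.

Lemma invariant_mon_orth h i j i' j' : invariant_functional h -> h 1 = 1 ->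
  (i + j)%N = (i' + j')%N -> i != i' ->
  h (star (a ^+ i * b ^+ j) * (a ^+ i' * b ^+ j')) = 0.
Proof.
move=> hI h1 ij ii'; set x := _ * _.
have two0 : (2 : R) != 0 by [].
(* The torus element 2 multiplies x by 2^(j+i'-i-j'), which for equal degrees is 4^(i'-i) and so
   differs from 1. *)
pose r : R := 2 ^+ j * (2^-1) ^+ i * (2 ^+ i' * (2^-1) ^+ j').
have xr : torus 2 x = r%:C *: x.
  have eX g n : torus 2 (oq_elt g ^+ n) = (torus_coef 2 g ^+ n)%:C *: (oq_elt g ^+ n).
    rewrite torusX// torus_elt//.
    by rewrite exprZn rmorphXn.
  rewrite /x starM !starX star_elt_a star_elt_b exprZn.
  rewrite !(torusM, torusZ, eX) //=.
  rewrite -!scalerAl -!scalerAr -?scalerAl !scalerA; congr (_ *: _).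
  rewrite /r !rmorphM /=; ring.
have hx : h (torus 2 x) = h x.
  have htI : invariant_functional (h \o torus 2).
    case: hI => hL hIn; split=> [k y z|g y] /=; first by rewrite torusD// torusZ// hL.
    by rewrite torus_del// hIn.
  have := invariant_functional_unique htI hI h1 x.
  by rewrite /= torus1// h1 mul1r.
move: hx; rewrite xr; case: hI => hL _.
have h0 : h 0 = 0 by have := hL (-1) 0 0; rewrite scaler0 addr0 mulN1r addNr.
rewrite -[_ *: x]addr0 hL h0 addr0 => /eqP.
rewrite -subr_eq0 -{2}[h x]mul1r -mulrBl mulf_eq0 => /orP[|/eqP//].
rewrite -(rmorph1 (real_complex R)) -rmorphB.
rewrite -(rmorph0 (real_complex R)) (inj_eq (@complexI R)) subr_eq0 => /eqP r1.
have : (2 : R) ^+ (j + i') = 2 ^+ (i + j') * r.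
  by rewrite /r !exprD !exprVn; field; rewrite !expf_eq0 (negPf two0) !andbF.
rewrite r1 mulr1.
move/eqP; rewrite -!natrX eqr_nat eqn_exp2l// => /eqP e.
by move: ii'; rewrite (_ : i = i') ?eqxx//; lia.
Qed.

End Coordinates.

(** * The cross product algebra *)

Section Embeddings.
Variables (R : realType) (q : R) (hq : 0 < q < 1).

Lemma inUE f : inU hq (@pclass R (uq_pres q) f) =
  @pclass R (uo_pres hq) (nc_map (@inl uqgen oqgen) f).
Proof.
exact: (@pmapE R (uq_pres q) (uo_pres hq) inl (fun=> erefl) (@uo_uq R q)).
Qed.
Lemma inOE t : inO hq (@pclass R (oq_pres hq) t) =
  @pclass R (uo_pres hq) (nc_map (@inr uqgen oqgen) t).
Proof.
exact: (@pmapE R (oq_pres hq) (uo_pres hq) inr (fun=> erefl) (@uo_oq R q)).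
Qed.

End Embeddings.

Opaque inU inO.

Section CrossRelations.
Variables (R : realType) (q : R) (hq : 0 < q < 1).
Local Notation C := R[i].
Local Notation A := (OSUq2 hq).
Local Notation U := (Uqsu2 q).
Local Notation X := (UOSUq2 hq).
Local Notation del := (@oq_del R q hq).
Local Notation "[ t ]X" := (@pclass R (uo_pres hq) t).

Definition ugen (g : uqgen) : X := inU hq (uq_elt q g).

Lemma ugenE g : ugen g = [NCgen (inl g)]X.
Proof. exact: inUE. Qed.

Lemma cross_rel x g : inO hq x * ugen g =
  \sum_(r <- uq_coprod_gen g) ugen r.1 * inO hq (del r.2 x).
Proof.
elim/pclass_ind: x => t; rewrite inOE ugenE -pclassM.
rewrite (_ : pclass _ = [nc_sum [seq
    (nc_map (@inl uqgen oqgen) r.1 * nc_map (@inr uqgen oqgen) (oq_act_nc q t r.2))%nc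
    | r <- uq_coprod_nc (NCgen g)]]X); last first.
  by apply/pclassP/nc_rel; exact: (uo_cross q t (NCgen g)).
rewrite pclass_sum /= -map_comp big_map; apply: eq_bigr => r _ /=.
by rewrite pclassM ugenE oq_delE inOE.
Qed.

Lemma uq_rel_ugen f g : uq_rel q f g ->
  [nc_map (@inl uqgen oqgen) f]X = [nc_map (@inl uqgen oqgen) g]X.
Proof. by move=> fg; apply/pclassP/nc_rel; exact: uo_uq. Qed.

Let qV : q^-1%:C = q%:C^-1 :> C.
Proof. by rewrite rmorphV// unitfE gt_eqF ?(q_gt0 hq). Qed.
Let q0 : q%:C != 0 :> C.
Proof. by rewrite -(rmorph0 (real_complex R)) (inj_eq (@complexI R)) gt_eqF ?(q_gt0 hq). Qed.

Definition uo_cE := (@pclassZ R (uo_pres hq), @pclassD R (uo_pres hq),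
  @pclassM R (uo_pres hq), @pclass_const R (uo_pres hq)).

Lemma ugen_KiK : ugen genKi * ugen genK = 1.
Proof. by rewrite !ugenE -pclassM (uq_rel_ugen (uq_KiK q)). Qed.
Lemma ugen_KF : ugen genK * ugen genF = q^-1%:C *: (ugen genF * ugen genK).
Proof.
have := uq_rel_ugen (uq_KFKi q); rewrite /= !uo_cE -!ugenE scalerAl => <-.
by rewrite -[RHS]mulrA ugen_KiK mulr1.
Qed.
Lemma ugen_EF : ugen genE * ugen genF = ugen genF * ugen genE +
  (qlam q)^-1%:C *: (ugen genK * ugen genK - ugen genKi * ugen genKi).
Proof.
have := uq_rel_ugen (uq_EF q); rewrite /= !uo_cE -!ugenE !scaleN1r => <-.
by rewrite addrC subrK.
Qed.

Lemma inOZ k x : inO hq (k *: x) = k *: inO hq x.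
Proof. exact: shomZ. Qed.

Lemma inO0 : inO hq 0 = 0.
Proof. by rewrite -(scale0r (1 : A)) inOZ scale0r. Qed.

Lemma ugen_K_inO x : ugen genK * inO hq x = inO hq (del genKi x) * ugen genK.
Proof. by rewrite cross_rel big_seq1 /= oq_delKi_K. Qed.
Lemma ugen_Ki_inO x : ugen genKi * inO hq x = inO hq (del genK x) * ugen genKi.
Proof. by rewrite cross_rel big_seq1 /= oq_delK_Ki. Qed.
(** The cross relation is applied to x <| K^-1, so that the twist by K disappears from the term
    starting with E. The remaining K^-1 is then moved to the right as well. *)
Lemma ugen_E_inO x : ugen genE * inO hq x =
  inO hq (del genKi x) * ugen genE - q^-1%:C *: (inO hq (del genE x) * ugen genKi).
Proof.
rewrite cross_rel !big_cons big_nil addr0 /= oq_delKi_K ugen_Ki_inO.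
have -> : del genK (del genE (del genKi x)) = q^-1%:C *: del genE x.
  by rewrite -[in RHS](oq_delKi_K x) oq_delKE scalerA qV mulVf// scale1r.
by rewrite inOZ -scalerAl addrK.
Qed.
Lemma ugen_F_inO x : ugen genF * inO hq x =
  inO hq (del genKi x) * ugen genF - q%:C *: (inO hq (del genF x) * ugen genKi).
Proof.
rewrite cross_rel !big_cons big_nil addr0 /= oq_delKi_K ugen_Ki_inO.
have -> : del genK (del genF (del genKi x)) = q%:C *: del genF x.
  by rewrite -[in RHS](oq_delKi_K x) oq_delKF scalerA qV mulfV// scale1r.
by rewrite inOZ -scalerAl addrK.
Qed.

(** The order is opposite to that of the cross product U (x) A: with A on the left, the bounded
    operators are applied last and preserve the convergence obtained for U. *)
Definition AU_sum (y : X) := exists s : seq (A * U),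
  y = \sum_(r <- s) inO hq r.1 * inU hq r.2.

Lemma AU_sumD y z : AU_sum y -> AU_sum z -> AU_sum (y + z).
Proof. by move=> [s ->] [t ->]; exists (s ++ t); rewrite big_cat. Qed.
Lemma AU_sum1 a f : AU_sum (inO hq a * inU hq f).
Proof. by exists [:: (a, f)]; rewrite big_seq1. Qed.
Lemma AU_sum_ugen a g f : AU_sum (inO hq a * ugen g * inU hq f).
Proof. by rewrite -mulrA /ugen -shomM; exact: AU_sum1. Qed.
Lemma AU_sumZ k y : AU_sum y -> AU_sum (k *: y).
Proof.
move=> [s ->]; exists [seq (k *: r.1, r.2) | r <- s].
by rewrite big_map scaler_sumr; apply: eq_bigr => r _; rewrite inOZ -scalerAl.
Qed.

Lemma AU_sumM t y : AU_sum y -> AU_sum ([t]X * y).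
Proof.
elim: t y => [g|k|t IHt u IHu|t IHt u IHu] y [s ->].
- elim: s => [|[x f] s IH]; first by rewrite big_nil mulr0; exists [::]; rewrite big_nil.
  rewrite big_cons mulrDr; apply: AU_sumD IH.
  case: g => g /=; last first.
    rewrite -/(nc_map (@inr uqgen oqgen) (NCgen g)) -inOE mulrA -shomM.
    exact: AU_sum1.
  rewrite -ugenE mulrA; case: g.
  + rewrite ugen_E_inO mulrBl -scaleN1r -scalerAl; apply: AU_sumD; first exact: AU_sum_ugen.
    by do 2 apply: AU_sumZ; exact: AU_sum_ugen.
  + rewrite ugen_F_inO mulrBl -scaleN1r -scalerAl; apply: AU_sumD; first exact: AU_sum_ugen.
    by do 2 apply: AU_sumZ; exact: AU_sum_ugen.
  + by rewrite ugen_K_inO; exact: AU_sum_ugen.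
  + by rewrite ugen_Ki_inO; exact: AU_sum_ugen.
- by rewrite pclass_const -scalerAl mul1r; apply: AU_sumZ; exists s.
- by rewrite pclassD mulrDl; apply: AU_sumD; [apply: IHt|apply: IHu]; exists s.
- by rewrite pclassM -mulrA; apply/IHt/IHu; exists s.
Qed.

Lemma AU_sumT y : AU_sum y.
Proof.
elim/pclass_ind: y => t; rewrite -[[t]X]mulr1; apply: AU_sumM.
by have := AU_sum1 1 1; rewrite !shom1 mulr1.
Qed.

End CrossRelations.

Section CrossReps.
Variables (R : realType) (q : R) (hq : 0 < q < 1).
Local Notation C := R[i].
Local Notation A := (OSUq2 hq).
Local Notation U := (Uqsu2 q).
Local Notation X := (UOSUq2 hq).
Local Notation del := (@oq_del R q hq).
Local Notation ugen := (ugen hq).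
Variables (H : hilbertType R) (pi : starRep X H).
Local Notation D := (rdom pi).

(** Meant for the two columns (a, c) and (b, d) of the unitary matrix of generators: the squared
    norms of x u and y u add up to that of u. *)
Lemma sqnorm_pair_bound x y : star x * x + star y * y = 1 -> forall u, D u ->
  sqnorm (rop pi (inO hq x) u) <= sqnorm u /\ sqnorm (rop pi (inO hq y) u) <= sqnorm u.
Proof.
move=> xy u Du; have Dr z := rop_dom z Du.
suff -> : sqnorm u = sqnorm (rop pi (inO hq x) u) + sqnorm (rop pi (inO hq y) u).
  by rewrite lerDl lerDr !sqnorm_ge0.
apply: (@complexI R); rewrite rmorphD /= -!hdot_sqnorm !rop_star// -hdotDr -!ropM// -ropD//.
by rewrite -!shom_star -!shomM -shomD xy shom1 rop1.
Qed.

Lemma inO_bounded x : exists b : R, forall u, D u ->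
  sqnorm (rop pi (inO hq x) u) <= b * sqnorm u.
Proof.
have q0 : q%:C != 0 :> C.
  by rewrite -(rmorph0 (real_complex R)) (inj_eq (@complexI R)) gt_eqF ?(q_gt0 hq).
(* Nonnegative bounds are needed to multiply them in the case of a product. *)
suff [b [_ hb]] : exists b : R, 0 <= b /\ forall u, D u ->
    sqnorm (rop pi (inO hq x) u) <= b * sqnorm u by exists b.
have gen1 : star (oq_elt hq gena) * oq_elt hq gena
    + star (oq_elt hq genc) * oq_elt hq genc = 1.
  rewrite star_elt_a star_elt_c -scalerAl (oq_da hq) (sqr_qhalf hq) -addrA rmorphN scaleNr.
  by rewrite subrr addr0.
have gen2 : star (oq_elt hq genb) * oq_elt hq genb
    + star (oq_elt hq gend) * oq_elt hq gend = 1.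
  rewrite star_elt_d star_elt_b -scalerAl (oq_ad hq) (sqr_qhalf hq) (oq_cb hq) addrC -addrA rmorphN scaleNr.
  by rewrite subrr addr0.
elim/oq_ind: x => [x|k|x y [b [b0 hb]] [b' [b'0 hb']]|x y [b [b0 hb]] [b' [b'0 hb']]].
- exists 1; split=> // u Du; rewrite mul1r.
  have [] := sqnorm_pair_bound gen1 Du; have [] := sqnorm_pair_bound gen2 Du.
  by case: x.
- exists (sqmod k); split=> [|u Du]; first exact: sqmod_ge0.
  by rewrite shomZ shom1 ropZ// rop1// sqnormZ.
- exists (2 * b + 2 * b'); split=> [|u Du]; first by rewrite addr_ge0 ?mulr_ge0.
  rewrite shomD ropD//; apply: le_trans (sqnorm_le2 _ _) _.
  have := hb u Du; have := hb' u Du; nra.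
- exists (b * b'); split=> [|u Du]; first exact: mulr_ge0.
  rewrite shomM ropM//; apply: le_trans (hb _ (rop_dom _ Du)) _.
  by rewrite -mulrA ler_wpM2l// hb'.
Qed.

Definition inv_vector (xi : H) :=
  D xi /\ forall g, rop pi (ugen g) xi = uq_counit_gen R g *: xi.

Section Invariant.
Variables (xi : H) (hxi : inv_vector xi).
Let Dxi : D xi := hxi.1.

(** Moving g past x until it meets the invariant vector leaves x <| S^-1(g): the formula defining
    the Heisenberg representation holds for every invariant vector. *)
Lemma inv_ugen x g : rop pi (ugen g) (rop pi (inO hq x) xi) =
  rop pi (inO hq (oq_op (uq_antipV_gen q g) x)) xi.
Proof.
case: hxi => _ gxi; rewrite -ropM//; case: g => /=;
rewrite ?ugen_E_inO ?ugen_F_inO ?ugen_K_inO ?ugen_Ki_inO ?ropBl ?ropZ ?ropM ?gxi//= ?scale0r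
  ?rop0r ?sub0r ?scale1r//.
- by rewrite oq_delZ inOZ ropZ// scaleNr.
- by rewrite oq_delZ inOZ ropZ// scaleNr.
Qed.

Lemma inv_term t x : rop pi (@pclass R (uo_pres hq) t) (rop pi (inO hq x) xi) =
  rop pi (inO hq (uo_op t x)) xi.
Proof.
elim: t x => [[g|g]|k|t IHt u IHu|t IHt u IHu] x /=.
- by rewrite -ugenE inv_ugen.
- by rewrite -/(nc_map (@inr uqgen oqgen) (NCgen g)) -inOE -ropM// -shomM.
- rewrite pclass_const ropZ ?rop1 ?inOZ ?ropZ//; exact: rop_dom.
- by rewrite pclassD ropD ?IHt ?IHu ?shomD ?ropD//; exact: rop_dom.
- by rewrite pclassM ropM ?IHu ?IHt//; exact: rop_dom.
Qed.

Lemma inv_rop t : rop pi (@pclass R (uo_pres hq) t) xi = rop pi (inO hq (uo_op t (1 : A))) xi.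
Proof. by rewrite -inv_term shom1 rop1. Qed.

(** By [inv_ugen], x <| S^-1(g) acts on xi as g x does, and g is moved by adjunction to xi', where
    it acts by the counit. Since S^-1 maps E and F to nonzero multiples of themselves and exchanges
    K with K^-1, this covers all generators. *)
Lemma inv_invariant_functional xi' : inv_vector xi' ->
  invariant_functional (fun x => hdot (rop pi (inO hq x) xi) xi').
Proof.
move=> [Dxi' gxi']; have qn0 : q != 0 by rewrite gt_eqF ?(q_gt0 hq).
have gE g x : hdot (rop pi (inO hq (oq_op (uq_antipV_gen q g) x)) xi) xi' =
    uq_counit_gen R g * hdot (rop pi (inO hq x) xi) xi'.
  rewrite -inv_ugen rop_star//; last exact: rop_dom.
  have -> : star (ugen g) = ugen (match g with genE => genF | genF => genE | h => h end).
    by case: g; rewrite -(shom_star (inU hq)) starE.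
  by case: g; rewrite gxi' /= ?scale0r ?scale1r ?hdot0r ?mul0r ?mul1r.
have scal (k : R) y : k != 0 -> hdot (rop pi (inO hq (- k%:C *: y)) xi) xi' = 0 ->
    hdot (rop pi (inO hq y) xi) xi' = 0.
  move=> k0; rewrite inOZ ropZ// hdotZl => /eqP; rewrite mulf_eq0 oppr_eq0.
  by rewrite -(rmorph0 (real_complex R)) (inj_eq (@complexI R)) (negPf k0) => /eqP.
split=> [k x y|g x]; first by rewrite shomD inOZ ropD// ropZ// hdotDl hdotZl.
case: g => /=.
- rewrite mul0r; apply: (scal q^-1); first by rewrite invr_eq0.
  by have := gE genE x; rewrite /= oq_delZ mul0r.
- rewrite mul0r; apply: (scal q) => //.
  by have := gE genF x; rewrite /= oq_delZ mul0r.
- exact: (gE genKi x).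
- exact: (gE genK x).
Qed.

End Invariant.
End CrossReps.

Section Transfer.
Variables (R : realType) (q : R) (hq : 0 < q < 1).
Local Notation C := R[i].
Local Notation A := (OSUq2 hq).
Local Notation X := (UOSUq2 hq).
Variables (Hh : hilbertType R) (pih : starRep X Hh) (vh : Hh).
Hypotheses (vh_inv : inv_vector pih vh) (vh1 : hdot vh vh = 1).
Variables (H : hilbertType R) (pi : starRep X H).

(** The Haar functional enters as the functional of the invariant unit vector [vh]; [inv_rop]
    reduces an arbitrary x of the cross product to an element of A. *)
Lemma inv_hdot xi xi' x : inv_vector pi xi -> inv_vector pi xi' ->
  hdot (rop pi x xi) xi' = hdot (rop pih x vh) vh * hdot xi xi'.
Proof.
move=> xiI xi'I; elim/pclass_ind: x => t.
rewrite (inv_rop xiI) (inv_rop vh_inv); set z := uo_op t 1.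
have inO1 (K : hilbertType R) (rho : starRep X K) v : inv_vector rho v ->
    rop rho (inO hq 1) v = v by case=> Dv _; rewrite shom1 rop1.
have h1 : hdot (rop pih (inO hq 1) vh) vh = 1 by rewrite inO1.
have := invariant_functional_unique (inv_invariant_functional xiI xi'I)
  (inv_invariant_functional vh_inv vh_inv) h1 z.
by cbv beta => ->; rewrite inO1// mulrC.
Qed.

Lemma inv_hdot2 xi xi' x y : inv_vector pi xi -> inv_vector pi xi' ->
  hdot (rop pi x xi) (rop pi y xi') =
  hdot (rop pih x vh) (rop pih y vh) * hdot xi xi'.
Proof.
move=> xiI xi'I; have [[Dxi _] [Dxi' _] [Dvh _]] := And3 xiI xi'I vh_inv.
rewrite -[y]starK -!rop_star; try exact: rop_dom; try by [].
by rewrite -!ropM// inv_hdot.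
Qed.

(** The norm of (x - y) xi is a multiple of that of (x - y) vh, so identities at [vh] hold at every
    invariant vector. *)
Lemma inv_transfer xi x y : inv_vector pi xi ->
  rop pih x vh = rop pih y vh -> rop pi x xi = rop pi y xi.
Proof.
move=> xiI xy; have [[Dxi _] [Dvh _]] := conj xiI vh_inv.
apply/eqP; rewrite -subr_eq0 -ropBl//; apply/eqP/hdot_eq0.
by rewrite inv_hdot2// ropBl// xy subrr hdot0l mul0r.
Qed.

End Transfer.

(** * Highest weight vectors *)

Section HighestWeight.
Variables (R : realType) (q : R) (hq : 0 < q < 1).
Local Notation C := R[i].
Local Notation A := (OSUq2 hq).
Local Notation X := (UOSUq2 hq).
Local Notation p := (qhalf q).
Local Notation ugen := (ugen hq).
Local Notation del := (@oq_del R q hq).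
Variables (H : hilbertType R) (pi : starRep X H).
Local Notation D := (rdom pi).
Local Notation "'E" := (rop pi (ugen genE)).
Local Notation "'F" := (rop pi (ugen genF)).
Local Notation "'K" := (rop pi (ugen genK)).
Local Notation "'Ki" := (rop pi (ugen genKi)).

Let q0 : 0 < q. Proof. exact: q_gt0. Qed.
Let qn0 : q != 0. Proof. by rewrite gt_eqF. Qed.
Let pn0 : p != 0. Proof. exact: qhalf_neq0. Qed.
Let lam0 : qlam q != 0. Proof. exact: qlam_neq0. Qed.
Let scaleC (x y : R) (u : H) : x%:C *: (y%:C *: u) = (x * y)%:C *: u.
Proof. by rewrite scalerA rmorphM. Qed.

Definition highest_weight n w := [/\ D w, 'E w = 0 & 'K w = (p ^+ n)%:C *: w].

(* E F^(k+1) w = ladder_coef n k F^k w for w of highest weight n; in q-numbers,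
   ladder_coef n k = [k+1][n-k]. *)
Definition ladder_coef (n k : nat) : R :=
  (q ^+ k.+1 - q ^- k.+1) * (q ^+ n * q ^- k - q ^- n * q ^+ k) / qlam q ^+ 2.

Lemma ladder_coefE n k : ladder_coef n k =
  (q ^+ k.+1 - q ^- k.+1) * (q ^+ n * q ^- k - q ^- n * q ^+ k) / qlam q ^+ 2.
Proof. by []. Qed.

(** The increment is the q-number [n - 2(k+1)], the eigenvalue of E F - F E on F^(k+1) w. *)
Lemma ladder_coefS n k : ladder_coef n k.+1 = ladder_coef n k +
  (qlam q)^-1 * (q ^+ n * q ^- k.+1 ^+ 2 - q ^- n * q ^+ k.+1 ^+ 2).
Proof.
have := lam0; rewrite /ladder_coef /qlam !exprS => l0.
have Q0 : q ^+ k != 0 by rewrite expf_eq0 (negPf qn0) andbF.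
have N0 : q ^+ n != 0 by rewrite expf_eq0 (negPf qn0) andbF.
field; rewrite qn0 Q0 N0 /=.
apply: contraNneq l0 => e; rewrite -[q - _](mulfK qn0) mulrBl mulVf// e mul0r.
by [].
Qed.

Lemma ladder_coef0 n : ladder_coef n 0 = (qlam q)^-1 * (q ^+ n - q ^- n).
Proof.
by rewrite /ladder_coef !expr1 expr0 invr1 !mulr1 -/(qlam q); field; rewrite lam0 ?qn0 ?expf_eq0 (negPf qn0) ?andbF.
Qed.

Lemma ladder_coefnn n : ladder_coef n n = 0.
Proof. by rewrite /ladder_coef mulfV ?mulVf ?subrr ?mulr0 ?mul0r// expf_eq0 (negPf qn0) andbF. Qed.

Lemma ladder_coef_gt0 n k : (k < n)%N -> 0 < ladder_coef n k.
Proof.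
move=> kn; case/andP: hq => _ q1.
have neg m : q ^+ m.+1 - q ^- m.+1 < 0.
  have h : q ^+ m.+1 < 1 by rewrite exprn_ilt1 ?ltW.
  by rewrite subr_lt0 (lt_trans h)// invf_gt1 ?exprn_gt0.
rewrite /ladder_coef; have -> : q ^+ n * q ^- k - q ^- n * q ^+ k = q ^+ (n - k.+1).+1 - q ^- (n - k.+1).+1.
  rewrite -[n in LHS](subnK (ltnW kn)) -(subnSK kn) !exprD.
  by field; rewrite !expf_eq0 (negPf qn0) !andbF.
apply: divr_gt0; last by rewrite exprn_even_gt0.
by rewrite nmulr_rgt0; exact: neg.
Qed.

Lemma rop_ugen_EF v : D v -> 'E ('F v) = 'F ('E v) +
  (qlam q)^-1%:C *: ('K ('K v) - 'Ki ('Ki v)).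
Proof.
by move=> Dv; rewrite -!ropM// ugen_EF ropD// ropZ// ropBl.
Qed.
Lemma rop_E_inO x v : D v -> 'E (rop pi (inO hq x) v) =
  rop pi (inO hq (del genKi x)) ('E v) - q^-1%:C *: rop pi (inO hq (del genE x)) ('Ki v).
Proof. by move=> Dv; rewrite -!ropM// ugen_E_inO ropBl// ropZ. Qed.
Lemma rop_K_inO x v : D v -> 'K (rop pi (inO hq x) v) =
  rop pi (inO hq (del genKi x)) ('K v).
Proof. by move=> Dv; rewrite -!ropM// ugen_K_inO. Qed.
Lemma rop_KiK v : D v -> 'Ki ('K v) = v.
Proof. by move=> Dv; rewrite -ropM// ugen_KiK rop1. Qed.

Lemma star_ugen g : star (ugen g) =
  ugen (match g with genE => genF | genF => genE | h => h end).
Proof. by rewrite /ugen -shom_star starE; case: g. Qed.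
Lemma hdot_F v v' : D v -> D v' -> hdot ('F v) v' = hdot v ('E v').
Proof. by move=> Dv Dv'; rewrite rop_star// star_ugen. Qed.

Lemma hdot_E v v' : D v -> D v' -> hdot ('E v) v' = hdot v ('F v').
Proof. by move=> Dv Dv'; rewrite rop_star// star_ugen. Qed.

Section Vector.
Variables (n : nat) (w : H) (hw : highest_weight n w).
Let Dw : D w. Proof. by case: hw. Qed.

Local Notation Fw k := (rop pi (ugen genF ^+ k) w).

Lemma hw_FS k : Fw k.+1 = 'F (Fw k).
Proof. by rewrite exprS ropM. Qed.

Lemma hw_FD k : D (Fw k). Proof. exact: rop_dom. Qed.

Lemma hw_K k : 'K (Fw k) = (p ^+ n * q ^- k)%:C *: Fw k.
Proof.
elim: k => [|k IH]; first by rewrite !expr0 invr1 mulr1 !rop1//; case: hw.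
rewrite hw_FS -ropM ?ugen_KF ?ropZ ?ropM ?IH ?ropZr; try exact: hw_FD.
by rewrite scaleC exprS invfM mulrCA.
Qed.

Lemma hw_Ki k : 'Ki (Fw k) = (p ^- n * q ^+ k)%:C *: Fw k.
Proof.
have nz : p ^+ n * q ^- k != 0.
  by rewrite mulf_neq0 ?invr_eq0// expf_eq0 ?(negPf pn0) ?(negPf qn0) andbF.
rewrite -[in LHS](_ : (p ^- n * q ^+ k)%:C *: 'K (Fw k) = Fw k); last first.
  rewrite hw_K scaleC mulrACA mulVf ?mulfV ?mulr1 ?scale1r//;
    by rewrite expf_eq0 ?(negPf pn0) ?(negPf qn0) andbF.
by rewrite ropZr ?rop_KiK//; [exact: hw_FD|apply: rop_dom; exact: hw_FD].
Qed.

Lemma hw_EF k : 'E (Fw k.+1) = (ladder_coef n k)%:C *: Fw k.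
Proof.
have KK j : (qlam q)^-1%:C *: ('K ('K (Fw j)) - 'Ki ('Ki (Fw j))) =
    ((qlam q)^-1 * (q ^+ n * q ^- j ^+ 2 - q ^- n * q ^+ j ^+ 2))%:C *: Fw j.
  rewrite !(hw_K, hw_Ki) !ropZr ?hw_K ?hw_Ki; try exact: hw_FD.
  rewrite !scaleC -scalerBl -rmorphB /= scaleC; congr (_%:C *: _); congr (_ * _).
  have qn : q ^+ n = p ^+ n * p ^+ n by rewrite -expr2 exprAC (sqr_qhalf hq).
  have P0 : p ^+ n != 0 by rewrite expf_eq0 (negPf pn0) andbF.
  have Q0 : q ^+ j != 0 by rewrite expf_eq0 (negPf qn0) andbF.
  by rewrite qn; field; rewrite P0 Q0.
elim: k => [|k IH].
  rewrite hw_FS rop_ugen_EF ?KK; last exact: hw_FD.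
  rewrite expr0 rop1//; case: hw => _ -> _; rewrite rop0r add0r.
  by rewrite ladder_coef0 expr0 invr1 expr1n !mulr1.
rewrite hw_FS rop_ugen_EF ?KK; last exact: hw_FD.
rewrite IH ropZr; last exact: hw_FD.
by rewrite -hw_FS -scalerDl -rmorphD /= -ladder_coefS.
Qed.

Lemma hw_FSnorm k : hdot (Fw k.+1) (Fw k.+1) = (ladder_coef n k)%:C * hdot (Fw k) (Fw k).
Proof.
rewrite {1}hw_FS hdot_F ?hw_EF ?hdotZr ?conj_rc//; exact: hw_FD.
Qed.

(** The squared norm acquires the factor [n+1][0] = 0. Positivity of the inner product thus makes
    the module generated by w finite-dimensional. *)
Lemma hw_Fn0 : Fw n.+1 = 0.
Proof. by apply: hdot_eq0; rewrite hw_FSnorm ladder_coefnn mul0r. Qed.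

End Vector.

Lemma hw_hdot_neq n n' w w' : highest_weight n w -> highest_weight n' w' ->
  n != n' -> hdot w w' = 0.
Proof.
move=> [Dw _ Kw] [Dw' _ Kw'] nn'.
have : hdot ('K w) w' = hdot w ('K w') by rewrite rop_star// star_ugen.
rewrite Kw Kw' hdotZl hdotZr conj_rc => /eqP.
rewrite -subr_eq0 -mulrBl mulf_eq0 => /orP[|/eqP//].
rewrite -rmorphB -(rmorph0 (real_complex R)) (inj_eq (@complexI R)) subr_eq0.
have strict m k : p ^+ (m + k.+1) != p ^+ m.
  rewrite exprD -subr_eq0 -{2}[p ^+ m]mulr1 -mulrBr mulf_eq0 expf_eq0 (negPf pn0) andbF.
  by rewrite subr_eq0; exact: qhalfX_neq1.
have [nn|nn|nn] := ltngtP n n'.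
- by rewrite -(subnKC nn) addSnnS eq_sym (negPf (strict _ _)).
- by rewrite -(subnKC nn) addSnnS (negPf (strict _ _)).
- by rewrite nn eqxx in nn'.
Qed.

Lemma hw_hdot n n' w w' k k' : highest_weight n w -> highest_weight n' w' ->
  hdot (rop pi (ugen genF ^+ k) w) (rop pi (ugen genF ^+ k') w') =
  if k == k' then (\prod_(j < k) ladder_coef n' j)%:C * hdot w w' else 0.
Proof.
move=> hw hw'; have [[Dw Ew _] [Dw' Ew' _]] := conj hw hw'.
elim: k k' => [|k IH] [|k'].
- by rewrite !expr0 !rop1// big_ord0 mul1r.
- rewrite expr0 rop1// hdotC (hw_FS hw') hdot_F ?Ew ?hdot0r ?rmorph0//; exact: rop_dom.
- by rewrite (hw_FS hw) expr0 rop1// hdot_F ?Ew' ?hdot0r//; exact: rop_dom.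
- rewrite {1}(hw_FS hw) hdot_F ?(hw_EF hw') ?hdotZr ?IH; try exact: rop_dom.
  rewrite eqSS conj_rc; case: eqP => [->|]; last by rewrite mulr0.
  by rewrite big_ord_recr /= [(_ * ladder_coef n' k')%:C]rcM mulrA [_%:C * _%:C]mulrC.
Qed.

Lemma hw0_inv w : highest_weight 0 w -> inv_vector pi w.
Proof.
move=> hw; have [Dw Ew Kw] := hw; split=> // -[] /=.
- by rewrite scale0r.
- by have := hw_Fn0 hw; rewrite expr1 scale0r.
- by rewrite Kw expr0.
- have := hw_Ki hw 0; rewrite !expr0 rop1// => ->.
  by rewrite invr1 mulr1.
Qed.

(* For w of highest weight n + 1, the vectors u1 = a F w + g c w and
   u2 = b F w + g d w with g = p^(n+4) [n+1] are of highest weight n, and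
   a d - q b c = 1 allows us to solve for w. *)
Lemma hw_lower n w : highest_weight n.+1 w -> exists u1 u2 (k : R),
  [/\ highest_weight n u1, highest_weight n u2 &
    w = k%:C *: (rop pi (inO hq (oq_elt hq genb)) u1 -
      q^-1%:C *: rop pi (inO hq (oq_elt hq gena)) u2)].
Proof.
move=> hw; have [Dw Ew Kw] := hw.
(* The value of [g] is forced by E u1 = E u2 = 0: for u1, applying E to a F w gives p [n+1] a w, and
   applying it to c w gives -p^-(n+3) a w. *)
pose g := p ^+ n.+4 * ladder_coef n.+1 0.
pose u x y := rop pi (inO hq (oq_elt hq x)) ('F w) +
              g%:C *: rop pi (inO hq (oq_elt hq y)) w.
have qp : q^-1 = p ^- 2 by rewrite (sqr_qhalf hq).
have DF : D ('F w) by exact: rop_dom.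
have Dr x v : D v -> D (rop pi (inO hq x) v) by exact: rop_dom.
have EFw : 'E ('F w) = (ladder_coef n.+1 0)%:C *: w.
  by have := hw_EF hw 0; rewrite expr1 expr0 rop1.
have Kiw : 'Ki w = (p ^- n.+1)%:C *: w.
  by have := hw_Ki hw 0; rewrite expr0 mulr1 rop1.
have KFw : 'K ('F w) = (p ^+ n.+1 * q^-1)%:C *: 'F w.
  by have := hw_K hw 1; rewrite expr1.
have hu x y : del genKi (oq_elt hq x) = p%:C *: oq_elt hq x ->
    del genE (oq_elt hq x) = 0 ->
    del genKi (oq_elt hq y) = p^-1%:C *: oq_elt hq y ->
    del genE (oq_elt hq y) = oq_elt hq x -> highest_weight n (u x y).
  move=> Kix Ex Kiy Ey; split.
  - by apply: rdomD; [exact: Dr|apply: rdomZ; exact: Dr].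
  - rewrite /u ropDr ?ropZr ?rop_E_inO//; try exact: Dr; last first.
      by apply: rdomZ; exact: Dr.
    rewrite Ex Ey Ew EFw Kiw Kix rop0r sub0r !inOZ inO0.
    rewrite !ropZ ?ropZr ?rop0l; try exact: rop_dom; try by []; last exact: rdomZ.
    rewrite scaler0 subr0 scalerN !scaleC -scalerBl -rmorphB /=.
    rewrite (_ : _ - _ = 0) ?scale0r// /g qp.
    rewrite !exprS; have P0 : p ^+ n != 0 by rewrite expf_eq0 (negPf pn0) andbF.
    by field; rewrite P0 pn0.
  - rewrite /u ropDr ?ropZr ?rop_K_inO//; try exact: Dr; last first.
      by apply: rdomZ; exact: Dr.
    rewrite KFw Kw Kix Kiy !inOZ !ropZ ?ropZr; try exact: rop_dom; try by [];
      try exact: rdomZ.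
    rewrite !scaleC scalerDr scaleC qp.
    by congr (_%:C *: _ + _%:C *: _); rewrite !exprS; field; rewrite pn0.
(* In b u1 - q^-1 a u2 the terms with F w cancel because b a = q^-1 a b, and by a d = 1 + q b c the
   others add up to -q^-1 g w. *)
exists (u gena genc), (u genb gend), (- q * g^-1); split.
- by apply: hu; rewrite oq_del_elt /= ?(oq_cE hq) ?scale0r.
- by apply: hu; rewrite oq_del_elt /= ?(oq_cE hq) ?scale0r.
have g0 : g != 0.
  by rewrite mulf_neq0 ?expf_eq0 ?(negPf pn0) ?andbF// gt_eqF ?ladder_coef_gt0.
have mulr x y z : rop pi (inO hq (oq_elt hq z)) (u x y) =
    rop pi (inO hq (oq_elt hq z * oq_elt hq x)) ('F w) +
    g%:C *: rop pi (inO hq (oq_elt hq z * oq_elt hq y)) w.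
  rewrite /u ropDr ?ropZr; try exact: Dr; last by apply: rdomZ; exact: Dr.
  by rewrite !shomM !ropM.
rewrite !mulr (oq_ba hq) (oq_ad hq) (shomD (inO hq) 1) !inOZ shom1.
rewrite ropD// rop1// !ropZ// qp.
set v1 := rop pi _ ('F w); set v2 := rop pi _ w.
rewrite (scalerDr _ v1).
rewrite [X in _ *: (_ + X)]opprD addrACA subrr add0r scaleC (scalerDr _ w).
rewrite [X in _ *: (_ + X)]opprD scaleC.
rewrite (_ : p ^- 2 * g * p ^+ 2 = g); last by field.
rewrite addrCA subrr addr0 -scaleNr -rmorphN scaleC.
rewrite (_ : _ * _ = 1) ?scale1r//.
have -> : - q / g * - (p ^- 2 * g) = q * p ^- 2 by field; rewrite g0 pn0.
by rewrite -qp mulfV.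
Qed.

Lemma hw_orth u : (forall xi, inv_vector pi xi -> forall x, hdot (rop pi x xi) u = 0) ->
  forall n w, highest_weight n w -> forall x, hdot (rop pi x w) u = 0.
Proof.
move=> hu; elim=> [|n IH] w hw x; first by apply: hu; exact: hw0_inv.
have [u1 [u2 [k [hu1 hu2 ->]]]] := hw_lower hw.
have [[D1 _ _] [D2 _ _]] := conj hu1 hu2.
have Dr y v : D v -> D (rop pi (inO hq y) v) by exact: rop_dom.
rewrite ropZr ?ropBr ?ropZr -?ropM//; try exact: Dr.
- by rewrite hdotZl hdotBl hdotZl !IH// mulr0 subrr mulr0.
- by apply: rdomZ; exact: Dr.
- by apply: rdomB; [exact: Dr|apply: rdomZ; exact: Dr].
Qed.

End HighestWeight.

Opaque ladder_coef.

(** * Finite-dimensional subspaces as Hilbert spaces *)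

Section FiniteSpan.
Variables (R : realType) (H : hilbertType R) (n : nat) (e : 'I_n -> H).
Hypothesis oe : orthonormal_family e.

(* The span of e, carried by its coordinate vectors. *)
Definition fin_span of orthonormal_family e := 'rV[R[i]]_n.
Local Notation V := (fin_span oe).
HB.instance Definition _ := GRing.Lmodule.copy V 'rV[R[i]]_n.

Definition span_vec (v : V) : H := \sum_i v 0 i *: e i.

Lemma span_vec_linear c (u v : V) : span_vec (c *: u + v) = c *: span_vec u + span_vec v.
Proof.
rewrite /span_vec scaler_sumr -big_split /=; apply: eq_bigr => i _.
by rewrite !mxE scalerDl scalerA.
Qed.
Lemma span_vecD u v : span_vec (u + v) = span_vec u + span_vec v.
Proof. by rewrite -[u]scale1r span_vec_linear !scale1r. Qed.
Lemma span_vec0 : span_vec 0 = 0.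
Proof. by rewrite /span_vec big1// => i _; rewrite mxE scale0r. Qed.
Lemma span_vecZ c u : span_vec (c *: u) = c *: span_vec u.
Proof. by rewrite -[c *: u]addr0 span_vec_linear span_vec0 addr0. Qed.
Lemma span_vecN u : span_vec (- u) = - span_vec u.
Proof. by rewrite -[- u]scaleN1r span_vecZ scaleN1r. Qed.
Lemma span_vecB u v : span_vec (u - v) = span_vec u - span_vec v.
Proof. by rewrite span_vecD span_vecN. Qed.

Lemma hdot_span_vec u i : hdot (span_vec u) (e i) = u 0 i.
Proof.
rewrite /span_vec hdot_suml (bigD1 i)//= hdotZl oe eqxx mulr1 big1 ?addr0// => j ji.
by rewrite hdotZl oe (negPf ji) mulr0.
Qed.

Lemma span_vec_inj u v : span_vec u = span_vec v -> u = v.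
Proof. by move=> uv; apply/rowP => i; rewrite -!hdot_span_vec uv. Qed.

Definition span_coord (u : H) : V := \row_i hdot u (e i).

Lemma span_coordK u : span_coord (span_vec u) = u.
Proof. by apply/rowP => i; rewrite mxE hdot_span_vec. Qed.
Lemma span_coordB u v : span_coord (u - v) = span_coord u - span_coord v.
Proof. by apply/rowP => i; rewrite !mxE hdotBl. Qed.

Lemma span_coord_contract u : sqnorm (span_vec (span_coord u)) <= sqnorm u.
Proof.
have uo : hdot (u - span_vec (span_coord u)) (span_vec (span_coord u)) = 0.
  rewrite {2}/span_vec hdot_sumr big1// => i _.
  by rewrite hdotZr hdotBl hdot_span_vec mxE subrr mulr0.
rewrite -[X in _ <= sqnorm X](subrK (span_vec (span_coord u))) (sqnormD_orth uo).
by rewrite lerDr sqnorm_ge0.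
Qed.

Let nrm (u : V) : R[i] := `|span_vec u|.
Let nrmD u v : nrm (u + v) <= nrm u + nrm v.
Proof. by rewrite /nrm span_vecD ler_normD. Qed.
Let nrmZ (c : R[i]) u : nrm (c *: u) = `|c| * nrm u.
Proof. by rewrite /nrm span_vecZ normrZ. Qed.
Let nrm_eq0 u : nrm u = 0 -> u = 0.
Proof.
move=> /eqP; rewrite normr_eq0 => /eqP u0; apply: span_vec_inj.
by rewrite u0 span_vec0.
Qed.

HB.instance Definition _ := Lmodule_isNormed.Build R[i] V nrmD nrmZ nrm_eq0.

Lemma fin_span_norm (u : V) : `|u| = `|span_vec u|.
Proof. by []. Qed.

(** The limit is taken in H and brought back by the orthogonal projection [span_coord], a
    contraction that fixes the span. *)
Let fin_span_complete (F : set_system V) : ProperFilter F -> cauchy F -> cvg F.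
Proof.
move=> FF /cauchyP Fc.
have vecF : span_vec @ F --> lim (span_vec @ F).
  apply: cauchy_cvg; apply: cauchy_exP => eps e0.
  have [x Fx] := Fc _ e0; exists (span_vec x).
  have xS : ball x eps `<=` span_vec @^-1` ball (span_vec x) eps.
    by move=> y; rewrite /preimage /= -!ball_normE /ball_ /= -span_vecB.
  exact: (filterS xS Fx).
set u := lim _ in vecF.
apply/cvg_ex; exists (span_coord u); apply/cvg_ballP => _ /posc[r r0 ->].
have rC : 0 < r%:C :> R[i] by rewrite ltcR.
have vS : span_vec @^-1` ball u r%:C `<=` ball (span_coord u) r%:C.
  move=> y; rewrite /preimage /= => /(ball_sqnorm _ _ r0) uy.
  rewrite -ball_normE /ball_ /= fin_span_norm -{1}(span_coordK y) -span_coordB.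
  by rewrite norm_lt_sqnorm//; apply: le_lt_trans (span_coord_contract _) uy.
exact: (filterS vS (cvg_ball vecF rC)).
Qed.

HB.instance Definition _ := Uniform_isComplete.Build V fin_span_complete.

Definition span_dot (u v : V) : R[i] := hdot (span_vec u) (span_vec v).

Let span_dot_bilinear : bilinear_for (GRing.Scale.Law.clone _ _ *%R _)
  (GRing.Scale.Law.clone _ _ (@Num.conj R[i] \; *%R) _) span_dot.
Proof.
split=> [v c x y|u c x y]; rewrite /span_dot span_vec_linear.
  by rewrite hdotDl hdotZl.
by rewrite hdotDr hdotZr.
Qed.
HB.instance Definition _ := bilinear_isBilinear.Build R[i] V V _ _ _ span_dot
  span_dot_bilinear.

Let span_dot_herm u v : span_dot u v = (-1) ^+ false * Num.conj (span_dot v u).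
Proof. by rewrite expr0 mul1r /span_dot -hdotC. Qed.
HB.instance Definition _ := isHermitianSesquilinear.Build R[i] V false
  (@Num.conj R[i]) span_dot span_dot_herm.

Let span_dot_pos u : u != 0 -> 0 < span_dot u u.
Proof.
move=> u0; rewrite /span_dot hdot_sqnorm ltcR lt_neqAle sqnorm_ge0 andbT eq_sym.
apply: contra_neq u0 => /sqnorm_eq0 h; apply: span_vec_inj; by rewrite h span_vec0.
Qed.
HB.instance Definition _ := isDotProduct.Build R[i] V span_dot span_dot_pos.

Let span_dot_norm (u : V) : (span_dot : {dot V for (@Num.conj R[i])}) u u = `|u| ^+ 2.
Proof. by rewrite fin_span_norm -hdot_norm. Qed.

HB.instance Definition _ := CompleteNormedModule_isHilbert.Build R V span_dot_norm.

Definition span_hilbert : hilbertType R := V.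

Lemma hdot_fin_span (u v : span_hilbert) : hdot u v = hdot (span_vec u) (span_vec v).
Proof. by []. Qed.

End FiniteSpan.

Section NormalizedOrbit.
Variables (R : realType) (q : R) (hq : 0 < q < 1).
Local Notation C := R[i].
Local Notation X := (UOSUq2 hq).
Local Notation p := (qhalf q).
Local Notation ugen := (ugen hq).

(** For r <= n, the inverse of the norm of F^r w when w is a unit vector of highest weight n. *)
Definition orbit_scale n r : R := (Num.sqrt (\prod_(s < r) ladder_coef q n s))^-1.
Definition orbit_elt n r : X := (orbit_scale n r)%:C *: ugen genF ^+ r.

Let prod_gt0 n r : (r <= n)%N -> 0 < \prod_(s < r) ladder_coef q n s.
Proof. by move=> rn; apply: prodr_gt0 => s _; apply: ladder_coef_gt0 => //; apply: leq_trans rn. Qed.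

Lemma orbit_scaleS n r : (r < n)%N ->
  orbit_scale n r = Num.sqrt (ladder_coef q n r) * orbit_scale n r.+1.
Proof.
move=> rn; rewrite /orbit_scale big_ord_recr /= (sqrtrM _ (ltW (prod_gt0 (ltnW rn)))) invfM.
by rewrite [RHS]mulrCA mulfV ?mulr1// gt_eqF// sqrtr_gt0 ladder_coef_gt0.
Qed.

Lemma orbit_scale_ladder n r : (r < n)%N ->
  orbit_scale n r.+1 * ladder_coef q n r = Num.sqrt (ladder_coef q n r) * orbit_scale n r.
Proof.
move=> rn; rewrite (orbit_scaleS rn) mulrA -expr2 sqr_sqrtr; first exact: mulrC.
by rewrite ltW// ladder_coef_gt0.
Qed.

Variables (H : hilbertType R) (pi : starRep X H).
Local Notation D := (rdom pi).

Lemma highest_weightZ n c w : highest_weight pi n w -> highest_weight pi n (c *: w).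
Proof.
move=> [Dw Ew Kw]; split; first exact: rdomZ.
- by rewrite ropZr// Ew scaler0.
- by rewrite ropZr// Kw !scalerA mulrC.
Qed.

Section Vector.
Variables (n : nat) (w : H) (hw : highest_weight pi n w).
Let Dw : D w. Proof. by case: hw. Qed.

Lemma orbit_eltE r : rop pi (orbit_elt n r) w = (orbit_scale n r)%:C *: rop pi (ugen genF ^+ r) w.
Proof. by rewrite ropZ. Qed.

Let Dr (x : X) : D (rop pi x w). Proof. exact: rop_dom. Qed.

Lemma orbit_elt_F r : (r < n)%N ->
  rop pi (ugen genF) (rop pi (orbit_elt n r) w) = (Num.sqrt (ladder_coef q n r))%:C *: rop pi (orbit_elt n r.+1) w.
Proof.
by move=> rn; rewrite !orbit_eltE ropZr// -(hw_FS hw) scalerA -rcM -orbit_scaleS.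
Qed.
Lemma orbit_elt_Fn : rop pi (ugen genF) (rop pi (orbit_elt n n) w) = 0.
Proof. by rewrite orbit_eltE ropZr// -(hw_FS hw) (hw_Fn0 hw) scaler0. Qed.
Lemma orbit_elt_E r : (r < n)%N ->
  rop pi (ugen genE) (rop pi (orbit_elt n r.+1) w) = (Num.sqrt (ladder_coef q n r))%:C *: rop pi (orbit_elt n r) w.
Proof.
by move=> rn; rewrite !orbit_eltE ropZr// (hw_EF hw) !scalerA -!rcM orbit_scale_ladder.
Qed.
Lemma orbit_elt_E0 : rop pi (ugen genE) (rop pi (orbit_elt n 0) w) = 0.
Proof. by rewrite orbit_eltE ropZr// expr0 rop1//; case: hw => _ -> _; rewrite scaler0. Qed.
Lemma orbit_elt_K r :
  rop pi (ugen genK) (rop pi (orbit_elt n r) w) = (p ^+ n * q ^- r)%:C *: rop pi (orbit_elt n r) w.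
Proof. by rewrite orbit_eltE ropZr// (hw_K hw) !scalerA mulrC. Qed.
Lemma orbit_elt_Ki r :
  rop pi (ugen genKi) (rop pi (orbit_elt n r) w) = (p ^- n * q ^+ r)%:C *: rop pi (orbit_elt n r) w.
Proof. by rewrite orbit_eltE ropZr// (hw_Ki hw) !scalerA mulrC. Qed.
Lemma orbit_elt0 : rop pi (orbit_elt n 0) w = w.
Proof. by rewrite orbit_eltE /orbit_scale big_ord0 sqrtr1 invr1 scale1r expr0 rop1. Qed.

End Vector.

Lemma orbit_elt_hdot n w w' r r' : (r <= n)%N -> highest_weight pi n w ->
  highest_weight pi n w' ->
  hdot (rop pi (orbit_elt n r) w) (rop pi (orbit_elt n r') w') = (r == r')%:R * hdot w w'.
Proof.
move=> rn hw hw'; rewrite !orbit_eltE; try by [case: hw|case: hw'].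
rewrite hdotZl hdotZr conj_rc (hw_hdot _ _ hw hw').
case: eqP => [<-|_]; last by rewrite !mulr0 mul0r.
rewrite !mulrA mul1r -!rcM -[RHS]mul1r; congr (_ * _).
rewrite (_ : _ * _ = 1)// /orbit_scale -invfM -expr2 sqr_sqrtr ?mulVf ?gt_eqF ?prod_gt0//.
by rewrite ltW ?prod_gt0.
Qed.

Lemma orbit_elt_hdot_neq n n' w w' r r' : n != n' -> highest_weight pi n w ->
  highest_weight pi n' w' ->
  hdot (rop pi (orbit_elt n r) w) (rop pi (orbit_elt n' r') w') = 0.
Proof.
move=> nn' hw hw'; rewrite !orbit_eltE; try by [case: hw|case: hw'].
rewrite hdotZl hdotZr (hw_hdot _ _ hw hw') (hw_hdot_neq hw hw' nn').
by case: ifP; rewrite !mulr0.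
Qed.

End NormalizedOrbit.

(** * The Heisenberg representation *)

Section HeisenbergBasis.
Variables (R : realType) (q : R) (hq : 0 < q < 1).
Local Notation C := R[i].
Local Notation A := (OSUq2 hq).
Local Notation U := (Uqsu2 q).
Local Notation X := (UOSUq2 hq).
Local Notation p := (qhalf q).
Local Notation ugen := (ugen hq).
Local Notation del := (@oq_del R q hq).
Variables (Hh : hilbertType R) (pih : starRep X Hh) (vh : Hh).
Hypotheses (vh_inv : inv_vector pih vh) (vh1 : hdot vh vh = 1).
Hypothesis vh_total : forall u, (forall x, hdot u (rop pih (inO hq x) vh) = 0) -> u = 0.

Definition ab_mon (ij : nat * nat) : A := oq_elt hq gena ^+ ij.1 * oq_elt hq genb ^+ ij.2.
Definition ab_mon_norm ij : R := sqnorm (rop pih (inO hq (ab_mon ij)) vh).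

(* No monomial has norm 0, but leaving out such monomials is harmless and
   saves the computation of the norms. *)
Definition spin_index := {ij : nat * nat | ab_mon_norm ij != 0}.
HB.instance Definition _ := Choice.on spin_index.
Implicit Type b : spin_index.
Definition spin_dim b : nat := ((val b).1 + (val b).2)%N.
Definition spin_top b : X := (Num.sqrt (ab_mon_norm (val b)))^-1%:C *: inO hq (ab_mon (val b)).
Definition spin_pairs := {b : spin_index & 'I_(spin_dim b).+1}.
Definition spin_pair b (k : 'I_(spin_dim b).+1) : spin_pairs :=
  existT (fun b => 'I_(spin_dim b).+1) b k.
Implicit Type m : spin_pairs.
(** Kept as elements of the algebra: applied to an invariant unit vector of any other
    representation, they again give an orthonormal family, with the same matrices. *)
Definition hbasis_elt m : X := orbit_elt hq (spin_dim (tag m)) (tagged m) * spin_top (tag m).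
Definition hbasis m : Hh := rop pih (hbasis_elt m) vh.

Let Dvh : rdom pih vh. Proof. by case: vh_inv. Qed.
Let p0 : p != 0. Proof. exact: qhalf_neq0. Qed.

Lemma ab_mon_highest_weight ij :
  highest_weight pih (ij.1 + ij.2) (rop pih (inO hq (ab_mon ij)) vh).
Proof.
case: vh_inv => _ gvh; set n := (_ + _)%N.
have Km : del genKi (ab_mon ij) = (p ^+ n)%:C *: ab_mon ij.
  rewrite -[in RHS](oq_delK_Ki (ab_mon ij)) oq_delK_mon oq_delZ scalerA -rcM -exprMn mulfV//.
  by rewrite expr1n scale1r.
split; first exact: rop_dom.
- rewrite rop_E_inO// oq_delE_mon inO0 rop0l; last exact: rop_dom.
  by rewrite (gvh genE) /= scale0r rop0r scaler0 subr0.
- by rewrite rop_K_inO// Km gvh /= scale1r inOZ ropZ.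
Qed.

Let ab_mon_inv_functional : invariant_functional
  (fun x => hdot (rop pih (inO hq x) vh) vh).
Proof. exact: inv_invariant_functional. Qed.

(** Monomials of different degrees have different K-eigenvalues; those of the same degree are
    separated by the torus automorphisms. *)
Lemma ab_mon_orth ij kl : ij != kl ->
  hdot (rop pih (inO hq (ab_mon ij)) vh) (rop pih (inO hq (ab_mon kl)) vh) = 0.
Proof.
move=> ne; have [h|h] := eqVneq (ij.1 + ij.2)%N (kl.1 + kl.2)%N; last first.
  exact: hw_hdot_neq (ab_mon_highest_weight ij) (ab_mon_highest_weight kl) h.
rewrite -rop_starl//; last exact: rop_dom.
rewrite -shom_star -ropM// -shomM.
apply: (invariant_mon_orth ab_mon_inv_functional) => //.
  by rewrite shom1 rop1.
apply: contra_neq ne => e; move: h; rewrite e => /addnI.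
by case: ij kl e => i j [k l] /= -> ->.
Qed.

Lemma spin_top_highest_weight b : highest_weight pih (spin_dim b) (rop pih (spin_top b) vh).
Proof. by rewrite ropZ//; apply/highest_weightZ/ab_mon_highest_weight. Qed.

Lemma spin_top_hdot b b' : hdot (rop pih (spin_top b) vh) (rop pih (spin_top b') vh) = (b == b')%:R.
Proof.
rewrite !ropZ// hdotZl hdotZr conj_rc; case: eqVneq => [<-|ne]; last first.
  by rewrite ab_mon_orth ?mulr0//; apply: contra_neq ne => /val_inj.
rewrite hdot_sqnorm -/(ab_mon_norm _) -!rcM mulrA -invfM -expr2.
rewrite sqr_sqrtr ?sqnorm_ge0// mulVf//.
exact: (valP b).
Qed.

Lemma hbasisE m : hbasis m = rop pih (orbit_elt hq (spin_dim (tag m)) (tagged m)) (rop pih (spin_top (tag m)) vh).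
Proof. by rewrite /hbasis ropM. Qed.

Lemma hbasis_dom m : rdom pih (hbasis m). Proof. exact: rop_dom. Qed.

Lemma hbasis_orthonormal : orthonormal_family hbasis.
Proof.
move=> [b r] [b' r']; rewrite !hbasisE /=.
have rn : (r <= spin_dim b)%N by rewrite -ltnS.
have [e|ne] := eqVneq b b'.
  subst b'; rewrite (orbit_elt_hdot _ rn (spin_top_highest_weight b) (spin_top_highest_weight b)).
  by rewrite spin_top_hdot eqxx mulr1 eq_Tagged.
rewrite (_ : (_ == _) = false); last first.
  by apply/negbTE/eqP => /(congr1 tag) /= e; rewrite e eqxx in ne.
have hb' := spin_top_highest_weight b'.
have [nn|nn] := eqVneq (spin_dim b) (spin_dim b'); last first.
  exact: orbit_elt_hdot_neq nn (spin_top_highest_weight b) hb'.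
move: (nat_of_ord r') hb' => k' hb'; rewrite -nn in hb' *.
by rewrite (orbit_elt_hdot _ rn (spin_top_highest_weight b) hb') spin_top_hdot (negPf ne) mulr0.
Qed.

Definition hbasis_span (v : Hh) := exists s : seq (C * spin_pairs),
  v = \sum_(t <- s) t.1 *: hbasis t.2.

Lemma hbasis_spanD u v : hbasis_span u -> hbasis_span v -> hbasis_span (u + v).
Proof. by move=> [s ->] [t ->]; exists (s ++ t); rewrite big_cat. Qed.
Lemma hbasis_spanZ c u : hbasis_span u -> hbasis_span (c *: u).
Proof.
move=> [s ->]; exists [seq (c * t.1, t.2) | t <- s].
by rewrite big_map scaler_sumr; apply: eq_bigr => t _; rewrite scalerA.
Qed.
Lemma hbasis_span0 : hbasis_span 0.
Proof. by exists [::]; rewrite big_nil. Qed.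
Lemma hbasis_span1 m : hbasis_span (hbasis m).
Proof. by exists [:: (1, m)]; rewrite big_seq1 scale1r. Qed.

(** K and K^-1 are diagonal, E and F are weighted shifts within a block. At the end of a block the
    coefficient is 0 and the index m' a placeholder. *)
Lemma ugen_hbasis g m : exists (c : C) m', tag m' = tag m /\ rop pih (ugen g) (hbasis m) = c *: hbasis m'.
Proof.
case: m => b r; set n := spin_dim b; have hw := spin_top_highest_weight b.
have eMr (k : 'I_n.+1) : hbasis (@spin_pair b k) = rop pih (orbit_elt hq n k) (rop pih (spin_top b) vh).
  by rewrite hbasisE.
have rn : (r <= n)%N by rewrite -ltnS.
case: g.
- case: r rn => [[|r] hr] rn.
    by exists 0, (@spin_pair b (Ordinal hr)); rewrite eMr (orbit_elt_E0 hw) scale0r.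
  exists (Num.sqrt (ladder_coef q n r))%:C, (@spin_pair b (Ordinal (ltnW hr))).
  by rewrite !eMr /= (orbit_elt_E hw).
- have [rn'|nr] := ltnP r n.
    exists (Num.sqrt (ladder_coef q n r))%:C, (@spin_pair b (Ordinal (rn' : (r.+1 < n.+1)%N))).
    by rewrite !eMr /= (orbit_elt_F hw).
  exists 0, (@spin_pair b r); rewrite !eMr scale0r.
  have -> : nat_of_ord r = n by apply/eqP; rewrite eqn_leq rn nr.
  by rewrite (orbit_elt_Fn hw).
- by exists (p ^+ n * q ^- r)%:C, (@spin_pair b r); rewrite !eMr (orbit_elt_K hw).
- by exists (p ^- n * q ^+ r)%:C, (@spin_pair b r); rewrite !eMr (orbit_elt_Ki hw).
Qed.

Let hbasis_span_dom v : hbasis_span v -> rdom pih v.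
Proof. by move=> [s ->]; apply: rdom_fsum => t _; apply: rdomZ; exact: hbasis_dom. Qed.

Let hbasis_span_ugen g v : hbasis_span v -> hbasis_span (rop pih (ugen g) v).
Proof.
move=> [s ->]; elim: s => [|[c m] s IH]; first by rewrite big_nil rop0r; exact: hbasis_span0.
have Dm : rdom pih (c *: hbasis m) by apply: rdomZ; exact: hbasis_dom.
rewrite big_cons ropDr//; last by apply: hbasis_span_dom; exists s.
apply: hbasis_spanD IH; rewrite ropZr; last exact: hbasis_dom.
have [k [m' [_ ->]]] := ugen_hbasis g m.
by do 2 apply: hbasis_spanZ; exact: hbasis_span1.
Qed.

(** Induction along the orbit of the monomials. A monomial left out of [spin_index] gives the vector
    0, any other a multiple of a basis vector; and x <| g is, up to a nonzero scalar, given by the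
    action of a generator on x vh, under which the span is stable. *)
Lemma hbasis_span_inO x : hbasis_span (rop pih (inO hq x) vh).
Proof.
have qn0 : q != 0 by rewrite gt_eqF ?(q_gt0 hq).
elim: (oq_weight_orbit x) => {x} [i j|k x y _ IHx _ IHy|g x _ IH].
- rewrite -/(ab_mon (i, j)); have [n0|n0] := eqVneq (ab_mon_norm (i, j)) 0.
    by rewrite (sqnorm_eq0 n0); exact: hbasis_span0.
  pose b : spin_index := exist _ (i, j) n0.
  have -> : rop pih (inO hq (ab_mon (i, j))) vh =
      (Num.sqrt (ab_mon_norm (i, j)))%:C *: hbasis (@spin_pair b ord0).
    rewrite hbasisE /= (orbit_elt0 (spin_top_highest_weight b)) ropZ// scalerA -rcM mulfV ?scale1r//.
    by rewrite gt_eqF// sqrtr_gt0 lt_neqAle eq_sym n0 sqnorm_ge0.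
  by apply: hbasis_spanZ; exact: hbasis_span1.
- by rewrite shomD inOZ ropD// ropZ//; apply: hbasis_spanD IHy; exact: hbasis_spanZ.
- have h g' := hbasis_span_ugen g' IH.
  have inv (c : R) z : c != 0 -> hbasis_span (rop pih (inO hq (- c%:C *: z)) vh) ->
      hbasis_span (rop pih (inO hq z) vh).
    move=> c0 /(hbasis_spanZ (- c^-1%:C)); rewrite inOZ ropZ// scalerA mulrNN -rcM mulVf//.
    by rewrite scale1r.
  case: g.
  + apply: (inv q^-1); first by rewrite invr_eq0.
    by have := h genE; rewrite (inv_ugen vh_inv) /= oq_delZ.
  + by apply: (inv q) => //; have := h genF; rewrite (inv_ugen vh_inv) /= oq_delZ.
  + by have := h genKi; rewrite (inv_ugen vh_inv).
  + by have := h genK; rewrite (inv_ugen vh_inv).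
Qed.

Lemma hbasis_span_rop x : hbasis_span (rop pih x vh).
Proof. by elim/pclass_ind: x => t; rewrite (inv_rop vh_inv); exact: hbasis_span_inO. Qed.

Lemma hbasis_total : total_family hbasis.
Proof.
move=> u um; apply: vh_total => x; have [s ->] := hbasis_span_inO x.
by rewrite hdot_sumr big1// => t _; rewrite hdotZr um mulr0.
Qed.

Lemma hbasis_fcomb x : exists S c, rop pih x vh = fcomb hbasis c S.
Proof.
have [s sE] := hbasis_span_rop x; pose S := [fset m in unzip2 s]%fset.
exists S, (fun m => hdot (rop pih x vh) (hbasis m)).
apply: (total_expand hbasis_orthonormal hbasis_total) => m mS.
rewrite sE hdot_suml big_seq big1// => t ts; rewrite hdotZl hbasis_orthonormal.
case: eqP => [e|_]; last by rewrite mulr0.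
by move: mS; rewrite -e in_fset /= map_f.
Qed.

Lemma hbasis_block f m m' : tag m' != tag m -> hdot (rop pih (inU hq f) (hbasis m)) (hbasis m') = 0.
Proof.
move=> mm; pose block v := rdom pih v /\
  forall k, tag k != tag m -> hdot v (hbasis k) = 0.
suff : block (rop pih (inU hq f) (hbasis m)) by case=> _; exact.
have : block (hbasis m).
  split=> [|k km]; first exact: hbasis_dom.
  by rewrite hbasis_orthonormal; case: eqP => // e; rewrite e eqxx in km.
elim/pclass_ind: f => f; rewrite inUE.
elim: f (hbasis m) => [g|c|f IHf g IHg|f IHf g IHg] v [Dv bv] /=.
- split=> [|k km]; first exact: rop_dom.
  rewrite -ugenE rop_star//; last exact: hbasis_dom.
  rewrite star_ugen; set g' := match g with genE => _ | _ => _ end.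
  have [c [k' [kk' ->]]] := ugen_hbasis g' k.
  by rewrite hdotZr bv ?mulr0// kk'.
- rewrite pclass_const; split=> [|k km]; first exact: rop_dom.
  by rewrite ropZ// rop1// hdotZl bv// mulr0.
- have [[Df bf] [Dg bg]] := conj (IHf v (conj Dv bv)) (IHg v (conj Dv bv)).
  rewrite pclassD; split=> [|k km]; first exact: rop_dom.
  by rewrite ropD// hdotDl bf// bg// addr0.
- have [Df bf] := IHf _ (IHg v (conj Dv bv)).
  by rewrite pclassM; split=> [|k km]; [exact: rop_dom|rewrite ropM// bf].
Qed.

End HeisenbergBasis.

(** * Weights and q-numbers of the spin representations *)

Section QuantumNumbers.
Variables (R : realType) (q : R) (hq : 0 < q < 1) (n : nat).
Local Notation p := (qhalf q).

Let lam0 : qlam q != 0. Proof. exact: qlam_neq0. Qed.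

Lemma qnum_nat m : qnum q m%:R = (qlam q)^-1 * (q ^+ m - q ^- m).
Proof. by rewrite /qnum powRN powR_mulrn// ltW// (q_gt0 hq). Qed.

Lemma ladder_coef_qnum r : (r <= n)%N -> ladder_coef q n r = qnum q r.+1%:R * qnum q (n - r)%:R.
Proof.
move=> rn; have qn0 : q != 0 by rewrite gt_eqF ?(q_gt0 hq).
have Q0 m : q ^+ m != 0 by rewrite expf_eq0 (negPf qn0) andbF.
rewrite !qnum_nat ladder_coefE -[in LHS](subnK rn) !exprD.
by field; rewrite !Q0 lam0.
Qed.

(** The exponent k - n/2 counts from the lowest weight, whereas n - k is the number of applications
    of F to a highest weight vector; half-integral powers of q become integral powers of p. *)
Lemma weight_powR k : (k <= n)%N ->
  q `^ (k%:R - n%:R / 2) = p ^+ n * q ^- (n - k).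
Proof.
move=> kn; have q0 := q_gt0 hq; have p0 := qhalf_gt0 hq.
have -> : k%:R - n%:R / 2 = 2^-1 * ((2 * k)%:R - n%:R) :> R by rewrite natrM; field.
rewrite powRrM powR12_sqrt ?ltW// -/(qhalf q) powRD; last by apply/implyP => _; rewrite gt_eqF.
rewrite powRN !powR_mulrn ?ltW//.
have qp : q ^+ (n - k) = p ^+ (n - k) * p ^+ (n - k).
  by rewrite -expr2 exprAC (sqr_qhalf hq).
have pn : p ^+ n = p ^+ k * p ^+ (n - k) by rewrite -exprD subnKC.
have p2 : p ^+ (2 * k) = p ^+ k * p ^+ k by rewrite mul2n -addnn exprD.
rewrite qp pn p2; set P := p ^+ k; set Q := p ^+ (n - k).
have P0 : P != 0 by rewrite gt_eqF// exprn_gt0.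
have Q0 : Q != 0 by rewrite gt_eqF// exprn_gt0.
by field; rewrite P0 Q0.
Qed.

Lemma qalpha_up k : (k < n)%N ->
  qalpha q (k%:R - n%:R / 2 + 1) (n%:R / 2) = Num.sqrt (ladder_coef q n (n - k.+1)).
Proof.
move=> kn; rewrite ladder_coef_qnum ?leq_subr// subnSK// subKn// /qalpha mulrC.
congr (Num.sqrt (qnum q _ * qnum q _)).
  by rewrite natrB ?(ltnW kn)//; field.
by rewrite -natr1; field.
Qed.

Lemma qalpha_down k : (0 < k <= n)%N ->
  qalpha q (k%:R - n%:R / 2) (n%:R / 2) = Num.sqrt (ladder_coef q n (n - k)).
Proof.
move=> /andP[k0 kn]; rewrite ladder_coef_qnum ?leq_subr// subKn// /qalpha mulrC.
congr (Num.sqrt (qnum q _ * qnum q _)).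
  by rewrite -[(n - k).+1%:R]natr1 natrB//; field.
by field.
Qed.

End QuantumNumbers.

Section SpinRepresentations.
Variables (R : realType) (q : R) (hq : 0 < q < 1).
Local Notation C := R[i].
Local Notation U := (Uqsu2 q).
Local Notation X := (UOSUq2 hq).
Local Notation p := (qhalf q).
Local Notation ugen := (ugen hq).
Variables (Hh : hilbertType R) (pih : starRep X Hh) (vh : Hh).
Hypotheses (vh_inv : inv_vector pih vh) (vh1 : hdot vh vh = 1).
Hypothesis vh_total : forall u, (forall x, hdot u (rop pih (inO hq x) vh) = 0) -> u = 0.
Local Notation hbasis := (hbasis (pih := pih) (vh := vh)).
Variable b : spin_index pih vh.
Local Notation n := (spin_dim b).

Let eb (k : 'I_n.+1) : Hh := hbasis (spin_pair k).

Lemma spin_basis_orthonormal : orthonormal_family eb.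
Proof.
by move=> i k; rewrite /eb (hbasis_orthonormal vh_inv vh1) eq_Tagged.
Qed.

Definition spin_space : hilbertType R := span_hilbert spin_basis_orthonormal.
Local Notation V := spin_space.
Let vec (v : V) : Hh := span_vec v.
Let coord (u : Hh) : V := span_coord spin_basis_orthonormal u.

Let vec_dom v : rdom pih (vec v).
Proof.
by apply: rdom_fsum => k _; apply: rdomZ; exact: (hbasis_dom vh_inv).
Qed.

(** A block is invariant under U, so projecting back to it changes nothing. Hence the compressions
    [spin_op] are multiplicative. *)
Let vecK f v : vec (coord (rop pih (inU hq f) (vec v))) = rop pih (inU hq f) (vec v).
Proof.
set w := rop _ _ _; apply/eqP; rewrite -subr_eq0; apply/eqP.
apply: (hbasis_total vh_inv vh_total) => -[b' r]; rewrite hdotBl.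
have [e|ne] := eqVneq b' b.
  by subst b'; rewrite [X in X - _](hdot_span_vec (coord w) r) mxE subrr.
rewrite /vec /span_vec hdot_suml big1 ?sub0r => [|k _]; last first.
  rewrite hdotZl (hbasis_orthonormal vh_inv vh1); case: eqP => [/(congr1 tag)/= e|_].
    by rewrite e eqxx in ne.
  by rewrite mulr0.
rewrite /w rop_sumr => [|k _]; last by apply: rdomZ; exact: (hbasis_dom vh_inv).
rewrite hdot_suml big1 ?oppr0// => k _; rewrite ropZr; last exact: (hbasis_dom vh_inv).
by rewrite hdotZl (hbasis_block vh_inv vh1) ?mulr0.
Qed.

Let spin_op (f : U) (v : V) : V := coord (rop pih (inU hq f) (vec v)).
Let vec_op f v : vec (spin_op f v) = rop pih (inU hq f) (vec v).
Proof. exact: vecK. Qed.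
Let vec_inj (u v : V) : vec u = vec v -> u = v.
Proof. exact: span_vec_inj. Qed.
Let vecL c (u v : V) : vec (c *: u + v) = c *: vec u + vec v.
Proof. exact: span_vec_linear. Qed.
Let vecD (u v : V) : vec (u + v) = vec u + vec v.
Proof. exact: span_vecD. Qed.
Let vecZ c (u : V) : vec (c *: u) = c *: vec u.
Proof. exact: span_vecZ. Qed.

Definition spin_rep : starRep U V.
Proof.
refine (@StarRep R U V [set: V] spin_op I (fun _ _ _ _ _ => I) _
  (fun _ _ _ => I) _ _ _ _ _ _).
- by move=> O [v Ov] _; exists v.
- move=> f c u v _ _; apply: vec_inj; rewrite vecL !vec_op vecL.
  by rewrite rop_linear.
- by move=> f g u _; apply: vec_inj; rewrite vecD !vec_op shomD ropD.
- by move=> c f u _; apply: vec_inj; rewrite vecZ !vec_op shomZ ropZ.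
- by move=> f g u _; apply: vec_inj; rewrite !vec_op shomM ropM.
- by move=> u _; apply: vec_inj; rewrite !vec_op shom1 rop1.
- move=> f u v _ _; rewrite !hdot_fin_span -!/(vec _) !vec_op.
  by rewrite shom_star rop_star.
Defined.

Definition spin_vec (k : 'I_n.+1) : V := coord (eb k).

Lemma span_spin_vec k : span_vec (spin_vec k) = hbasis (spin_pair k).
Proof.
rewrite /span_vec (bigD1 k)//= mxE spin_basis_orthonormal eqxx scale1r big1 ?addr0// => i ik.
by rewrite mxE spin_basis_orthonormal eq_sym (negPf ik) scale0r.
Qed.

Lemma spin_vec_orthonormal : orthonormal_family spin_vec.
Proof. by move=> i k; rewrite hdot_fin_span !span_spin_vec spin_basis_orthonormal. Qed.

Lemma hdot_spin_vec (v : V) k : hdot v (spin_vec k) = v 0 k.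
Proof.
by rewrite hdot_fin_span span_spin_vec; exact: (hdot_span_vec (v : fin_span spin_basis_orthonormal)).
Qed.

Lemma spin_vec_total : total_family spin_vec.
Proof.
move=> v hv; apply: vec_inj; rewrite /vec /span_vec big1 => [|k _].
  by rewrite big1// => k _; rewrite mxE scale0r.
by rewrite -hdot_spin_vec hv scale0r.
Qed.

Lemma rop_spin_rep f v : span_vec (rop spin_rep f v) = rop pih (inU hq f) (span_vec v).
Proof. exact: vec_op. Qed.

Lemma spin_rep_is_spin : is_spin_rep n spin_rep.
Proof.
have hw := spin_top_highest_weight vh_inv b.
have eMr (k : 'I_n.+1) : hbasis (spin_pair k) =
    rop pih (orbit_elt hq n k) (rop pih (spin_top b) vh) by rewrite (hbasisE vh_inv).
(* Bases are indexed by the number of applications of F to a highest weight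
   vector, whereas is_spin_rep starts from the lowest weight. *)
exists (fun k => spin_vec (rev_ord k)); split.
- by move=> i k; rewrite spin_vec_orthonormal (inj_eq rev_ord_inj).
- move=> v; apply/eqP; rewrite -subr_eq0; apply/eqP/spin_vec_total => k.
  rewrite hdotBl hdot_suml (bigD1 (rev_ord k))//= rev_ordK hdotZl spin_vec_orthonormal.
  rewrite eqxx mulr1 big1 ?addr0 ?subrr// => i ik.
  rewrite hdotZl spin_vec_orthonormal (_ : (rev_ord i == k) = false) ?mulr0//.
  by apply: contraNF ik => /eqP <-; rewrite rev_ordK.
- by [].
move=> k j.
have kn : (k <= n)%N by rewrite -ltnS.
have rE : nat_of_ord (rev_ord k) = (n - k)%N by rewrite /= subSS.
have nk : (n - k <= n)%N by rewrite leq_subr.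
split; apply: vec_inj; rewrite vec_op /vec span_vecZ span_spin_vec eMr rE.
- by rewrite (orbit_elt_K hw) /j (weight_powR hq).
- have -> : (k%:Z + 1)%R = k.+1%:Z :> int by lia.
  have [kn'|nk'] := ltnP k n; last first.
    have -> : (n - k = 0)%N by apply/eqP; rewrite subn_eq0.
    rewrite /ext_basis insubN -?leqNgt// (orbit_elt_E0 hw).
    by rewrite span_vec0 scaler0.
  have k1 : (k.+1 < n.+1)%N by [].
  have -> : (n - k = (n - k.+1).+1)%N by lia.
  rewrite (orbit_elt_E hw) ?(qalpha_up hq)//; last by lia.
  rewrite /ext_basis insubT span_spin_vec eMr /= subSS.
  by rewrite /j.
- rewrite /j {j}; case: k kn rE nk => -[|k] hk kn rE nk /=.
    by rewrite subn0 (orbit_elt_Fn hw) span_vec0 scaler0.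
  rewrite (orbit_elt_F hw); last by lia.
  rewrite (qalpha_down hq)//= subn1 /= insubT; first by lia.
  by move=> h; rewrite span_spin_vec eMr /= subSS subnSK.
Qed.

End SpinRepresentations.

(** * Inner products in Hilbert space direct sums *)

Section DirectSumUnitary.
Variables (R : realType) (H : hilbertType R) (I : choiceType) (K : I -> hilbertType R).

Lemma hsum_sqnormD1 (f : forall i, K i) i0 : hsum_sqnorm f =
  ((sqnorm (f i0))%:E + \esum_(i in ~` [set i0]) (sqnorm (f i))%:E)%E.
Proof.
rewrite /hsum_sqnorm (esumID [set i0]) => [|i _]; last by rewrite lee_fin sqnorm_ge0.
by rewrite !setTI esum_set1// lee_fin sqnorm_ge0.
Qed.

Definition hsum_incl i0 (k : K i0) : forall i, K i := eqtype.dfwith (fun i => 0 : K i) k.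

Lemma hsum_incl_sqnorm i0 (k : K i0) : hsum_sqnorm (hsum_incl k) = (sqnorm k)%:E.
Proof.
rewrite (hsum_sqnormD1 _ i0) /hsum_incl dfwith_in esum1 ?adde0// => i /= /eqP ii0.
by rewrite dfwith_out ?sqnorm0// eq_sym.
Qed.

Variable W : H -> forall i, K i.
Hypothesis uW : hsum_unitary W.

Lemma hsum_unitary0 u : (forall i, W u i = 0) -> u = 0.
Proof.
move=> Wu; case: uW => _ /(_ u) + _; rewrite /hsum_sqnorm esum1 => [[e]|i _].
  by apply: sqnorm_eq0.
by rewrite Wu sqnorm0.
Qed.

Lemma hsum_unitaryD u v i : W (u + v) i = W u i + W v i.
Proof. by case: uW => /(_ 1 u v i) + _ _; rewrite !scale1r. Qed.
Lemma hsum_unitaryZ c u i : W (c *: u) i = c *: W u i.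
Proof.
have W0 : W 0 i = 0 by apply: (@addrI _ (W 0 i)); rewrite -hsum_unitaryD !addr0.
by case: uW => /(_ c u 0 i) + _ _; rewrite W0 !addr0.
Qed.

Lemma hsum_unitary_inj u v : (forall i, W u i = W v i) -> u = v.
Proof.
move=> uv; apply/eqP; rewrite -subr_eq0 -scaleN1r; apply/eqP/hsum_unitary0 => i.
by rewrite hsum_unitaryD hsum_unitaryZ uv scaleN1r subrr.
Qed.

Lemma hsum_unitary_incl i0 (k : K i0) : exists v, W v = hsum_incl k.
Proof.
case: uW => _ _ /(_ (hsum_incl k)); rewrite hsum_incl_sqnorm ltry => /(_ isT)[v hv].
by exists v; apply: functional_extensionality_dep.
Qed.

(** [hsum_unitary] speaks of norms only, so the inner product is recovered by polarization: adding c
    v to u changes only the component i0, and the changes of the squared norms agree. *)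
Lemma hsum_unitary_hdot i0 (k : K i0) u v : W v = hsum_incl k ->
  hdot u v = hdot (W u i0) k.
Proof.
move=> Wv; set z := hdot u v - hdot (W u i0) k.
(* The part of the squared norm outside i0 is a finite real number and can be cancelled. *)
have fin w : exists t : R,
    (\esum_(i in ~` [set i0]) (sqnorm (W w i))%:E)%E = t%:E :> \bar R /\
    sqnorm w = sqnorm (W w i0) + t.
  case: uW => _ /(_ w) + _; rewrite (hsum_sqnormD1 _ i0).
  case: (esum _ _) => [t| |] //=; rewrite -EFinD => -[<-].
  by exists t.
have key c : sqnorm (u + c *: v) - sqnorm u = sqnorm (W u i0 + c *: k) - sqnorm (W u i0).
  have [t [e1 ->]] := fin u; have [t' [e2 ->]] := fin (u + c *: v).
  have Wi : W (u + c *: v) i0 = W u i0 + c *: k.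
    by rewrite hsum_unitaryD hsum_unitaryZ Wv /hsum_incl dfwith_in.
  have -> : t' = t.
    apply: EFin_inj; rewrite -e1 -e2; apply: eq_esum => i /= /eqP ii0.
    by rewrite hsum_unitaryD hsum_unitaryZ Wv /hsum_incl dfwith_out ?scaler0 ?addr0// eq_sym.
  by rewrite Wi; ring.
have vk : sqnorm v = sqnorm k.
  by case: uW => _ /(_ v) + _; rewrite Wv hsum_incl_sqnorm => -[].
have keyC c : c * (hdot u v)^*%R + c^*%R * hdot u v =
    c * (hdot (W u i0) k)^*%R + c^*%R * hdot (W u i0) k.
  have := congr1 (real_complex R) (key c).
  rewrite !rmorphB /= -!hdot_sqnorm !(hdotDl, hdotDr, hdotZl, hdotZr).
  rewrite (hdot_sqnorm v) (hdot_sqnorm k) vk (hdotC v u) (hdotC k (W u i0)).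
  move=> /eqP; rewrite -subr_eq0 => /eqP e; apply/eqP; rewrite -subr_eq0; apply/eqP.
  by rewrite -[RHS]e; ring.
suff : z = 0 by move/eqP; rewrite subr_eq0 => /eqP.
apply: sqmod_eq0; apply: (@complexI R); rewrite sqmodE rmorph0.
(* The choice c = z turns the polarized identity into the vanishing of twice the squared modulus of
   z. *)
have : z * z^*%R + z^*%R * z = 0.
  move: (keyC z) => /eqP; rewrite -subr_eq0 => /eqP <-.
  by rewrite {2 4}/z rmorphB /=; ring.
by rewrite [z^*%R * z]mulrC -mulr2n => /eqP; rewrite mulrn_eq0 => /eqP.
Qed.

End DirectSumUnitary.

(** * Integrability of the Heisenberg representation, and its multiples *)

Section HeisenbergIntegrable.
Variables (R : realType) (q : R) (hq : 0 < q < 1).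
Local Notation C := R[i].
Local Notation U := (Uqsu2 q).
Local Notation X := (UOSUq2 hq).
Variables (Hh : hilbertType R) (pih : starRep X Hh) (vh : Hh).
Hypotheses (vh_inv : inv_vector pih vh) (vh1 : hdot vh vh = 1).
Hypothesis vh_total : forall u, (forall x, hdot u (rop pih (inO hq x) vh) = 0) -> u = 0.
Hypothesis pih_closed : rep_closed pih.
Local Notation hbasis := (hbasis (pih := pih) (vh := vh)).
Local Notation spin_pairs := (spin_pairs pih vh).

Definition spin_block (b : spin_index pih vh) : {fset spin_pairs} :=
  [fset m : spin_pairs in [seq @spin_pair _ _ _ _ _ _ b k | k <- enum 'I_(spin_dim b).+1]]%fset.

Lemma mem_spin_block b m : (m \in spin_block b) = (tag m == b).
Proof.
rewrite in_fset /=; apply/mapP/eqP => [[k _ ->]//|].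
by case: m => b' k /= e; subst b'; exists k; rewrite ?mem_enum.
Qed.

(** A test of membership that involves U alone, although the domain is defined by the whole cross
    product. The finite blocks of the basis serve as stable sets. *)
Lemma rdom_pih_adjoint u : (forall f, exists v, forall m,
  hdot v (hbasis m) = hdot u (rop pih (inU hq (star f)) (hbasis m))) -> rdom pih u.
Proof.
move=> /choice[v hv]; rewrite pih_closed.
apply: (@adjoint_in_closure_dom _ _ _ _ (inU hq) (inO hq) _ pih _ hbasis) hv => //.
- exact: (hbasis_orthonormal vh_inv vh1).
- exact: (hbasis_total vh_inv vh_total).
- exact: (hbasis_dom vh_inv).
- exact: inO_bounded.
- exact: AU_sumT.
- move=> m; exists (spin_block (tag m)) => [f k k'|]; last by rewrite mem_spin_block.
  rewrite !mem_spin_block => /eqP km k'm; apply: (hbasis_block vh_inv vh1).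
  by rewrite km.
Qed.

Lemma heisenberg_integrable : integrable_rep (rep_res (inU hq) pih).
Proof.
split.
  apply/seteqP; split=> [u Du|u hu]; first exact: rdom_sub_closure.
  apply: rdom_pih_adjoint => f; have [v hv] := hu f; exists v => m.
  have Dm : rdom (rep_res (inU hq) pih) (hbasis m) by exact: (hbasis_dom vh_inv m).
  exact: (graph_closure_adj hv Dm).
exists (spin_index pih vh), (fun b => spin_dim b).
exists (fun b => spin_space vh_inv vh1 b), (fun b => spin_rep vh_inv vh1 vh_total b).
split; first by move=> b; exact: spin_rep_is_spin.
apply: (@equiv_direct_sum_bases _ _ _ _ _ (fun b => 'I_(spin_dim b).+1) _ _
  (fun b k => hbasis (spin_pair k)) (fun b k => spin_vec vh_inv vh1 k)).
- move=> [b k] [b' k'] /=; exact: (hbasis_orthonormal vh_inv vh1).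
- move=> u hu; apply: (hbasis_total vh_inv vh_total) => -[b k]; exact: (hu (existT _ b k)).
- by move=> b; exact: spin_vec_orthonormal.
- by move=> b; exact: spin_vec_total.
- by move=> b k; exact: (hbasis_dom vh_inv).
- by [].
- move=> f b k; set w := rop (spin_rep vh_inv vh1 vh_total b) f (spin_vec vh_inv vh1 k).
  pose S : {fset 'I_(spin_dim b).+1} := [fset j in enum 'I_(spin_dim b).+1]%fset.
  exists S, (fun j => hdot w (spin_vec vh_inv vh1 j)).
  have wE : w = fcomb (fun j => spin_vec vh_inv vh1 j) (fun j => hdot w (spin_vec vh_inv vh1 j)) S.
    apply: total_expand; [exact: spin_vec_orthonormal|exact: spin_vec_total|].
    by move=> j; rewrite in_fset /= mem_enum.
  split=> //; rewrite /= -(span_spin_vec vh_inv vh1) -rop_spin_rep -/w {1}wE.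
  rewrite /fcomb; elim: (enum_fset S) => [|j s IH]; first by rewrite !big_nil span_vec0.
  by rewrite !big_cons span_vecD span_vecZ span_spin_vec IH.
- move=> u hu; apply: rdom_pih_adjoint => f; have [v hv] := hu f; exists v => -[b k].
  exact: hv.
- by [].
Qed.

Section Multiples.
Variables (H : hilbertType R) (pi : starRep X H) (pi_closed : rep_closed pi).
Variables (I : choiceType) (xi : I -> H).
Hypothesis xi_inv : forall i, inv_vector pi (xi i).
Hypothesis xi_orth : orthonormal_family xi.
Hypothesis xi_total : forall u, (forall i x, hdot (rop pi x (xi i)) u = 0) -> u = 0.

Let E i (m : spin_pairs) := rop pi (hbasis_elt m) (xi i).
Let E' (t : {i : I & spin_pairs}) := E (tag t) (tagged t).

Let Dxi i : rdom pi (xi i). Proof. by case: (xi_inv i). Qed.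

Let DE i m : rdom pi (E i m). Proof. exact: rop_dom. Qed.

Let E_hdot i m i' m' : hdot (E i m) (E i' m') = (m == m')%:R * (i == i')%:R.
Proof.
rewrite (inv_hdot2 vh_inv vh1 _ _ (xi_inv i) (xi_inv i')) xi_orth.
by rewrite -!/(hbasis _) (hbasis_orthonormal vh_inv vh1).
Qed.

(** The expansion of x vh in the basis is an identity at [vh]; [inv_transfer] carries it to each
    [xi i] with the same coefficients. *)
Let E_fcomb x : exists S c, forall i,
  rop pi x (xi i) = fcomb (E i) c S /\ rop pih x vh = fcomb hbasis c S.
Proof.
have [S [c xE]] := hbasis_fcomb vh_inv vh1 vh_total x; exists S, c => i; split=> //.
have [_ Dvh] := conj (xi_inv i) (proj1 vh_inv).
have := @inv_transfer _ _ _ _ _ _ vh_inv vh1 _ pi (xi i) x (\sum_(m <- S) c m *: hbasis_elt m) (xi_inv i).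
rewrite xE !rop_suml//; under eq_bigr do rewrite ropZ//.
by move=> /(_ erefl) ->; apply: eq_bigr => m _; rewrite ropZ.
Qed.

Lemma equiv_heisenberg_multiple : equiv_direct_sum pi (fun _ : I => pih).
Proof.
have oE : orthonormal_family E'.
  move=> [i m] [i' m']; rewrite /E' /= E_hdot; have [e|ne] := eqVneq i i'.
    by subst i'; rewrite mulr1 eq_Tagged.
  by rewrite mulr0; case: eqP => // /(congr1 tag) /= e; rewrite e eqxx in ne.
have tE : total_family E'.
  move=> u hu; apply: xi_total => i x; have [S [c /(_ i)[-> _]]] := E_fcomb x.
  rewrite hdot_suml big1// => m _.
  by rewrite hdotZl hdotC (hu (existT _ i m)) rmorph0 mulr0.
apply: (@equiv_direct_sum_bases _ _ _ _ _ (fun _ => spin_pairs) _ _ E (fun _ m => hbasis m)) => //.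
- by move=> _; exact: (hbasis_orthonormal vh_inv vh1).
- by move=> _; exact: (hbasis_total vh_inv vh_total).
- by move=> _ m; exact: (hbasis_dom vh_inv).
- move=> x i m; have [S [c /(_ i)[h1 h2]]] := E_fcomb (x * hbasis_elt m); exists S, c.
  split; first by rewrite -h1 ropM.
  by rewrite -h2 ropM//; case: vh_inv.
- move=> u hu; rewrite pi_closed.
  have /choice[v hv] f : exists v, forall t, hdot v (E' t) =
      hdot u (rop pi (inU hq (star f)) (E' t)).
    by have [v hv] := hu (inU hq f); exists v => -[i m]; rewrite shom_star hv.
  apply: (@adjoint_in_closure_dom _ _ _ _ (inU hq) (inO hq) _ pi _ E') hv => //.
  + by move=> -[i m]; exact: DE.
  + exact: inO_bounded.
  + exact: AU_sumT.
  move=> [i m].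
  (* The stable set around (i, m) is the block of m inside the i-th copy. *)
  exists [fset t : {i : I & spin_pairs} in [seq existT _ i k | k <- spin_block (tag m)]]%fset.
    move=> f [j k] [j' k'].
    rewrite !in_fset /= => /mapP[l lm] /(congr1 (fun t : {_ : I & spin_pairs} =>
      (tag t, tagged t))) /= [-> ->] nk.
    rewrite /E' /= /E -ropM//.
    rewrite (inv_hdot2 vh_inv vh1 _ _ (xi_inv i) (xi_inv j')) xi_orth.
    have [ij|_] := eqVneq i j'; last by rewrite mulr0.
    rewrite ropM; last by case: vh_inv.
    have kl : tag k' != tag l.
      move: lm; rewrite mem_spin_block => /eqP ->.
      apply: contraNneq nk => km; apply/mapP; exists k'; rewrite ?mem_spin_block ?km//.
      by rewrite ij.
    by rewrite (hbasis_block vh_inv vh1 f kl) mul0r.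
  rewrite in_fset /=; apply/mapP; exists m => //; by rewrite mem_spin_block.
- move=> i u hu; apply: rdom_pih_adjoint => f; have [v hv] := hu (inU hq f).
  by exists v => m; rewrite hv shom_star.
Qed.

End Multiples.
End HeisenbergIntegrable.

Section DirectSumInclusion.
Variables (R : realType) (X : starAlgType R) (I : choiceType).
Variables (K : I -> hilbertType R) (rho : forall i, starRep X (K i)).

Lemma hsum_inclZ i (w : K i) c k : hsum_incl (c *: w) k = c *: hsum_incl w k.
Proof.
rewrite /hsum_incl; have [ik|ik] := eqVneq i k.
  by subst k; rewrite !eqtype.dfwith_in.
by rewrite !eqtype.dfwith_out// scaler0.
Qed.

Lemma rop_hsum_incl x i (w : K i) k :
  rop (rho k) x (hsum_incl w k) = hsum_incl (rop (rho i) x w) k.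
Proof.
rewrite /hsum_incl; have [ik|ik] := eqVneq i k.
  by subst k; rewrite !eqtype.dfwith_in.
by rewrite !eqtype.dfwith_out// rop0r.
Qed.

Lemma hsum_rdom_incl i (w : K i) : rdom (rho i) w -> hsum_rdom rho (hsum_incl w).
Proof.
move=> Dw; split=> [k|x].
  rewrite /hsum_incl; have [ik|ik] := eqVneq i k.
    by subst k; rewrite eqtype.dfwith_in.
  by rewrite eqtype.dfwith_out//; exact: rdom0.
have -> : (fun k => rop (rho k) x (hsum_incl w k)) = hsum_incl (rop (rho i) x w).
  by apply: functional_extensionality_dep => k; exact: rop_hsum_incl.
by rewrite hsum_incl_sqnorm ltry.
Qed.

End DirectSumInclusion.

(** * Invariant vectors of integrable representations *)

Section InvariantFamily.
Variables (R : realType) (q : R) (hq : 0 < q < 1).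
Local Notation C := R[i].
Local Notation U := (Uqsu2 q).
Local Notation X := (UOSUq2 hq).
Local Notation p := (qhalf q).
Local Notation ugen := (ugen hq).
Variables (Hh : hilbertType R) (pih : starRep X Hh) (vh : Hh).
Hypotheses (vh_inv : inv_vector pih vh) (vh1 : hdot vh vh = 1).
Variables (H : hilbertType R) (pi : starRep X H).

Lemma inv_vector0 : inv_vector pi 0.
Proof. by split=> [|g]; rewrite ?rop0r ?scaler0//; exact: rdom0. Qed.
Lemma inv_vectorZ c u : inv_vector pi u -> inv_vector pi (c *: u).
Proof.
move=> [Du gu]; split=> [|g]; first exact: rdomZ.
by rewrite ropZr// gu !scalerA mulrC.
Qed.
Lemma inv_vectorD u v : inv_vector pi u -> inv_vector pi v -> inv_vector pi (u + v).
Proof.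
move=> [Du gu] [Dv gv]; split=> [|g]; first exact: rdomD.
by rewrite ropDr// gu gv scalerDr.
Qed.

Variables (I : choiceType) (n : I -> nat) (K : I -> hilbertType R).
Variable T : forall i, starRep U (K i).
Variable e : forall i, 'I_(n i).+1 -> K i.
Hypothesis e_orth : forall i, orthonormal_family (@e i).
Hypothesis e_exp : forall i w, w = \sum_k hdot w (@e i k) *: @e i k.
Hypothesis T_dom : forall i, rdom (T i) = [set: K i].
Hypothesis T_act : forall i (k : 'I_(n i).+1), let l : R := (n i)%:R / 2 in
  let j : R := k%:R - l in
  [/\ rop (T i) (uq_elt q genK) (e k) = (q `^ j)%:C *: e k,
      rop (T i) (uq_elt q genE) (e k) =
        (qalpha q (j + 1) l)%:C *: ext_basis (@e i) (k%:Z + 1) &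
      rop (T i) (uq_elt q genF) (e k) =
        (qalpha q j l)%:C *: ext_basis (@e i) (k%:Z - 1)].
Variable W : H -> forall i, K i.
Hypothesis uW : hsum_unitary W.
Hypothesis domW : forall u, rdom pi u <-> hsum_rdom T (W u).
Hypothesis opW : forall x u i, rdom pi u ->
  W (rop pi (inU hq x) u) i = rop (T i) x (W u i).

Variable v : forall i, 'I_(n i).+1 -> H.
Hypothesis vW : forall i k, W (@v i k) = hsum_incl (@e i k).

Let Dv i k : rdom pi (@v i k).
Proof. by apply/domW; rewrite vW; apply: hsum_rdom_incl; rewrite T_dom. Qed.

Let op_v f i k c (k' : 'I_(n i).+1) : rop (T i) f (e k) = c *: e k' ->
  rop pi (inU hq f) (v k) = c *: v k'.
Proof.
move=> fe; apply: (hsum_unitary_inj uW) => j.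
by rewrite opW// (hsum_unitaryZ uW) !vW rop_hsum_incl fe hsum_inclZ.
Qed.

Let op_v0 f i (k : 'I_(n i).+1) : rop (T i) f (e k) = 0 -> rop pi (inU hq f) (v k) = 0.
Proof. by move=> fe; rewrite (@op_v f i k 0 k) ?scale0r// fe. Qed.

Let hdot_v u i (k : 'I_(n i).+1) : hdot u (v k) = hdot (W u i) (e k).
Proof. exact: hsum_unitary_hdot. Qed.

Let V (t : {i : I & 'I_(n i).+1}) := v (tagged t).

Let V_orth : orthonormal_family V.
Proof.
move=> [i k] [j l]; rewrite /V /= hdot_v vW /hsum_incl.
have [ij|ij] := eqVneq i j.
  by subst j; rewrite eqtype.dfwith_in e_orth eq_Tagged.
rewrite eqtype.dfwith_out// hdot0l; case: eqP => // /(congr1 tag) /= h.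
by rewrite h eqxx in ij.
Qed.

Let V_total : total_family V.
Proof.
move=> u hu; apply: (hsum_unitary0 uW) => i; rewrite [LHS]e_exp big1// => k _.
by rewrite -hdot_v (hu (existT _ i k)) scale0r.
Qed.

Let v_E i (k k' : 'I_(n i).+1) : k' = k.+1 :> nat ->
  rop pi (ugen genE) (v k) = (Num.sqrt (ladder_coef q (n i) (n i - k'))) %:C *: v k'.
Proof.
move=> kk; have kn : (k < n i)%N by rewrite -ltnS -kk.
apply: op_v; have [_ + _] := T_act k => ->; rewrite (qalpha_up hq kn) kk.
congr (_ *: _); rewrite /ext_basis (_ : k%:Z + 1 = k'%:Z); last by rewrite kk; lia.
by rewrite valK.
Qed.

Let v_F i (k k' : 'I_(n i).+1) : k = k'.+1 :> nat ->
  rop pi (ugen genF) (v k) = (Num.sqrt (ladder_coef q (n i) (n i - k))) %:C *: v k'.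
Proof.
move=> kk; have kn : (0 < k <= n i)%N by rewrite kk /= -ltnS -kk.
apply: op_v; have [_ _] := T_act k => ->; rewrite (qalpha_down hq kn).
congr (_ *: _); rewrite /ext_basis (_ : k%:Z - 1 = k'%:Z); last by rewrite kk; lia.
by rewrite valK.
Qed.

Let v_top i : highest_weight pi (n i) (v (@ord_max (n i))).
Proof.
split=> //.
- apply: op_v0; have [_ + _] := T_act (@ord_max (n i)) => ->.
  rewrite /ext_basis (_ : (@ord_max (n i))%:Z + 1 = (n i).+1%:Z); last by rewrite /=; lia.
  by rewrite insubN ?ltnn// scaler0.
- apply: op_v; have [+ _ _] := T_act (@ord_max (n i)) => ->.
  by rewrite (weight_powR hq (leqnn _)) subnn expr0 invr1 mulr1.
Qed.

Let coef_neq0 i k : (0 < k <= n i)%N ->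
  (Num.sqrt (ladder_coef q (n i) (n i - k)))%:C != 0 :> C.
Proof.
move=> kn; rewrite -(rmorph0 (real_complex R)) (inj_eq (@complexI R)) gt_eqF//.
by rewrite sqrtr_gt0 ladder_coef_gt0//; lia.
Qed.

(** Induction on the distance from the highest weight: F descends by one step with a nonzero
    coefficient. *)
Let v_orbit i (k : 'I_(n i).+1) : exists x : X, v k = rop pi x (v (@ord_max (n i))).
Proof.
have : exists d, (k + d = n i)%N by exists (n i - k)%N; rewrite subnKC// -ltnS.
case=> d; elim: d k => [|d IH] k kd.
  exists 1; rewrite rop1//; congr (v _); apply: val_inj.
  by move: kd; rewrite /= addn0.
have k1 : (k.+1 < (n i).+1)%N by move: (nat_of_ord k) kd => m; lia.
have [|x hx] := IH (Ordinal k1); first by move: kd; rewrite /= addnS addSn.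
have hF := @v_F i (Ordinal k1) k erefl.
have c0 := @coef_neq0 i k.+1 (ltac:(by [])).
exists ((Num.sqrt (ladder_coef q (n i) (n i - k.+1)))%:C^-1 *: (ugen genF * x)).
by rewrite ropZ// ropM// -hx hF scalerA mulVf// scale1r.
Qed.

(** The summands T_0. By [inv_support], their basis vectors carry all nonzero coefficients of any
    invariant vector. *)
Definition inv_index := {i : I | n i == 0%N}.
HB.instance Definition _ := Choice.on inv_index.
Definition inv_family (i : inv_index) : H := v (@ord0 (n (val i))).

Lemma inv_family_inv i : inv_vector pi (inv_family i).
Proof.
have n0 : n (val i) = 0%N by apply/eqP; exact: (valP i).
apply: (hw0_inv (hq := hq)).
have -> : inv_family i = v (@ord_max (n (val i))).
  by congr (v _); apply: val_inj; rewrite /= n0.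
by move: (v ord_max) (v_top (val i)) => w; rewrite n0.
Qed.

Lemma inv_family_orth : orthonormal_family inv_family.
Proof.
move=> i j; rewrite (V_orth (existT _ (val i) ord0) (existT _ (val j) ord0)).
congr (nat_of_bool _)%:R; apply/eqP/eqP => [/(congr1 tag)/val_inj//|->//].
Qed.

(** In a summand of positive spin the lowest basis vector is a multiple of some F w and every other
    one of some E w; since eta is killed by both E and F, adjunction makes it orthogonal to all of
    them. *)
Let inv_support eta : inv_vector pi eta -> forall t,
  (exists i, V t = inv_family i) \/ hdot eta (V t) = 0.
Proof.
move=> [Deta geta] [i k]; rewrite /V /=.
have [n0|n0] := eqVneq (n i) 0%N.
  left; exists (exist _ i (introT eqP n0)); congr (v _); apply: val_inj => /=.
  by apply/eqP; rewrite -leqn0 -n0 -ltnS.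
right; have scal c w : c != 0 -> hdot eta (c *: w) = 0 -> hdot eta w = 0.
  move=> c0; rewrite hdotZr => /eqP; rewrite mulf_eq0 conjC_eq0 (negPf c0).
  by move/eqP.
case k0 : (nat_of_ord k) => [|m].
  have k1 : (1 < (n i).+1)%N by rewrite ltnS lt0n.
  have hF := @v_F i (Ordinal k1) k (ltac:(by rewrite k0)).
  apply: (scal (Num.sqrt (ladder_coef q (n i) (n i - 1)))%:C).
    by apply: coef_neq0; move: n0; lia.
  by rewrite -hF -hdot_E// geta scale0r hdot0l.
have km : (m < (n i).+1)%N by rewrite -k0 ltnW.
have hE := @v_E i (Ordinal km) k k0.
apply: (scal (Num.sqrt (ladder_coef q (n i) (n i - k)))%:C).
  by apply: coef_neq0; rewrite k0 /= -k0 -ltnS.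
by rewrite -hE -hdot_F// geta scale0r hdot0l.
Qed.

(** [hw_orth] needs orthogonality for all invariant vectors, as [hw_lower] leads to invariant
    vectors outside the family. Although pi(x) may be unbounded, on an invariant vector eta the norm
    of pi(x) eta is that of pi_h(x) vh times that of eta, so orthogonality passes to limits of
    combinations of the family. *)
Lemma inv_family_total u : (forall i x, hdot (rop pi x (inv_family i)) u = 0) -> u = 0.
Proof.
move=> hu.
have inv_orth eta : inv_vector pi eta -> forall x, hdot (rop pi x eta) u = 0.
  move=> etaI x; have Deta : rdom pi eta by case: etaI.
  apply: (@sqmod_arb _ _ (sqnorm (rop pih x vh) * sqnorm u)) => eps e0.
  have [S /(_ S (fsubset_refl _))] := total_approx V_orth V_total eta e0.
  set s := fcomb V _ S => etas.
  have termI t : inv_vector pi (hdot eta (V t) *: V t).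
    have [[i ->]|->] := inv_support etaI t; first exact/inv_vectorZ/inv_family_inv.
    by rewrite scale0r; exact: inv_vector0.
  have sI : inv_vector pi s.
    rewrite /s /fcomb; elim: (enum_fset S) => [|t r IH].
      by rewrite big_nil; exact: inv_vector0.
    by rewrite big_cons; exact: inv_vectorD.
  have su : hdot (rop pi x s) u = 0.
    rewrite /s /fcomb rop_sumr => [|t _]; last by case: (termI t).
    rewrite hdot_suml big1// => t _.
    have [[i ->]|->] := inv_support etaI t; last by rewrite scale0r rop0r hdot0l.
    rewrite ropZr; last by case: (inv_family_inv i).
    by rewrite hdotZl hu mulr0.
  have Ds : rdom pi s by case: sI.
  have dI : inv_vector pi (eta - s).
    by rewrite -scaleN1r; apply: inv_vectorD => //; exact: inv_vectorZ.
  have -> : hdot (rop pi x eta) u = hdot (rop pi x (eta - s)) u.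
    by rewrite ropBr// hdotBl su subr0.
  apply: le_trans (hdot_CS _ _) _; rewrite mulrAC ler_wpM2r ?sqnorm_ge0//.
  have -> : sqnorm (rop pi x (eta - s)) = sqnorm (rop pih x vh) * sqnorm (eta - s).
    apply: (@complexI R); rewrite rcM -!hdot_sqnorm.
    exact: (inv_hdot2 vh_inv vh1).
  by rewrite ler_wpM2l ?sqnorm_ge0// ltW.
apply: V_total => -[i k]; rewrite /V /= hdotC.
have [x ->] := v_orbit k.
by rewrite (hw_orth inv_orth (v_top i)) rmorph0.
Qed.

End InvariantFamily.

(** * Decomposition into Heisenberg representations, and irreducibility *)

Section Main.
Variables (R : realType) (q : R) (hq : 0 < q < 1).
Local Notation C := R[i].
Local Notation X := (UOSUq2 hq).
Local Notation ugen := (ugen hq).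

Section Heisenberg.
Variables (Hh : hilbertType R) (pih : starRep X Hh) (vh : Hh).
Hypotheses (vh_inv : inv_vector pih vh) (vh1 : hdot vh vh = 1).
Hypothesis vh_total : forall u, (forall x, hdot u (rop pih (inO hq x) vh) = 0) -> u = 0.
Hypothesis pih_closed : rep_closed pih.

Lemma integrable_is_multiple (H : hilbertType R) (pi : starRep X H) :
  rep_closed pi -> integrable_rep (rep_res (inU hq) pi) ->
  exists I : choiceType, equiv_direct_sum pi (fun _ : I => pih).
Proof.
move=> pi_closed [_ [I [n [K [T [spin [W [uW domW opW]]]]]]]].
pose e i := projT1 (cid (spin i)).
have e_orth i : orthonormal_family (e i) by rewrite /e; case: (cid _) => ? [].
have e_exp i w : w = \sum_k hdot w (e i k) *: e i k.
  by move: w; rewrite /e; case: (cid _) => ? [].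
have T_dom i : rdom (T i) = [set: K i] by rewrite /e; case: (cid (spin i)) => ? [].
have T_act i := let: And4 _ _ _ h := projT2 (cid (spin i)) in h.
pose v i k := projT1 (cid (hsum_unitary_incl uW (e i k))).
have vW i k : W (v i k) = hsum_incl (e i k) by rewrite /v; case: (cid _).
exists (inv_index n).
apply: (equiv_heisenberg_multiple vh_inv vh1 vh_total pih_closed pi_closed
  (xi := inv_family v)).
- exact: (inv_family_inv (pi := pi) T_dom T_act uW domW opW vW).
- exact: (inv_family_orth e_orth uW vW).
- exact: (inv_family_total vh_inv vh1 (pi := pi) e_orth e_exp T_dom T_act uW domW opW vW).
Qed.

(** Against each x vh, both sides have the same inner product by [inv_hdot2], and these vectors are
    total. The uniqueness of the Haar functional thus makes the space of invariant vectors
    one-dimensional. *)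
Lemma inv_vector_line w : inv_vector pih w -> w = hdot w vh *: vh.
Proof.
move=> wI; have Dvh : rdom pih vh by case: vh_inv.
apply/eqP; rewrite -subr_eq0; apply/eqP/vh_total => x.
have Dw : rdom pih w by case: wI.
have h := inv_hdot2 vh_inv vh1 1 (inO hq x) wI vh_inv.
rewrite !rop1// in h.
by rewrite hdotBl hdotZl h mulrC subrr.
Qed.

(** If the component of [vh] along one summand is 0, cyclicity of [vh] makes that summand trivial
    ([killed]). The component along the summand [true], viewed in [Hh], is invariant and so a
    multiple of [vh]: either it is 0, or [vh] itself has no component along [false]. *)
Lemma heisenberg_irreducible : irreducible_rep pih.
Proof.
have Dvh : rdom pih vh by case: vh_inv.
split=> // -[K [rho [nz [W [uW domW opW]]]]].
have [Dr _] : hsum_rdom rho (W vh) by apply/domW.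
have killed b : W vh b = 0 -> False.
  move=> Wb; have [k k0] := nz b; have [u hu] := hsum_unitary_incl uW k.
  suff u0 : u = 0.
    move: k0; have -> : k = W u b by rewrite hu /hsum_incl eqtype.dfwith_in.
    by rewrite u0 -(scale0r (0 : Hh)) (hsum_unitaryZ uW) scale0r eqxx.
  apply: vh_total => x; rewrite hdotC (hsum_unitary_hdot uW _ hu).
  by rewrite opW// Wb rop0r hdot0l rmorph0.
have comp b : exists2 u, inv_vector pih u & W u = hsum_incl (W vh b).
  have [u hu] := hsum_unitary_incl uW (W vh b); exists u => //.
  have Du : rdom pih u by apply/domW; rewrite hu; exact: hsum_rdom_incl.
  split=> // g; apply: (hsum_unitary_inj uW) => k.
  rewrite opW// (hsum_unitaryZ uW) hu rop_hsum_incl -hsum_inclZ.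
  by rewrite -opW//; case: vh_inv => _ ->; rewrite (hsum_unitaryZ uW).
have [u uI hu] := comp true.
have uz := inv_vector_line uI.
have Wt : W u true = W vh true by rewrite hu /hsum_incl eqtype.dfwith_in.
have Wf : W u false = 0 by rewrite hu /hsum_incl eqtype.dfwith_out.
have [z0|z0] := eqVneq (hdot u vh) 0.
  apply: (killed true); rewrite -Wt uz (hsum_unitaryZ uW) z0 scale0r.
  by [].
apply: (killed false); apply/eqP; move: Wf; rewrite uz (hsum_unitaryZ uW) => /eqP.
by rewrite scaler_eq0 (negPf z0).
Qed.

End Heisenberg.

(** These four properties are all that the other arguments use of the Heisenberg representation.
    Invariance of [vh] comes from 1 <| S^-1(g) being the counit of g times 1. *)
Lemma heisenberg_vector (Hh : hilbertType R) (pih : starRep X Hh) :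
  is_heisenberg pih -> exists vh, [/\ inv_vector pih vh, hdot vh vh = 1,
    forall u, (forall x, hdot u (rop pih (inO hq x) vh) = 0) -> u = 0 &
    rep_closed pih].
Proof.
move=> [h [pi0 [vh [pit [[_ h1 _] [Dvh dom0 hpi] [domt opO opU] [domh oph]]]]]].
have pit_dom u : rdom pit u -> rdom pih u by rewrite domh; exact: rdom_sub_closure.
have pih_pit x u : rdom pit u -> rop pih x u = rop pit x u.
  by move=> Du; apply: graph_closure_closable => //; apply: oph; exact: pit_dom.
have Dt : rdom pit vh by rewrite domt.
exists vh; split.
- split=> [|g]; first exact: pit_dom.
  rewrite pih_pit//; have := opU (uq_elt q g) 1; rewrite rop1// => ->.
  rewrite (uq_antipVE hq) oq_act_op oq_op1 ropZ// rop1//; congr (_ *: _).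
  by case: g; rewrite /= ?mulr0.
- by rewrite -h1 hpi rop1.
- move=> u hu; apply: (dense_orth (@rdom_dense _ _ _ pit)) => w.
  rewrite domt dom0 => -[x _ <-].
  by rewrite -(opO x _ Dvh) -pih_pit// hu.
(* A closure is closed: an approximation in the graph of [pih] is followed by one in the graph of
   [pit], each within a quarter of eps because of the factors 2 in [sqnorm_triangle]. *)
- apply/seteqP; split=> [u|u hu]; first exact: rdom_sub_closure.
  rewrite domh => x; have [v hv] := hu x; exists v.
  apply/graph_closureP => eps e0; have e4 := divr_gt0 e0 (ltac:(by []) : 0 < 4 :> R).
  have [w [Dw w1 w2]] := (graph_closureP pih x u v).1 hv _ e4.
  have [w' [Dw' w1' w2']] := (graph_closureP pit x w _).1 (oph x w Dw) _ e4.
  exists w'; split=> //.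
    apply: le_lt_trans (sqnorm_triangle _ w _) _; move: w1 w1'; lra.
  apply: le_lt_trans (sqnorm_triangle _ (rop pih x w) _) _; move: w2 w2'; lra.
Qed.

End Main.

Theorem theorem5p5 (R : realType) (q : R) (hq : 0 < q < 1)
    (Hh : hilbertType R) (pih : starRep (UOSUq2 hq) Hh)
    (pih_heisenberg : is_heisenberg pih) :
  (forall (H : hilbertType R) (pi : starRep (UOSUq2 hq) H),
      rep_closed pi ->
      integrable_rep (rep_res (inU hq) pi) ->
      exists I : choiceType, equiv_direct_sum pi (fun _ : I => pih)) /\
  (irreducible_rep pih /\ integrable_rep (rep_res (inU hq) pih)).
Proof.
have [vh [vh_inv vh1 vh_total pih_closed]] := heisenberg_vector pih_heisenberg.
split=> [H pi|]; first exact: (integrable_is_multiple vh_inv vh1 vh_total pih_closed).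
split; first exact: (heisenberg_irreducible vh_inv vh1 vh_total pih_closed).
exact: (heisenberg_integrable vh_inv vh1 vh_total pih_closed).
Qed.
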